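(* For every pair of complex elliptic curves $E$ and $F$, \[ \operatorname{irr}(E\times F)=3 . \]
   Context: All varieties are over $\mathbb C$. For an irreducible projective variety $X$ of dimension $n$, the degree of irrationality is \[ \operatorname{irr}(X)=\min\{\deg(f)\mid f\colon X\dashrightarrow\mathbb P^n \text{ is a dominant rational map}\}. \] Here $\deg(f)$ is the degree of the induced function field extension $\mathbb C(\mathbb P^n)\subset\mathbb C(X)$. *)

(* Defs.v *)
From HB Require Import structures.
From mathcomp Require Import all_boot all_order all_algebra.
From mathcomp Require Import generic_quotient ring_quotient fraction.
From mathcomp Require Import boolp classical_sets reals complex mpoly.

Set Implicit Arguments.
Unset Strict Implicit.
Unset Printing Implicit Defensive.

Import GRing.Theory.

Local Open Scope quotient_scope.
Local Open Scope ring_scope.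
Local Open Scope classical_set_scope.

(* A subset of P^n is represented by the set of all its homogeneous coordinate
   vectors, i.e. a set of nonzero vectors of K^(n+1). Sets of the form
   [proj_zeros S] with S homogeneous are stable under nonzero scalars. *)
Definition proj_zeros (K : fieldType) (n : nat) (S : set {mpoly K[n.+1]}) :
    set 'rV[K]_n.+1 :=
  [set x : 'rV[K]_n.+1 | x != 0 /\ forall p, S p -> p.@[x 0] = 0].

Definition proj_closed (K : fieldType) (n : nat) (A : set 'rV[K]_n.+1) : Prop :=
  exists S : set {mpoly K[n.+1]},
    (forall p, S p -> p \is homog mdeg) /\ A = proj_zeros S.

Definition proj_irreducible (K : fieldType) (n : nat)
    (A : set 'rV[K]_n.+1) : Prop :=
  A !=set0 /\
  forall B C : set 'rV[K]_n.+1, proj_closed B -> proj_closed C ->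
    A `<=` B `|` C -> A `<=` B \/ A `<=` C.

Record projVariety (K : fieldType) (n : nat) := ProjVariety {
  pv_set :> set 'rV[K]_n.+1;
  pv_closed : proj_closed pv_set;
  pv_irreducible : proj_irreducible pv_set
}.

Section HomogeneousForms.
Variable K : fieldType.

Lemma meval_homogZ n d (p : {mpoly K[n]}) (c : K) (x : 'rV[K]_n) :
  p \is d.-homog -> p.@[(c *: x) 0] = c ^+ d * p.@[x 0].
Proof.
move/dhomogP=> hp; rewrite !mevalE mulr_sumr; apply: eq_big_seq => m /hp <-.
rewrite mulrCA; congr (_ * _).
rewrite /= mdegE -prodrXr -big_split /=; apply: eq_bigr => i _.
by rewrite mxE exprMn.
Qed.

Lemma homog_meval0Z n (p : {mpoly K[n]}) (c : K) (x : 'rV[K]_n) :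
  p \is homog mdeg -> p.@[x 0] = 0 -> p.@[(c *: x) 0] = 0.
Proof. by case/homogP=> d hp px; rewrite (meval_homogZ _ _ hp) px mulr0. Qed.

Lemma proj_closedZ n (A : set 'rV[K]_n.+1) c x :
  proj_closed A -> c != 0 -> A x -> A (c *: x).
Proof.
case=> S [hS ->] c0 [x0 Sx]; split=> [|p Sp].
  by rewrite scaler_eq0 negb_or c0.
exact/homog_meval0Z/Sx/Sp/hS.
Qed.

Lemma proj_closed_neq0 n (A : set 'rV[K]_n.+1) x :
  proj_closed A -> A x -> x != 0.
Proof. by case=> S [_ ->] []. Qed.

Definition linear_forms k l (M : 'M[K]_(k, l)) : l.-tuple {mpoly K[k]} :=
  [tuple \sum_(i < k) M i j *: 'X_i | j < l].

Lemma linear_formsE k l (M : 'M[K]_(k, l)) (p : {mpoly K[l]}) (x : 'rV[K]_k) :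
  (p \mPo linear_forms M).@[x 0] = p.@[(x *m M) 0].
Proof.
rewrite comp_mpoly_meval; apply: meval_eq => j.
rewrite tnth_mktuple mxE raddf_sum /=; apply: eq_bigr => i _.
by rewrite mevalZ mevalXU mulrC.
Qed.

Lemma homog_linear_forms k l (M : 'M[K]_(k, l)) (p : {mpoly K[l]}) :
  p \is homog mdeg -> p \mPo linear_forms M \is homog mdeg.
Proof.
case/homogP=> d /dhomogP hp; apply/homogP; exists d.
rewrite comp_mpolyE big_seq; apply: rpred_sum => m /hp <-.
apply: rpredZ; rewrite /= mdegE.
apply: (big_ind2 (fun (q : {mpoly K[k]}) e => q \is e.-homog)).
- exact: dhomog1.
- by move=> ? ? ? ? h1 h2; exact: dhomogM.
- move=> i _; rewrite -[X in X.-homog]mul1n; apply: dhomogMn.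
  rewrite tnth_mktuple; apply: rpred_sum => j _; apply: rpredZ.
  by rewrite dhomogX /= mdeg1.
Qed.

End HomogeneousForms.

Section VanishingIdeal.
Variables (K : closedFieldType) (n : nat) (X : projVariety K n).

(* X is a cone, so this is the usual homogeneous ideal I(X). *)
Definition vanishing : pred {mpoly K[n.+1]} :=
  fun p => `[< forall x, pv_set X x -> p.@[x 0] = 0 >].

Let ray (p : {mpoly K[n.+1]}) (x : 'rV[K]_n.+1) : {poly K} :=
  \poly_(d < msize p) (pihomog mdeg d p).@[x 0].

Let rayE p x c : (ray p x).[c] = p.@[(c *: x) 0].
Proof.
rewrite horner_poly [in RHS](@pihomog_partitionE _ _ mdeg (msize p) p) //.
rewrite raddf_sum /=; apply: eq_bigr => d _.
by rewrite (meval_homogZ _ _ (pihomogP _ _ _)) mulrC.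
Qed.

Let poly_eq0 (q : {poly K}) : (forall c, c != 0 -> q.[c] = 0) -> q = 0.
Proof.
move=> hq; apply/eqP; apply: contraT => q0.
have /closed_rootP[c] : size (q * 'X + 1%:P) != 1%N.
  rewrite size_polyDl size_mulX // ?size_polyC ?oner_eq0 //.
    by rewrite eqSS size_poly_eq0.
  by rewrite ltnS size_poly_gt0.
rewrite /root hornerD hornerM hornerX hornerC.
have [->|/hq ->] := eqVneq c 0; first by rewrite mulr0 add0r oner_eq0.
by rewrite mul0r add0r oner_eq0.
Qed.

Let ray0 p : set 'rV[K]_n.+1 :=
  proj_zeros [set q | exists d, q = pihomog mdeg d p].

Let ray0_closed p : proj_closed (ray0 p).
Proof.
exists [set q | exists d, q = pihomog mdeg d p]; split=> // q [d ->].
by apply/homogP; exists d; exact: pihomogP.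
Qed.

Let ray0P p x : x != 0 -> ray p x = 0 -> ray0 p x.
Proof.
move=> x0 r0; split=> // q [d ->].
have [dp|dp] := ltnP d (msize p).
  by have := congr1 (coefp d) r0; rewrite /= coef_poly dp coef0.
rewrite pihomogE big_seq_cond big1 ?meval0 // => m /andP[/msize_mdeg_lt mp].
by move=> /eqP md; move: mp; rewrite md ltnNge dp.
Qed.

Let ray0_van p : pv_set X `<=` ray0 p -> p \in vanishing.
Proof.
move=> Xp; rewrite unfold_in; apply/asboolP => x /Xp[_ px].
rewrite (@pihomog_partitionE _ _ mdeg (msize p) p) // raddf_sum /=.
by rewrite big1 // => d _; apply: px; exists d.
Qed.

Lemma vanishing_prime : prime_idealr_closed vanishing.
Proof.
move=> p q; rewrite unfold_in => /asboolP pq.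
have Xpq : pv_set X `<=` ray0 p `|` ray0 q.
  move=> x Xx; have x0 := proj_closed_neq0 (pv_closed X) Xx.
  have : ray p x * ray q x == 0.
    apply/eqP/poly_eq0 => c c0; rewrite hornerM !rayE -mevalM; apply: pq.
    exact: proj_closedZ (pv_closed X) c0 Xx.
  by rewrite mulf_eq0 => /orP[] /eqP r0; [left|right]; exact: ray0P.
have [_ Xirr] := pv_irreducible X.
by have [/ray0_van ->|/ray0_van ->] := Xirr _ _ (ray0_closed p) (ray0_closed q) Xpq;
  rewrite ?orbT.
Qed.

Lemma vanishing_ideal : idealr_closed vanishing.
Proof.
split=> [||a p q]; rewrite ?unfold_in.
- by apply/asboolP => x _; rewrite meval0.
- apply/asboolP => h1; have [[x Xx] _] := pv_irreducible X.
  by have /eqP := h1 x Xx; rewrite meval1 oner_eq0.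
- move=> /asboolP hp /asboolP hq; apply/asboolP => x Xx.
  by rewrite mevalD mevalM hp // hq // mulr0 addr0.
Qed.

End VanishingIdeal.

HB.instance Definition _ (K : closedFieldType) (n : nat) (X : projVariety K n) :=
  isIdealr.Build {mpoly K[n.+1]} (vanishing X) (vanishing_ideal X).
HB.instance Definition _ (K : closedFieldType) (n : nat) (X : projVariety K n) :=
  isPrimeIdealrClosed.Build {mpoly K[n.+1]} (vanishing X) (@vanishing_prime K n X).

Definition hcoord (K : closedFieldType) (n : nat) (X : projVariety K n) : Type :=
  {ideal_quot (vanishing X : prime_idealr {mpoly K[n.+1]})}.

HB.instance Definition _ (K : closedFieldType) (n : nat) (X : projVariety K n) :=
  GRing.ComNzRing.on (hcoord X).

Section Hcoord.
Variables (K : closedFieldType) (n : nat) (X : projVariety K n).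
Local Notation S := (hcoord X).

Definition hcoord_unit : pred S := fun a => `[< exists b, b * a = 1 >].
Definition hcoord_inv (a : S) : S :=
  if pselect (exists b, b * a = 1) is left h then projT1 (cid h) else a.

Fact hcoord_mulVr : {in hcoord_unit, left_inverse 1 hcoord_inv *%R}.
Proof.
move=> a; rewrite unfold_in /hcoord_inv => /asboolP ha.
by case: pselect => // h; exact: projT2 (cid h).
Qed.

Fact hcoord_unitP (a b : S) : b * a = 1 -> hcoord_unit a.
Proof. by move=> ba; apply/asboolP; exists b. Qed.

Fact hcoord_inv_out : {in [predC hcoord_unit], hcoord_inv =1 id}.
Proof.
by move=> a; rewrite inE unfold_in /hcoord_inv; case: pselect => // h /asboolP.
Qed.

End Hcoord.

HB.instance Definition _ (K : closedFieldType) (n : nat) (X : projVariety K n) :=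
  GRing.ComNzRing_hasMulInverse.Build (hcoord X)
    (@hcoord_mulVr K n X) (@hcoord_unitP K n X) (@hcoord_inv_out K n X).
HB.instance Definition _ (K : closedFieldType) (n : nat) (X : projVariety K n) :=
  GRing.ComUnitRing_isIntegral.Build (hcoord X)
    (@Quotient.rquot_IdomainAxiom {mpoly K[n.+1]} (vanishing X)).

Section FunctionField.
Variables (K : closedFieldType) (n : nat) (X : projVariety K n).

Definition hcoord_pi (p : {mpoly K[n.+1]}) : hcoord X :=
  \pi_({ideal_quot (vanishing X : prime_idealr {mpoly K[n.+1]})}) p.

Fact hcoord_pi_is_zmod_morphism : zmod_morphism hcoord_pi.
Proof. exact: pi_is_zmod_morphism. Qed.

Fact hcoord_pi_is_monoid_morphism : monoid_morphism hcoord_pi.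
Proof. exact: pi_is_monoid_morphism. Qed.

HB.instance Definition _ :=
  GRing.isZmodMorphism.Build {mpoly K[n.+1]} (hcoord X) hcoord_pi
    hcoord_pi_is_zmod_morphism.
HB.instance Definition _ :=
  GRing.isMonoidMorphism.Build {mpoly K[n.+1]} (hcoord X) hcoord_pi
    hcoord_pi_is_monoid_morphism.

Lemma hcoord_pi_eq0 p :
  hcoord_pi p = 0 <-> forall x, pv_set X x -> p.@[x 0] = 0.
Proof.
have -> : (forall x, pv_set X x -> p.@[x 0] = 0) <-> p - 0 \in vanishing X.
  by rewrite subr0 unfold_in; exact: (rwP (asboolP _)).
have -> := Quotient.idealrBE (vanishing X : prime_idealr {mpoly K[n.+1]}) p 0.
rewrite -(raddf0 hcoord_pi); exact: (rwP eqP).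
Qed.

Definition hclass (p : {mpoly K[n.+1]}) : {fraction hcoord X} :=
  FracField.tofrac (hcoord_pi p).

Lemma hclass_eq0 p : hclass p = 0 <-> forall x, pv_set X x -> p.@[x 0] = 0.
Proof.
rewrite -hcoord_pi_eq0; split=> [/eqP|h].
  by rewrite tofrac_eq0 => /eqP.
by rewrite /hclass h tofrac0.
Qed.

(* The field K(X) of rational functions on X, as a subfield of the fraction
   field of the homogeneous coordinate ring. *)
Definition function_field : set {fraction hcoord X} :=
  [set u | exists (d : nat) (a b : {mpoly K[n.+1]}),
     [/\ a \is d.-homog, b \is d.-homog, hclass b != 0
       & u = hclass a / hclass b]].

Definition alg_independent m (t : m.-tuple {fraction hcoord X}) : Prop :=
  forall p : {mpoly K[m]},
    mmap (fun c : K => hclass c%:MP) (tnth t) p = 0 -> p = 0.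

(* dim X is the transcendence degree of K(X) over K. *)
Definition has_dimension (m : nat) : Prop :=
  exists t : m.-tuple {fraction hcoord X},
    [/\ forall i, function_field (tnth t i),
        alg_independent t
      & forall u, function_field u -> ~ alg_independent [tuple of rcons t u]].

(* A rational map X --> P^m is given by m + 1 forms of the same degree, not all
   vanishing on X. *)
Record rationalMap (m : nat) := RationalMap {
  rm_deg : nat;
  rm_forms : m.+1.-tuple {mpoly K[n.+1]};
  rm_homog : forall i, tnth rm_forms i \is rm_deg.-homog;
  rm_neq0 : exists i, hclass (tnth rm_forms i) != 0
}.

Variables (m : nat) (f : rationalMap m).

Definition rm_eval (x : 'rV[K]_n.+1) : 'rV[K]_m.+1 :=
  \row_i (tnth (rm_forms f) i).@[x 0].

(* The image of the open subset where the chosen forms do not all vanish is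
   dense; as X is irreducible, this does not depend on the representative. *)
Definition dominant : Prop :=
  forall A : set 'rV[K]_m.+1, proj_closed A ->
    (forall x, pv_set X x -> rm_eval x != 0 -> A (rm_eval x)) ->
    forall y, y != 0 -> A y.

(* The image of f^* : K(P^m) -> K(X), for f dominant. *)
Definition pullback_field : set {fraction hcoord X} :=
  [set u | exists (d : nat) (a b : {mpoly K[m.+1]}),
     [/\ a \is d.-homog, b \is d.-homog, hclass (b \mPo rm_forms f) != 0
       & u = hclass (a \mPo rm_forms f) / hclass (b \mPo rm_forms f)]].

End FunctionField.

Arguments hcoord_pi {K n} X p.
Arguments hclass {K n} X p.
Arguments function_field {K n} X.

(* [E : F] = d for subfields F and E of L with F included in E. *)
Definition extension_degree (L : fieldType) (F E : set L) (d : nat) : Prop :=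
  exists e : 'I_d -> L,
    (forall i, E (e i)) /\
    forall x, E x ->
      exists! c : {ffun 'I_d -> L},
        (forall i, F (c i)) /\ x = \sum_(i < d) c i * e i.

Definition map_degree (K : closedFieldType) (n : nat) (X : projVariety K n)
    (m : nat) (f : rationalMap X m) (d : nat) : Prop :=
  extension_degree (pullback_field f) (function_field X) d.

(* irr(X) = d, where m is the dimension of X. *)
Definition irr_eq (K : closedFieldType) (n : nat) (X : projVariety K n)
    (d : nat) : Prop :=
  exists m : nat,
    [/\ has_dimension X m,
        exists f : rationalMap X m, dominant f /\ map_degree f d
      & forall (f : rationalMap X m) (e : nat),
          dominant f -> map_degree f e -> (d <= e)%N].

(* A smooth cubic curve in P^2. Any of its points can serve as the origin; the
   degree of irrationality does not involve that choice. *)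
Definition elliptic_curve (K : closedFieldType) (E : projVariety K 2) : Prop :=
  exists f : {mpoly K[3]},
    [/\ f \is 3.-homog,
        pv_set E = proj_zeros [set f]
      & forall x, pv_set E x -> exists i : 'I_3, f^`M(i).@[x 0] != 0].

Section Segre.
Variables (K : closedFieldType) (n m : nat).
Variables (X : projVariety K n) (Y : projVariety K m).

Local Notation N := (n.+1 * m.+1).-1.

Definition segre (x : 'rV[K]_n.+1) (y : 'rV[K]_m.+1) : 'rV[K]_N.+1 :=
  mxvec (x^T *m y).

Definition segre_set : set 'rV[K]_N.+1 :=
  [set z | exists x y, [/\ pv_set X x, pv_set Y y & z = segre x y]].

Let coef (i : 'I_n.+1) (j : 'I_m.+1) : 'I_N.+1 := mxvec_index i j.

Let segreE x y i j : segre x y 0 (coef i j) = x 0 i * y 0 j.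
Proof. by have := mxvecE (x^T *m y) i j; rewrite mxE big_ord1 !mxE. Qed.

Let coefP (z z' : 'rV[K]_N.+1) :
  (forall i j, z 0 (coef i j) = z' 0 (coef i j)) -> z = z'.
Proof.
move=> h; apply/rowP => k.
by case/mxvec_indexP: (k : 'I_(n.+1 * m.+1)) => i j; exact: h.
Qed.

Let neq0P k (z : 'rV[K]_k) : z != 0 -> exists i, z 0 i != 0.
Proof. by case/rV0Pn => i; exists i. Qed.

Let segre_neq0 x y : x != 0 -> y != 0 -> segre x y != 0.
Proof.
move=> /neq0P[i xi] /neq0P[j yj]; apply/rV0Pn; exists (coef i j).
by rewrite segreE mulf_neq0.
Qed.

Let mxl (y : 'rV[K]_m.+1) : 'M[K]_(n.+1, N.+1) :=
  \matrix_i segre (delta_mx 0 i) y.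
Let mxr (x : 'rV[K]_n.+1) : 'M[K]_(m.+1, N.+1) :=
  \matrix_j segre x (delta_mx 0 j).

Let mxlE x y : x *m mxl y = segre x y.
Proof.
apply: coefP => i j; rewrite segreE mxE (bigD1 i) //= big1 ?addr0 => [|k ki].
  by rewrite mxE segreE mxE !eqxx mul1r.
by rewrite mxE segreE mxE eqxx /= eq_sym (negPf ki) mul0r mulr0.
Qed.

Let mxrE x y : y *m mxr x = segre x y.
Proof.
apply: coefP => i j; rewrite segreE mxE (bigD1 j) //= big1 ?addr0 => [|k kj].
  by rewrite mxE segreE mxE !eqxx mulr1 mulrC.
by rewrite mxE segreE mxE eqxx /= eq_sym (negPf kj) mulr0 mulr0.
Qed.

Let colmx (j : 'I_m.+1) : 'M[K]_(N.+1, n.+1) :=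
  \matrix_(k, i) (k == coef i j)%:R.
Let rowmx (i : 'I_n.+1) : 'M[K]_(N.+1, m.+1) :=
  \matrix_(k, j) (k == coef i j)%:R.

Let colmxE (z : 'rV[K]_N.+1) i j : (z *m colmx j) 0 i = z 0 (coef i j).
Proof.
rewrite mxE (bigD1 (coef i j)) //= big1 ?addr0 => [|k ki].
  by rewrite mxE eqxx mulr1.
by rewrite mxE (negPf ki) mulr0.
Qed.

Let rowmxE (z : 'rV[K]_N.+1) i j : (z *m rowmx i) 0 j = z 0 (coef i j).
Proof.
rewrite mxE (bigD1 (coef i j)) //= big1 ?addr0 => [|k ki].
  by rewrite mxE eqxx mulr1.
by rewrite mxE (negPf ki) mulr0.
Qed.

Fact segre_closed : proj_closed segre_set.
Proof.
have [SX [hX EX]] := pv_closed X; have [SY [hY EY]] := pv_closed Y.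
exists [set p |
  [\/ exists i j k l, p = 'X_(coef i j) * 'X_(coef k l)
                        - 'X_(coef i l) * 'X_(coef k j),
      exists2 q, SX q & exists j, p = q \mPo linear_forms (colmx j)
    | exists2 q, SY q & exists i, p = q \mPo linear_forms (rowmx i)]]; split.
  move=> p [[i [j [k [l ->]]]]|[q /hX hq [j ->]]|[q /hY hq [i ->]]];
    [|exact: homog_linear_forms..].
  apply/homogP; exists (1 + 1)%N; apply: rpredB; apply: dhomogM;
    by rewrite dhomogX /= mdeg1.
apply/seteqP; split=> [z [x [y [Xx Yy ->]]]|z [z0 hz]].
  have [x0 xX] : proj_zeros SX x by rewrite -EX.
  have [y0 yY] : proj_zeros SY y by rewrite -EY.
  split; first exact: segre_neq0.
  move=> p [[i [j [k [l ->]]]]|[q Sq [j ->]]|[q Sq [i ->]]].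
  - by rewrite mevalB !mevalM !mevalXU !segreE mulrACA [y 0 j * _]mulrC mulrACA subrr.
  - rewrite linear_formsE (_ : _ *m _ = y 0 j *: x).
      exact/homog_meval0Z/xX/Sq/hX.
    by apply/rowP => i; rewrite colmxE segreE mxE mulrC.
  - rewrite linear_formsE (_ : _ *m _ = x 0 i *: y).
      exact/homog_meval0Z/yY/Sq/hY.
    by apply/rowP => j; rewrite rowmxE segreE mxE.
have minor i j k l :
    z 0 (coef i j) * z 0 (coef k l) = z 0 (coef i l) * z 0 (coef k j).
  apply/eqP; rewrite -subr_eq0 -!mevalXU -!mevalM -mevalB; apply/eqP/hz.
  by constructor 1; exists i, j, k, l.
have [i0 [j0 zij]] : exists i j, z 0 (coef i j) != 0.
  have [k] := neq0P z0.
  by case/mxvec_indexP: (k : 'I_(n.+1 * m.+1)) => i j zij; exists i, j.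
exists (z *m colmx j0), ((z 0 (coef i0 j0))^-1 *: (z *m rowmx i0)); split.
- rewrite EX; split.
    by apply/rV0Pn; exists i0; rewrite colmxE.
  by move=> q Sq; rewrite -linear_formsE; apply: hz; constructor 2; exists q => //; exists j0.
- apply: (proj_closedZ (pv_closed Y)); first by rewrite invr_eq0.
  rewrite EY; split.
    by apply/rV0Pn; exists j0; rewrite rowmxE.
  by move=> q Sq; rewrite -linear_formsE; apply: hz; constructor 3; exists q => //; exists i0.
- apply: coefP => i j; rewrite segreE colmxE mxE rowmxE mulrCA -minor.
  by rewrite mulrCA mulVf ?mulr1.
Qed.

Let preim_closed k (J : set 'M[K]_(k.+1, N.+1)) (A : set 'rV[K]_N.+1) :
  (forall M (x : 'rV[K]_k.+1), J M -> x != 0 -> x *m M != 0) -> proj_closed A ->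
  exists2 P : set 'rV[K]_k.+1, proj_closed P &
    forall x, x != 0 -> P x <-> forall M, J M -> A (x *m M).
Proof.
move=> hJ [S [hS ->]].
set S' := [set p | exists2 M, J M & exists2 q, S q & p = q \mPo linear_forms M].
exists (proj_zeros S').
  exists S'; split=> // p [M _ [q /hS hq ->]]; exact: homog_linear_forms.
move=> x x0; split=> [[_ hx] M JM|hx].
  split=> [|q Sq]; first exact: hJ.
  by rewrite -linear_formsE; apply: hx; exists M => //; exists q.
by split=> // p [M JM [q Sq ->]]; rewrite linear_formsE; apply: (hx M JM).2.
Qed.

Fact segre_irreducible : proj_irreducible segre_set.
Proof.
have [[x1 Xx1] Xirr] := pv_irreducible X.
have [[y1 Yy1] Yirr] := pv_irreducible Y.
have X0 x : pv_set X x -> x != 0 by exact: proj_closed_neq0 (pv_closed X).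
have Y0 y : pv_set Y y -> y != 0 by exact: proj_closed_neq0 (pv_closed Y).
split; first by exists (segre x1 y1), x1, y1.
move=> B C cB cC hBC.
have hl y : pv_set Y y ->
    (forall x, pv_set X x -> B (segre x y)) \/
    (forall x, pv_set X x -> C (segre x y)).
  move=> Yy.
  have hJ M (x : 'rV[K]_n.+1) : [set mxl y] M -> x != 0 -> x *m M != 0.
    by move=> -> x0; rewrite mxlE; apply: segre_neq0 => //; exact: Y0.
  have [PB cPB hPB] := preim_closed hJ cB.
  have [PC cPC hPC] := preim_closed hJ cC.
  have [x Xx|XB|XC] := Xirr _ _ cPB cPC.
  - have [|h|h] := hBC (segre x y); first by exists x, y.
      by left; apply/(hPB x (X0 x Xx)) => M ->; rewrite mxlE.
    by right; apply/(hPC x (X0 x Xx)) => M ->; rewrite mxlE.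
  - by left=> x Xx; rewrite -mxlE; apply: (hPB x (X0 x Xx)).1 => //; exact: XB.
  - by right=> x Xx; rewrite -mxlE; apply: (hPC x (X0 x Xx)).1 => //; exact: XC.
have hJ M (y : 'rV[K]_m.+1) : [set mxr x | x in pv_set X] M -> y != 0 -> y *m M != 0.
  by move=> [x Xx <-] y0; rewrite mxrE; apply: segre_neq0 => //; exact: X0.
have [PB cPB hPB] := preim_closed hJ cB.
have [PC cPC hPC] := preim_closed hJ cC.
have [y Yy|YB|YC] := Yirr _ _ cPB cPC.
- have [h|h] := hl y Yy.
    by left; apply/(hPB y (Y0 y Yy)) => M [x Xx <-]; rewrite mxrE; exact: h.
  by right; apply/(hPC y (Y0 y Yy)) => M [x Xx <-]; rewrite mxrE; exact: h.
- left=> _ [x [y [Xx Yy ->]]]; rewrite -mxrE.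
  by apply: (hPB y (Y0 y Yy)).1 => //; [exact: YB|exists x].
- right=> _ [x [y [Xx Yy ->]]]; rewrite -mxrE.
  by apply: (hPC y (Y0 y Yy)).1 => //; [exact: YC|exists x].
Qed.

(* The product X x Y, embedded by the Segre map. *)
Definition prod_variety : projVariety K N :=
  ProjVariety segre_closed segre_irreducible.

End Segre.

(* Main.v *)
Require Import Defs.
From mathcomp Require Import all_boot all_algebra reals complex.
From HB Require Import structures.
From mathcomp Require Import all_order all_field perm generic_quotient fraction.
From mathcomp Require Import boolp classical_sets mpoly.
From mathcomp Require Import ring zify.

(* Lower bound. A smooth cubic has only constant points over K = C(P^2), since it
   is not dominated by a rational curve; so C(X) with X = E x F is not K. If it
   has degree 2 over K, write C(X) = K + K delta with delta^2 in K. The line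
   joining the generic point of E to its conjugate meets E again in a constant
   point; projecting from it gives C(E) = C(t, w) with w^2 = D(t), t in K and w in
   K delta. The same for F gives w'^2 = D'(t') and c = w' / w in K, so that
   D'(t') = c^2 D(t). The 2-form dt dt' / (w w') would then be regular on P^2:
   comparing degrees, the Jacobian of (t, t') vanishes, although t and t' are
   algebraically independent.

   Upper bound. Through a tangent at an inflexion point, E and F get equations
   y^2 = x^3 + (m x + n)^2 and v^2 = u^3 + (m' u + n')^2. With A = y - m x - n,
   A' = v - m' u - n', l = u / x and k = A' / A, the quantity A is affine in x
   over C(l, k), which makes A (A + 2 (m x + n)) = x^3 a cubic equation for x
   over C(l, k); and x generates C(X) over that field. *)

Set Implicit Arguments.
Unset Strict Implicit.
Unset Printing Implicit Defensive.

Import GRing.Theory.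

Local Open Scope quotient_scope.
Local Open Scope ring_scope.
Local Open Scope classical_set_scope.

(** No surface is resolved and no sheaf is used: all takes place inside one field, at the generic
    point of the product, and regularity of the 2-form becomes a divisibility of polynomials.
    Restricting forms in the plane to the lines through a general point [B] makes them polynomials
    in one variable over [k = C(S)], [S] naming the line; [B] avoids the zeros of the relevant
    quartics, so degrees are exact. With [D = G u^2] and [D' = G v^2], the 2-form has the shape
    [J / (G u v)]. The denominator divides [J] because a separable quartic has coprime partial
    derivatives; it has degree [2m + 2n], whereas each term of [J] differentiates once in the
    variable and so loses a degree. A vanishing Jacobian contradicts independence through
    derivations: some nonzero combination of the two partial derivations would kill t and t', hence
    everything algebraic over them, hence the coordinates of the plane. For the upper bound, an
    inflexion is what makes the product of [A] and [A + 2 (m x + n)] a pure cube, so that dividing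
    the two curve equations cancels a factor [A]. The cubic equation only bounds the degree by 3;
    equality comes from the lower bound. *)

Local Notation "x %:F" := (FracField.tofrac x).

(** * Subfields and algebraic closure *)

Section Subfields.
Variable L : fieldType.

(** Subfields are sets inside a common [L], as in [extension_degree], so that they can be compared
    by inclusion; [sf_type] makes a field type of one when polynomials over it are needed. *)
Record subfld := Subfld {
  sf_set :> L -> Prop;
  sf_closed : [/\ sf_set 1, forall x y, sf_set x -> sf_set y -> sf_set (x - y)
    & forall x y, sf_set x -> sf_set y -> sf_set (x / y)]
}.
Implicit Types (F G : subfld) (S : set L).

Definition sf_pred F : {pred L} := fun x => `[< F x >].

Lemma sf_divring F : divring_closed (sf_pred F).
Proof.
case: (sf_closed F) => F1 FB FD; split=> [|x y|x y]; rewrite ?unfold_in.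
- exact/asboolP.
- by move=> /asboolP ? /asboolP ?; apply/asboolP/FB.
- by move=> /asboolP ? /asboolP ?; apply/asboolP/FD.
Qed.

HB.instance Definition _ F :=
  GRing.isDivringClosed.Build L (sf_pred F) (sf_divring F).

Definition sf_type F := {x : L | x \in sf_pred F}.
HB.instance Definition _ F := SubType.on (sf_type F).
HB.instance Definition _ F := Choice.on (sf_type F).
HB.instance Definition _ F := [SubChoice_isSubIntegralDomain of sf_type F by <:].
HB.instance Definition _ F := [SubIntegralDomain_isSubField of sf_type F by <:].

Definition sf_val F : sf_type F -> L := val.
HB.instance Definition _ F := GRing.RMorphism.copy (@sf_val F) (val : sf_type F -> L).

Lemma sf_valP F (x : sf_type F) : F (sf_val x).
Proof. by have := valP x; rewrite unfold_in => /asboolP. Qed.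

Lemma sf_valE F x : F x -> {y : sf_type F | sf_val y = x}.
Proof.
move=> Fx; have xF : x \in sf_pred F by rewrite unfold_in; exact/asboolP.
by exists (exist _ x xF).
Qed.

Lemma sf1 F : F 1. Proof. by case: (sf_closed F). Qed.
Lemma sfB F x y : F x -> F y -> F (x - y).
Proof. by case: (sf_closed F) => _ + _; apply. Qed.
Lemma sf_div F x y : F x -> F y -> F (x / y).
Proof. by case: (sf_closed F) => _ _; apply. Qed.
Lemma sf0 F : F 0.
Proof. by rewrite -(subrr 1); apply: sfB; exact: sf1. Qed.
Lemma sfN F x : F x -> F (- x).
Proof. by rewrite -sub0r; apply: sfB; exact: sf0. Qed.
Lemma sfD F x y : F x -> F y -> F (x + y).
Proof. by move=> Fx /sfN Fy; rewrite -[y]opprK; exact: sfB. Qed.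
Lemma sfV F x : F x -> F x^-1.
Proof. by rewrite -div1r; apply: sf_div; exact: sf1. Qed.
Lemma sfM F x y : F x -> F y -> F (x * y).
Proof. by move=> Fx /sfV Fy; rewrite -[y]invrK; exact: sf_div. Qed.
Lemma sfX F x n : F x -> F (x ^+ n).
Proof. by move=> Fx; elim: n => [|n IH]; rewrite ?expr0 ?exprS; [exact: sf1|exact: sfM]. Qed.
Lemma sf_sum F (I : Type) (r : seq I) (P : pred I) (f : I -> L) :
  (forall i, P i -> F (f i)) -> F (\sum_(i <- r | P i) f i).
Proof. by move=> Ff; apply: big_ind => //; [exact: sf0|exact: sfD]. Qed.
Lemma sf_prod F (I : Type) (r : seq I) (P : pred I) (f : I -> L) :
  (forall i, P i -> F (f i)) -> F (\prod_(i <- r | P i) f i).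
Proof. by move=> Ff; apply: big_ind => //; [exact: sf1|exact: sfM]. Qed.
Lemma sf_nat F n : F n%:R.
Proof. by elim: n => [|n IH]; rewrite ?mulrS; [exact: sf0|apply: sfD; [exact: sf1|]]. Qed.

Lemma sf_map_poly F (p : {poly L}) : (forall i, F p`_i) ->
  {q : {poly sf_type F} | map_poly (@sf_val F) q = p}.
Proof.
move=> Fp; exists (\poly_(i < size p) projT1 (sf_valE (Fp i))).
apply/polyP=> i; rewrite coef_map coef_poly.
case: ltnP => [_|hi]; first exact: (projT2 (sf_valE (Fp i))).
by rewrite [LHS]rmorph0 nth_default.
Qed.

Definition algOver S z :=
  exists p : {poly L}, [/\ p != 0, forall i, S p`_i & root p z].

Lemma algOverP F z : algOver F z <-> algebraicOver (@sf_val F) z.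
Proof.
split=> [[p [p0 Fp pz]]|[q q0 qz]].
  have [q qE] := sf_map_poly Fp; exists q; last by rewrite qE.
  by rewrite -(map_poly_eq0 (@sf_val F)) qE.
exists (map_poly (@sf_val F) q); split=> //; first by rewrite map_poly_eq0.
by move=> i; rewrite coef_map; exact: sf_valP.
Qed.

Lemma algOverS S T z : S `<=` T -> algOver S z -> algOver T z.
Proof. by move=> ST [p [p0 Fp pz]]; exists p; split=> // i; exact/ST. Qed.

Lemma algOver_id F z : F z -> algOver F z.
Proof.
move=> Fz; apply/algOverP; have [y <-] := sf_valE Fz; exact: algebraic_id.
Qed.

Fact alg_closed F : [/\ algOver F 1,
    forall x y, algOver F x -> algOver F y -> algOver F (x - y)
  & forall x y, algOver F x -> algOver F y -> algOver F (x / y)].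
Proof.
split=> [|x y|x y]; first exact/algOver_id/sf1.
- by move=> /algOverP ? /algOverP ?; apply/algOverP/algebraic_sub.
- by move=> /algOverP ? /algOverP ?; apply/algOverP/algebraic_div.
Qed.

Definition algcl F := Subfld (alg_closed F).

Lemma algcl_trans F z : algOver (algcl F) z -> algcl F z.
Proof.
case=> p [p0 Fp pz]; apply/algOverP/integral_algebraic.
apply: (@integral_root _ _ _ p) => // _ /(nthP 0)[i _ <-].
exact/integral_algebraic/algOverP/Fp.
Qed.

Fact gen_closed S : let G x := forall F, S `<=` F -> F x in
  [/\ G 1, forall x y, G x -> G y -> G (x - y)
    & forall x y, G x -> G y -> G (x / y)].
Proof.
split=> [F _|x y Gx Gy F SF|x y Gx Gy F SF]; first exact: sf1.
- by apply: sfB; [exact: Gx|exact: Gy].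
- by apply: sf_div; [exact: Gx|exact: Gy].
Qed.

Definition gen S := Subfld (gen_closed S).

Lemma sub_gen S : S `<=` gen S. Proof. by move=> x Sx F; exact. Qed.
Lemma gen_sub S F : S `<=` F -> gen S `<=` F.
Proof. by move=> SF x; exact. Qed.
Lemma algcl_gen F S : S `<=` algcl F -> algcl (gen S) `<=` algcl F.
Proof.
by move=> /gen_sub SF z /(algOverS SF); exact: algcl_trans.
Qed.

(* The ring F[x] generated by an algebraic element is already a field. *)
Lemma gen_alg_poly F x y : algOver F x -> gen (F `|` [set x]) y ->
  exists2 q : {poly L}, (forall i, F q`_i) & y = q.[x].
Proof.
case/algOverP=> p p0 px Gy.
have wf : (p != 0) && root (map_poly (@sf_val F) p) x by rewrite p0.
pose inj : subFExtend (@sf_val F) x p -> L := @subfx_inj _ _ _ _ _.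
(* The image of the abstract extension is a field containing [F] and [x], hence contains the
   generated field; its elements are values of polynomials by [subfxE]. *)
pose H := [set inj z | z in setT].
have HP : [/\ H 1, forall a b, H a -> H b -> H (a - b)
    & forall a b, H a -> H b -> H (a / b)].
  split=> [|_ _ [a _ <-] [b _ <-]|_ _ [a _ <-] [b _ <-]].
  - by exists 1 => //; rewrite /inj rmorph1.
  - by exists (a - b) => //; rewrite /inj rmorphB.
  - by exists (a / b) => //; rewrite /inj fmorph_div.
have HE (q : {poly sf_type F}) : inj (subfx_eval _ _ _ q) = (map_poly (@sf_val F) q).[x].
  by rewrite /inj subfx_inj_eval // wf.
have /Gy[z _ <-] : F `|` [set x] `<=` Subfld HP.
  move=> a [/sf_valE[b <-]|->].
    by exists (subfx_eval _ _ _ b%:P) => //; rewrite HE map_polyC hornerC.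
  by exists (subfx_eval _ _ _ 'X) => //; rewrite HE map_polyX hornerX.
have [q ->] := subfxE z; exists (map_poly (@sf_val F) q); last exact: HE.
by move=> i; rewrite coef_map; exact: sf_valP.
Qed.

End Subfields.

(** * Polynomial rings and evaluation morphisms *)

Section MpolyGenerators.
Variables (n : nat) (R : comNzRingType).

Lemma mpoly_ring_ind (P : {mpoly R[n]} -> Prop) :
  (forall c, P c%:MP) -> (forall i, P 'X_i) ->
  (forall p q, P p -> P q -> P (p + q)) ->
  (forall p q, P p -> P q -> P (p * q)) -> forall p, P p.
Proof.
move=> PC PX PD PM; elim/mpolyind; first by rewrite -mpolyC0.
move=> c m p _ _ Pp; apply: (PD) Pp; rewrite -mul_mpolyC; apply: (PM) => //.
rewrite mpolyXE_id; apply: big_ind => [|p1 q1|i _]; [by rewrite -mpolyC1|exact: PM|].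
by elim: (m i) => [|k IH]; rewrite ?expr0 ?exprS -?mpolyC1 //; exact: PM.
Qed.

Lemma rmorph_mpoly_eq (S : pzRingType) (f g : {rmorphism {mpoly R[n]} -> S}) :
  (forall c, f c%:MP = g c%:MP) -> (forall i, f 'X_i = g 'X_i) -> f =1 g.
Proof.
by move=> fC fX; apply: mpoly_ring_ind => // p q;
   rewrite ?rmorphD ?rmorphM => -> ->.
Qed.

End MpolyGenerators.

Lemma mmapXU n (R : nzRingType) (S : comNzRingType) (f : {rmorphism R -> S})
  (h : 'I_n -> S) i : mmap f h 'X_i = h i.
Proof. by rewrite mmapX mmap1U. Qed.

Lemma rmorph_mmap n (R S T : comNzRingType) (g : {rmorphism S -> T})
    (f : {rmorphism R -> S}) (h : 'I_n -> S) (p : {mpoly R[n]}) :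
  g (mmap f h p) = mmap (g \o f) (g \o h) p.
Proof.
by rewrite /mmap rmorph_sum; apply: eq_bigr => m _;
   rewrite rmorphM /mmap1 rmorph_prod; congr (_ * _); apply: eq_bigr => i _;
   rewrite rmorphXn.
Qed.

Lemma mmap_eq n (R S : comNzRingType) (f : R -> S)
    (h k : 'I_n -> S) (p : {mpoly R[n]}) : h =1 k -> mmap f h p = mmap f k p.
Proof. by move=> hk; apply: eq_bigr => m _; rewrite (mmap1_eq _ hk). Qed.

Lemma mmap_mPo n l (R S : comNzRingType) (f : {rmorphism R -> S}) (h : 'I_n -> S)
    (lq : l.-tuple {mpoly R[n]}) (p : {mpoly R[l]}) :
  mmap f h (p \mPo lq) = mmap f (fun i => mmap f h (tnth lq i)) p.
Proof.
elim/mpoly_ring_ind: p => [c|i|p q IHp IHq|p q IHp IHq].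
- by rewrite comp_mpolyC !mmapC.
- by rewrite comp_mpolyXU mmapXU -tnth_nth.
- rewrite !rmorphD; exact: (congr2 +%R IHp IHq).
- rewrite !rmorphM; exact: (congr2 *%R IHp IHq).
Qed.

Lemma mmap_homogZ n d (R S : comNzRingType) (f : {rmorphism R -> S})
    (p : {mpoly R[n]}) (c : S) (h : 'I_n -> S) :
  p \is d.-homog -> mmap f (fun i => c * h i) p = c ^+ d * mmap f h p.
Proof.
move/dhomogP=> hp; rewrite /mmap mulr_sumr; apply: eq_big_seq => m /hp <-.
rewrite mulrCA; congr (_ * _).
rewrite /mmap1 /= mdegE -prodrXr -big_split /=; apply: eq_bigr => i _.
by rewrite exprMn.
Qed.

(** * Polynomials over an algebraically closed field are determined by their values *)

Section Vanishing.
Variable C : closedFieldType.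

(** The last variable becomes the variable of a univariate polynomial, which allows induction on the
    number of variables. *)
Definition split_last n : 'I_n.+1 -> {poly {mpoly C[n]}} :=
  fun i => if unlift ord_max i is Some j then ('X_j)%:P else 'X.
Definition mpoly_last n (p : {mpoly C[n.+1]}) : {poly {mpoly C[n]}} :=
  mmap (polyC \o @mpolyC n C) (@split_last n) p.

Lemma mpoly_lastD n (p q : {mpoly C[n.+1]}) : mpoly_last (p + q) = mpoly_last p + mpoly_last q.
Proof. exact: rmorphD. Qed.
Lemma mpoly_lastM n (p q : {mpoly C[n.+1]}) : mpoly_last (p * q) = mpoly_last p * mpoly_last q.
Proof. exact: rmorphM. Qed.

Lemma mpoly_lastK n (p : {mpoly C[n.+1]}) :
  p = (map_poly (@mwiden n C) (mpoly_last p)).['X_ord_max].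
Proof.
elim/mpoly_ring_ind: p => [c|i|p q IHp IHq|p q IHp IHq].
- by rewrite /mpoly_last mmapC /= map_polyC hornerC /= mwidenC.
- rewrite /mpoly_last mmapXU /split_last.
  case: unliftP => [j ->|->]; last by rewrite map_polyX hornerX.
  rewrite map_polyC hornerC /= mwidenX mnmwiden1; congr 'X_(_); apply: val_inj.
  by rewrite /= /bump leqNgt ltn_ord.
- by rewrite {1}IHp {1}IHq mpoly_lastD (rmorphD (map_poly (@mwiden n C))) hornerD.
- by rewrite {1}IHp {1}IHq mpoly_lastM (rmorphM (map_poly (@mwiden n C))) hornerM.
Qed.

Lemma meval_last n (p : {mpoly C[n.+1]}) (v : 'I_n -> C) (c : C) :
  (map_poly (meval v) (mpoly_last p)).[c]
   = p.@[fun i => if unlift ord_max i is Some j then v j else c].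
Proof.
elim/mpoly_ring_ind: p => [b|i|p q IHp IHq|p q IHp IHq].
- by rewrite /mpoly_last mmapC /= map_polyC hornerC /= !mevalC.
- rewrite /mpoly_last mmapXU /split_last mevalXU /=.
  case: unliftP => [j _|_]; last by rewrite map_polyX hornerX.
  by rewrite map_polyC hornerC /= mevalXU.
- rewrite mpoly_lastD (rmorphD (map_poly (meval v))) hornerD mevalD; exact: (congr2 +%R IHp IHq).
- rewrite mpoly_lastM (rmorphM (map_poly (meval v))) hornerM mevalM; exact: (congr2 *%R IHp IHq).
Qed.

(** With all variables but the last fixed, a univariate polynomial vanishing at every point of a
    closed field is zero; so each of its coefficients vanishes everywhere and the induction
    hypothesis applies to it. *)
Lemma mpoly_eq0 n (p : {mpoly C[n]}) : (forall v, p.@[v] = 0) -> p = 0.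
Proof.
elim: n p => [|n IH] p p0.
  by have := p0 (fun=> 0); rewrite [p]nvar0_mpolyC mevalC => ->; rewrite mpolyC0.
rewrite [p]mpoly_lastK; suff -> : mpoly_last p = 0 by rewrite rmorph0 horner0.
apply/polyP => i; rewrite coef0; apply: IH => v.
have /(congr1 (coefp i)) : map_poly (meval v) (mpoly_last p) = 0.
  apply/eqP/negPn/negP => /closed_nonrootP[c].
  by rewrite /root meval_last p0 eqxx.
by rewrite /= coef_map coef0.
Qed.

Lemma mpoly_nonzero n (p : {mpoly C[n]}) : p != 0 -> exists v, p.@[v] != 0.
Proof.
move=> /eqP p0; apply: contrapT => h; apply: p0; apply: mpoly_eq0 => v.
by apply/eqP; apply: contrapT => /negP pv; apply: h; exists v.
Qed.

End Vanishing.

(** * Algebraic dependence over the constants *)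

Section AlgebraicOverConstants.
Variables (C : closedFieldType) (L : fieldType) (iota : {rmorphism C -> L}).
Implicit Types (S T : set L) (x y z : L).

Definition adj S := gen (range iota `|` S).

Lemma adj_iota S c : adj S (iota c). Proof. by apply: sub_gen; left; exists c. Qed.
Lemma adj_sub S x : S x -> adj S x. Proof. by move=> Sx; apply: sub_gen; right. Qed.
Lemma adj_le S (F : subfld L) :
  (forall c, F (iota c)) -> S `<=` F -> adj S `<=` F.
Proof. by move=> FC SF; apply: gen_sub => x [[c _ <-]|/SF]. Qed.
Lemma algcl_adj S (F : subfld L) :
  (forall c, F (iota c)) -> S `<=` algcl F -> algcl (adj S) `<=` algcl F.
Proof.
by move=> FC SF; apply: algcl_gen => x [[c _ <-]|/SF //]; exact: algOver_id.
Qed.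

Fact constants_closed : let F := range iota in [/\ F 1,
  forall x y, F x -> F y -> F (x - y) & forall x y, F x -> F y -> F (x / y)].
Proof.
split=> [|_ _ [a _ <-] [b _ <-]|_ _ [a _ <-] [b _ <-]].
- by exists 1; rewrite ?rmorph1.
- by exists (a - b); rewrite ?rmorphB.
- by exists (a / b); rewrite ?fmorph_div.
Qed.
Definition constants := Subfld constants_closed.

(** A polynomial over [C] already splits there, so it acquires no new root in [L]. *)
Lemma algcl_constants x : algcl constants x -> range iota x.
Proof.
case=> p [p0 Cp px].
have [q qE] : exists q, map_poly iota q = p.
  exists (\poly_(i < size p) projT1 (cid2 (Cp i))); apply/polyP => i.
  rewrite coef_map coef_poly; case: ltnP => hi.
    by case: (cid2 _) => /= a _ ->.
  by rewrite [LHS]rmorph0 nth_default.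
have [r qr] := closed_field_poly_normal q.
move: px; rewrite -qE qr map_polyZ rootZ; last first.
  by rewrite fmorph_eq0 lead_coef_eq0 -(map_poly_eq0 iota) qE.
rewrite rmorph_prod /= (eq_bigr (fun z : C => 'X - (iota z)%:P)); last first.
  by move=> z _; rewrite rmorphB /= map_polyX map_polyC.
rewrite -(big_map iota xpredT (fun z : L => 'X - z%:P)) root_prod_XsubC.
by case/mapP => c _ ->; exists c.
Qed.

Section Fractions.
Variables (n : nat) (t : 'I_n -> L).
Local Notation ev := (mmap iota t).

Definition fractions : set L :=
  [set x | exists P Q, ev Q != 0 /\ x = ev P / ev Q].

Fact fractions_closed : let F := fractions in [/\ F 1,
  forall x y, F x -> F y -> F (x - y) & forall x y, F x -> F y -> F (x / y)].
Proof.
split=> [|_ _ [P [Q [Q0 ->]]] [P' [Q' [Q'0 ->]]]|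
  _ _ [P [Q [Q0 ->]]] [P' [Q' [Q'0 ->]]]].
- by exists 1, 1; rewrite rmorph1 divr1 oner_neq0.
- exists (P * Q' - P' * Q), (Q * Q'); rewrite rmorphB !rmorphM mulf_neq0 //.
  by split=> //; field; rewrite Q0 Q'0.
- have [P'0|P'0] := eqVneq (ev P') 0.
    by exists 0, 1; rewrite rmorph1 oner_neq0 P'0 mul0r invr0 mulr0 rmorph0 mul0r.
  exists (P * Q'), (Q * P'); rewrite !rmorphM mulf_neq0 //.
  by split=> //; field; rewrite Q0 P'0 Q'0.
Qed.

Lemma adj_fractions : adj (range t) `<=` fractions.
Proof.
apply: (adj_le (F := Subfld fractions_closed)) => [c|_ [i _ <-]].
  by exists c%:MP, 1; rewrite rmorph1 oner_neq0 mmapC divr1.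
by exists 'X_i, 1; rewrite rmorph1 oner_neq0 mmapXU divr1.
Qed.

Lemma common_denominator (p : {poly L}) : (forall i, fractions p`_i) ->
  exists Q (P : nat -> {mpoly C[n]}),
    ev Q != 0 /\ forall i, ev Q * p`_i = ev (P i).
Proof.
elim/poly_ind: p => [_|p c IH pF].
  by exists 1, (fun=> 0); rewrite rmorph1 oner_neq0; split=> // i; rewrite coef0 mulr0 rmorph0.
have [|Q [P [Q0 PE]]] := IH.
  by move=> i; have := pF i.+1; rewrite coefD coefMX coefC addr0.
have [A [B [B0 cE]]] := pF 0; rewrite coefD coefMX coefC /= add0r in cE.
exists (Q * B), (fun i => if i is j.+1 then P j * B else Q * A).
rewrite !rmorphM mulf_neq0 //; split=> // -[|i]; rewrite coefD coefMX coefC /=.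
  by rewrite add0r cE rmorphM; field.
by rewrite addr0 rmorphM /= -PE; ring.
Qed.

End Fractions.

Lemma mmap_mwiden n (h : 'I_n.+1 -> L) (p : {mpoly C[n]}) :
  mmap iota h (mwiden p) = mmap iota (h \o widen_ord (leqnSn n)) p.
Proof.
elim/mpoly_ring_ind: p => [c|i|p q IHp IHq|p q IHp IHq].
- by rewrite mwidenC !mmapC.
- by rewrite mwidenX mnmwiden1 !mmapXU.
- rewrite !rmorphD; exact: (congr2 +%R IHp IHq).
- rewrite !rmorphM; exact: (congr2 *%R IHp IHq).
Qed.

Lemma meval_mwiden n (h : 'I_n.+1 -> C) (p : {mpoly C[n]}) :
  (mwiden p).@[h] = p.@[h \o widen_ord (leqnSn n)].
Proof.
elim/mpoly_ring_ind: p => [c|i|p q IHp IHq|p q IHp IHq].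
- by rewrite mwidenC !mevalC.
- by rewrite mwidenX mnmwiden1 !mevalXU.
- rewrite !rmorphD; exact: (congr2 +%R IHp IHq).
- rewrite !rmorphM; exact: (congr2 *%R IHp IHq).
Qed.

(** Clearing denominators in an equation of the last element over the field of the others gives the
    relation. It is nonzero because specialising all variables but the last recovers the values of
    each coefficient. *)
Lemma algebraic_dependent n (h : 'I_n.+1 -> L) :
  algcl (adj (range (h \o widen_ord (leqnSn n)))) (h ord_max) ->
  exists2 p : {mpoly C[n.+1]}, p != 0 & mmap iota h p = 0.
Proof.
move=> /(algOverS (@adj_fractions _ _)) [p [p0 pF pz]].
have [Q [P [Q0 PE]]] := common_denominator pF.
exists (\sum_(i < size p) mwiden (P i) * 'X_ord_max ^+ i); last first.
  have E i : mmap iota h (mwiden (P i) * 'X_ord_max ^+ i) =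
      mmap iota (h \o widen_ord (leqnSn n)) Q * (p`_i * h ord_max ^+ i).
    by rewrite rmorphM rmorphXn /= mmap_mwiden mmapXU -PE mulrA.
  rewrite rmorph_sum (eq_bigr _ (fun (i : 'I_(size p)) _ => E i)).
  by rewrite -mulr_sumr -horner_coef (rootP pz) mulr0.
apply/negP => /eqP F0; move/eqP: p0; apply; apply/polyP => i; rewrite coef0.
have [hi|hi] := ltnP i (size p); last by rewrite nth_default.
suff Pi0 : P i = 0.
  by apply/eqP; rewrite -(mulrI_eq0 _ (mulfI Q0)) PE Pi0 rmorph0.
apply: mpoly_eq0 => v.
have : \poly_(j < size p) (P j).@[v] = 0.
  apply/eqP/negPn/negP => /closed_nonrootP[c]; apply/negP; rewrite negbK.
  pose w := fun i : 'I_n.+1 => if unlift ord_max i is Some j then v j else c.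
  have := congr1 (meval w) F0; rewrite meval0 rmorph_sum /= => F0'.
  rewrite rootE horner_poly -[X in _ == X]F0'; apply/eqP/eq_bigr => j _.
  rewrite rmorphM rmorphXn /= mevalXU meval_mwiden {2}/w unlift_none.
  congr (_ * _); apply: meval_eq => k /=; rewrite /w.
  have -> : widen_ord (leqnSn n) k = lift ord_max k.
    by apply: val_inj; rewrite /= /bump leqNgt ltn_ord.
  by rewrite liftK.
by move/(congr1 (coefp i)); rewrite /= coef_poly hi coef0.
Qed.

(* [x] is the inner variable, [y] the outer one. *)
Definition eval2 x y (F : {poly {poly C}}) : L :=
  (map_poly (fun q => (map_poly iota q).[x]) F).[y].

Lemma transcendental_pair x y (F : {poly {poly C}}) : ~ range iota x ->
  ~ algcl (adj [set x]) y -> eval2 x y F = 0 -> F = 0.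
Proof.
move=> xC yx F0; apply: contrapT => /eqP Fn0; apply: yx.
pose ex : {poly C} -> L := fun q => (map_poly iota q).[x].
(* Evaluation at the transcendental [x] is injective, so a nonzero [F] stays nonzero when its
   coefficients are evaluated and would make [y] algebraic. *)
have ex0 q : ex q = 0 -> q = 0.
  move=> qx; apply: contrapT => /eqP q0; apply: xC.
  apply: algcl_constants; exists (map_poly iota q).
  split; [by rewrite map_poly_eq0|move=> i|exact/eqP].
  by rewrite coef_map; exists q`_i.
have ex00 : ex 0 = 0 by rewrite /ex rmorph0 horner0.
have coefE i : (map_poly ex F)`_i = ex F`_i.
  by rewrite coef_map_id0.
exists (map_poly ex F); split; last exact/eqP.
  apply/negP => /eqP h; move/eqP: Fn0; apply; apply/polyP => i.
  by rewrite coef0; apply: ex0; rewrite -coefE h coef0.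
move=> i; rewrite coefE /ex horner_coef; apply: sf_sum => j _.
rewrite coef_map; apply: sfM; first exact: adj_iota.
by apply: sfX; apply: adj_sub.
Qed.

Definition bivariate (p : {mpoly C[2]}) : {poly {poly C}} :=
  mmap (polyC \o polyC) (fun i : 'I_2 => if i == ord0 then 'X%:P else 'X) p.

Lemma bivariateE (x y : L) p :
  eval2 x y (bivariate p) = mmap iota (fun i : 'I_2 => if i == ord0 then x else y) p.
Proof.
rewrite /eval2; set ex := fun q : {poly C} => _.
pose m : {rmorphism {poly {poly C}} -> L} :=
  horner_eval y \o map_poly (horner_eval x \o map_poly iota).
rewrite -[LHS]/(m (bivariate p)) rmorph_mmap.
rewrite /mmap; apply: eq_bigr => i _; congr (_ * _).
  by rewrite /m /= map_polyC /= map_polyC /horner_eval /= !hornerC.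
apply: mmap1_eq => j; rewrite /m /=; case: ifP => _.
  by rewrite map_polyC /= map_polyX /horner_eval /= hornerC hornerX.
by rewrite map_polyX /horner_eval hornerX.
Qed.

Lemma bivariate_eq0 p : bivariate p = 0 -> p = 0.
Proof.
move=> p0; apply: mpoly_eq0 => v.
have := congr1 (fun F => F.[(v ord_max)%:P].[v ord0]) p0; rewrite !horner0 => <-.
pose m : {rmorphism {poly {poly C}} -> C} :=
  horner_eval (v ord0) \o horner_eval (v ord_max)%:P.
rewrite -[RHS]/(m (bivariate p)) rmorph_mmap.
rewrite /meval /mmap; apply: eq_bigr => i _; congr (_ * _).
  by rewrite /m /= /horner_eval !hornerC.
apply: mmap1_eq => j; rewrite /m /= /horner_eval; case: eqP => [->|/eqP j0].
  by rewrite hornerC hornerX.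
rewrite hornerX hornerC; congr v; apply: val_inj.
by case: j j0 => [[|[]]].
Qed.

(** The exchange property: the relation between [x] and [y], read with its variables swapped, would
    be trivial if [x] were transcendental over [y]. *)
Lemma algcl_exchange x y : algcl (adj [set x]) y -> ~ range iota y ->
  algcl (adj [set y]) x.
Proof.
move=> yx yC; apply: contrapT => xy.
pose h (i : 'I_2) := if i == ord0 then x else y.
have [|p p0 ph] := @algebraic_dependent 1 h.
  rewrite [h _]/=; apply: (algcl_adj _ _ yx) => [c|_ ->]; first exact: adj_iota.
  by apply: algOver_id; apply: adj_sub; exists ord0.
have swap : mmap iota (fun i : 'I_2 => if i == ord0 then y else x)
  (p \mPo [tuple 'X_ord_max; 'X_ord0]) = 0.
  rewrite mmap_mPo -[RHS]ph; apply: mmap_eq => -[[|[|//]] hi] /=;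
  by rewrite (tnth_nth 0) /= mmapXU.
move: (swap); rewrite -bivariateE => /(transcendental_pair yC xy)/bivariate_eq0 q0.
move/eqP: p0; apply; apply: mpoly_eq0 => v.
have := congr1 (meval (fun i : 'I_2 => if i == ord0 then v ord_max else v ord0)) q0.
rewrite meval0 comp_mpoly_meval => <-; apply: meval_eq => -[[|[|//]] hi];
by rewrite (tnth_nth 0) /= mevalXU /=; congr v; apply: val_inj.
Qed.

(** This is invariance of the transcendence degree for two elements. If [a], [b] were dependent, a
    single element would have [x] and [y] in its algebraic closure, and exchange would make [y]
    algebraic over [x]. *)
Lemma generators_independent x y a b : ~ range iota x ->
  ~ algcl (adj [set x]) y -> algcl (adj [set a; b]) x ->
  algcl (adj [set a; b]) y ->
  ~ range iota a /\ ~ algcl (adj [set a]) b.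
Proof.
move=> xC yx xab yab.
have single z : ~ (forall w, algcl (adj [set a; b]) w -> algcl (adj [set z]) w).
  move=> hz; apply: yx; have := hz _ yab; apply: algcl_adj => [c|_ ->].
    exact: adj_iota.
  by apply: algcl_exchange (hz _ xab) xC.
split=> [[c _ ac]|ba].
  apply: (single b) => w; apply: algcl_adj => [d|_ [->|->]]; first exact: adj_iota.
    by apply: algOver_id; rewrite -ac; exact: adj_iota.
  exact/algOver_id/adj_sub.
apply: (single a) => w; apply: algcl_adj => [d|_ [->|->]] //; first exact: adj_iota.
exact/algOver_id/adj_sub.
Qed.

End AlgebraicOverConstants.

(** * Derivations *)

Definition derivation (R : nzRingType) (d : R -> R) : Prop :=
  {morph d : x y / x + y} /\ forall x y, d (x * y) = d x * y + x * d y.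

Section Derivations.
Variables (R : nzRingType) (d : R -> R).
Hypothesis dP : derivation d.

Lemma derD x y : d (x + y) = d x + d y. Proof. by case: dP. Qed.
Lemma derM x y : d (x * y) = d x * y + x * d y. Proof. by case: dP. Qed.
Lemma der0 : d 0 = 0.
Proof. by apply: (addrI (d 0)); rewrite -derD !addr0. Qed.
Lemma derN x : d (- x) = - d x.
Proof. by apply: (addrI (d x)); rewrite -derD !subrr der0. Qed.
Lemma derB x y : d (x - y) = d x - d y.
Proof. by rewrite derD derN. Qed.
Lemma der1 : d 1 = 0.
Proof. by apply: (addrI (d 1)); rewrite addr0 -[in RHS](mulr1 1) derM mulr1 mul1r. Qed.
Lemma der_sum (I : Type) (r : seq I) (P : pred I) (F : I -> R) :
  d (\sum_(i <- r | P i) F i) = \sum_(i <- r | P i) d (F i).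
Proof. exact: (big_morph _ derD der0). Qed.

End Derivations.

Lemma deriv_derivation (R : comNzRingType) : derivation (@deriv R).
Proof. by split=> p q; rewrite ?derivD ?derivM. Qed.

Lemma derX (R : comNzRingType) (d : R -> R) : derivation d ->
  forall x n, d (x ^+ n) = x ^+ n.-1 *+ n * d x.
Proof.
move=> dP x; elim=> [|n IH]; first by rewrite expr0 (der1 dP) mulr0n mul0r.
rewrite exprS (derM dP) IH /=; case: n {IH} => [|n] /=.
  by rewrite expr0 mulr1n mulr0n mul0r mulr0 addr0 mulr1 mul1r.
by rewrite (mulrS _ n.+1) mulrDl [d x * _]mulrC mulrA mulrnAr -exprS.
Qed.

Lemma der_map_poly (R : comNzRingType) (d : R -> R) :
  derivation d -> derivation (map_poly d).
Proof.
move=> dP; have cE (p : {poly R}) i : (map_poly d p)`_i = d p`_i.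
  by rewrite coef_map_id0 // der0.
split=> p q; apply/polyP => i; rewrite ?coefD !cE ?coefD ?(derD dP) //.
rewrite !coefM (der_sum dP) -big_split; apply: eq_bigr => j _.
by rewrite (derM dP) !cE.
Qed.

Lemma der_map_polyC (R : comNzRingType) (d : R -> R) c :
  derivation d -> map_poly d c%:P = (d c)%:P.
Proof.
move=> dP; apply/polyP => i; rewrite coef_map_id0 ?(der0 dP) // !coefC.
by case: eqP; rewrite ?(der0 dP).
Qed.

Lemma der_map_polyX (R : comNzRingType) (d : R -> R) :
  derivation d -> map_poly d 'X = 0.
Proof.
move=> dP; apply/polyP => i; rewrite coef_map_id0 ?(der0 dP) // coefX coef0.
by case: eqP; rewrite ?(der0 dP) ?(der1 dP).
Qed.

Section QuotientRule.
Variables (R : comNzRingType) (E : fieldType) (f : {rmorphism R -> E}) (d : R -> R).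
Hypothesis dP : derivation d.

Let q (a b : R) : E := (f (d a) * f b - f a * f (d b)) / f b ^+ 2.

(** The quotient rule gives the same value on two representations of one fraction; this makes
    [dfrac] independent of the representation it chooses. *)
Lemma quotient_rule_eq a b n e : f b != 0 -> f e != 0 -> a * e = n * b ->
  q a b = q n e.
Proof.
move=> b0 e0 ae.
have dE : f (d a) * f e + f a * f (d e) = f (d n) * f b + f n * f (d b).
  by have := congr1 (f \o d) ae; rewrite /= !(derM dP) !rmorphD !rmorphM.
have aE : f a = f n * f b / f e.
  by apply: (canRL (mulfK e0)); rewrite -!rmorphM ae.
have daE : f (d a) = (f (d n) * f b + f n * f (d b) - f a * f (d e)) / f e.
  by apply: (canRL (mulfK e0)); rewrite -dE addrK.
by rewrite /q daE aE; field; rewrite b0 e0.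
Qed.

Lemma quotient_ruleD a b a' b' : f b != 0 -> f b' != 0 ->
  q (a * b' + a' * b) (b * b') = q a b + q a' b'.
Proof.
move=> b0 b'0; rewrite /q !(derD dP, derM dP) !(rmorphD, rmorphM).
by field; rewrite b0 b'0.
Qed.

Lemma quotient_ruleM a b a' b' : f b != 0 -> f b' != 0 ->
  q (a * a') (b * b') = q a b * (f a' / f b') + (f a / f b) * q a' b'.
Proof.
move=> b0 b'0; rewrite /q !(derM dP) !(rmorphD, rmorphM).
by field; rewrite b0 b'0.
Qed.

Lemma quotientD a b a' b' : f b != 0 -> f b' != 0 ->
  f a / f b + f a' / f b' = f (a * b' + a' * b) / f (b * b').
Proof. by move=> b0 b'0; rewrite rmorphD !rmorphM; field; rewrite b0 b'0. Qed.

Lemma quotientB a b a' b' : f b != 0 -> f b' != 0 ->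
  f a / f b - f a' / f b' = f (a * b' - a' * b) / f (b * b').
Proof. by move=> b0 b'0; rewrite rmorphB !rmorphM; field; rewrite b0 b'0. Qed.

Lemma quotient_eq a b a' b' : f b != 0 -> f b' != 0 -> f (a * b' - a' * b) = 0 ->
  f a / f b = f a' / f b'.
Proof.
move=> b0 b'0; rewrite rmorphB !rmorphM => /eqP; rewrite subr_eq0 => /eqP abE.
by apply/eqP; rewrite eqr_div // abE.
Qed.

Lemma quotientM a b a' b' :
  f a / f b * (f a' / f b') = f (a * a') / f (b * b').
Proof. by rewrite mulf_div !rmorphM. Qed.

End QuotientRule.

Section FractionDerivation.
Variables (R : idomainType) (d : R -> R).
Hypothesis dP : derivation d.

Lemma fracE (z : {fraction R}) :
  exists a b : R, b != 0 /\ z = a%:F / b%:F.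
Proof.
elim/quotW: z => x; exists \n_x, \d_x; split; first exact: denom_ratioP.
apply: (canRL (mulfK _)); first by rewrite tofrac_eq0 denom_ratioP.
rewrite !piE; apply/eqmodP; rewrite /= FracField.equivfE.
by rewrite !numden_Ratio ?mulf_neq0 ?oner_eq0 ?denom_ratioP // !mulr1 mulrC.
Qed.

Definition dfrac (z : {fraction R}) : {fraction R} :=
  let a := projT1 (cid (fracE z)) in
  let b := projT1 (cid (projT2 (cid (fracE z)))) in
  ((d a)%:F * b%:F - a%:F * (d b)%:F) / b%:F ^+ 2.

Lemma dfracE a b : b != 0 ->
  dfrac (a%:F / b%:F) = ((d a)%:F * b%:F - a%:F * (d b)%:F) / b%:F ^+ 2.
Proof.
move=> b0; rewrite /dfrac; case: (cid _) => n h /=; case: (cid _) => e [e0 zE] /=.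
apply: (quotient_rule_eq (f := @FracField.tofrac R)); rewrite ?tofrac_eq0 //.
have bF : b%:F != 0 by rewrite tofrac_eq0.
have eF : e%:F != 0 by rewrite tofrac_eq0.
by move/eqP: zE; rewrite eqr_div // -!tofracM tofrac_eq => /eqP.
Qed.

Lemma dfrac_tofrac a : dfrac a%:F = (d a)%:F.
Proof.
have := @dfracE a 1 (oner_neq0 _); rewrite !tofrac1 divr1 => ->.
by rewrite (der1 dP) tofrac0 mulr0 subr0 mulr1 expr1n divr1.
Qed.

Lemma dfrac_derivation : derivation dfrac.
Proof.
pose f : {rmorphism R -> {fraction R}} := @FracField.tofrac R.
split=> x y; have [a [b [b0 ->]]] := fracE x; have [a' [b' [b'0 ->]]] := fracE y;
  have bF : f b != 0 by rewrite tofrac_eq0.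
all: have b'F : f b' != 0 by rewrite tofrac_eq0.
- have -> := quotientD a a' bF b'F.
  by rewrite !dfracE ?mulf_neq0 //; exact: (quotient_ruleD dP).
- have -> := quotientM f a b a' b'.
  by rewrite !dfracE ?mulf_neq0 //; exact: (quotient_ruleM dP).
Qed.

End FractionDerivation.
Global Opaque dfrac.

Section FieldDerivation.
Variables (L : fieldType) (d : L -> L).
Hypothesis dP : derivation d.

Fact der_kernel_closed : let F := [set x | d x = 0] in [/\ F 1,
  forall x y, F x -> F y -> F (x - y) & forall x y, F x -> F y -> F (x / y)].
Proof.
split=> [|x y|x y] /=; first exact: der1.
- by move=> dx dy; rewrite (derB dP) dx dy subr0.
- move=> dx dy; rewrite (derM dP) dx mul0r add0r.
  have [->|y0] := eqVneq y 0; first by rewrite invr0 (der0 dP) mulr0.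
  have := der1 dP; rewrite -(mulfV y0) (derM dP) dy mul0r add0r => /eqP.
  by rewrite mulf_eq0 (negPf y0) /= => /eqP ->; rewrite mulr0.
Qed.

Lemma der_horner (p : {poly L}) z : (forall i, d p`_i = 0) ->
  d p.[z] = p^`().[z] * d z.
Proof.
elim/poly_ind: p => [|p c IH] hp; first by rewrite deriv0 !horner0 mul0r der0.
have dc : d c = 0 by have := hp 0; rewrite coefD coefMX coefC add0r.
rewrite !hornerE (derD dP) (derM dP) dc addr0 IH; last first.
  by move=> i; have := hp i.+1; rewrite coefD coefMX coefC addr0.
by rewrite derivD derivM derivX derivC !hornerE; ring.
Qed.

Lemma der_algebraic (F : L -> Prop) z : (forall n, n.+1%:R != 0 :> L) ->
  (forall x, F x -> d x = 0) -> (forall x n, F x -> F (x *+ n)) ->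
  algOver F z -> d z = 0.
Proof.
move=> char0 Fd Fn [p [p0 Fp pz]].
have [n] := ubnP (size p); elim: n p p0 Fp pz => // n IH p p0 Fp pz pn.
apply/eqP; apply: contraT => dz.
have p'z : root p^`() z.
  have := @der_horner p z (fun i => Fd _ (Fp i)).
  by rewrite (rootP pz) (der0 dP) => /esym/eqP; rewrite mulf_eq0 (negPf dz) orbF.
have [p'0|p'0] := eqVneq p^`() 0; last first.
  rewrite (IH _ p'0 _ p'z) ?eqxx // in dz => [i|]; first by rewrite coef_deriv; exact: Fn.
  exact: leq_trans (lt_size_deriv p0) pn.
have pC : p = (p`_0)%:P.
  apply/polyP => -[|i]; rewrite coefC //=; have := congr1 (coefp i) p'0.
  rewrite /= coef0 coef_deriv => /eqP.
  by rewrite -mulr_natr mulf_eq0 (negPf (char0 _)) orbF => /eqP.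
by move: pz p0; rewrite pC rootC => /eqP ->; rewrite eqxx.
Qed.

End FieldDerivation.

(** * Binary quartics and the Kummer argument *)

Section Quartic.
Variable R : comNzRingType.
Implicit Types (e : nat -> R) (X Y : R).

Definition quartic e X Y : R := e 0 * X ^+ 4 + e 1 * X ^+ 3 * Y
  + e 2 * X ^+ 2 * Y ^+ 2 + e 3 * X * Y ^+ 3 + e 4 * Y ^+ 4.
Definition quartic_dx e X Y : R := 4%:R * e 0 * X ^+ 3
  + 3%:R * e 1 * X ^+ 2 * Y + 2%:R * e 2 * X * Y ^+ 2 + e 3 * Y ^+ 3.
Definition quartic_dy e X Y : R := e 1 * X ^+ 3
  + 2%:R * e 2 * X ^+ 2 * Y + 3%:R * e 3 * X * Y ^+ 2 + 4%:R * e 4 * Y ^+ 3.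

Lemma quarticZ e c X Y : quartic e (c * X) (c * Y) = c ^+ 4 * quartic e X Y.
Proof. by rewrite /quartic; ring. Qed.

Lemma der_quartic (d : R -> R) e X Y : derivation d -> (forall i, d (e i) = 0) ->
  d (quartic e X Y) = quartic_dx e X Y * d X + quartic_dy e X Y * d Y.
Proof.
move=> dP de; rewrite /quartic !(derD dP, derM dP, derX dP) !de.
by rewrite /quartic_dx /quartic_dy /=; ring.
Qed.

(** Euler's relation [X f_X + Y f_Y = 4 f] and the chain rule [d f = f_X dX + f_Y dY] form a linear
    system whose determinant is the Wronskian; Cramer's rule solves it. *)
Lemma quartic_dx_wronskian (d : R -> R) e X Y : derivation d ->
  (forall i, d (e i) = 0) ->
  quartic_dx e X Y * (X * d Y - Y * d X)
  = 4%:R * quartic e X Y * d Y - Y * d (quartic e X Y).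
Proof.
move=> dP de; rewrite (der_quartic _ _ dP de).
by rewrite /quartic /quartic_dx /quartic_dy; ring.
Qed.

Lemma quartic_dy_wronskian (d : R -> R) e X Y : derivation d ->
  (forall i, d (e i) = 0) ->
  quartic_dy e X Y * (X * d Y - Y * d X)
  = X * d (quartic e X Y) - 4%:R * quartic e X Y * d X.
Proof.
move=> dP de; rewrite (der_quartic _ _ dP de).
by rewrite /quartic /quartic_dx /quartic_dy; ring.
Qed.

End Quartic.

Lemma rmorph_quartic (R S : comNzRingType) (f : {rmorphism R -> S}) e X Y :
  f (quartic e X Y) = quartic (f \o e) (f X) (f Y).
Proof. by rewrite /quartic !(rmorphD, rmorphM, rmorphXn). Qed.

Lemma rmorph_quartic_dx (R S : comNzRingType) (f : {rmorphism R -> S}) e X Y :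
  f (quartic_dx e X Y) = quartic_dx (f \o e) (f X) (f Y).
Proof. by rewrite /quartic_dx !(rmorphD, rmorphM, rmorphXn, rmorph_nat). Qed.

Lemma rmorph_quartic_dy (R S : comNzRingType) (f : {rmorphism R -> S}) e X Y :
  f (quartic_dy e X Y) = quartic_dy (f \o e) (f X) (f Y).
Proof. by rewrite /quartic_dy !(rmorphD, rmorphM, rmorphXn, rmorph_nat). Qed.

(** By Euler's relation, in characteristic zero a common zero of the partial derivatives is a
    multiple zero of the form on the projective line. *)
Definition separable_quartic (C : comNzRingType) (e : nat -> C) : Prop :=
  forall a b, quartic_dx e a b = 0 -> quartic_dy e a b = 0 -> a = 0 /\ b = 0.

Section QuarticValues.
Variables (C : closedFieldType) (k : fieldType) (j : {rmorphism C -> k}).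
Variable e : nat -> C.
Hypothesis e_sep : separable_quartic e.
Local Notation P := {poly k}.
Let cst : {rmorphism C -> P} := polyC \o j.
Local Notation ce := (cst \o e).

(** The two partial derivatives have no common zero on the projective line, and coprime [X], [Y]
    give a point of that line modulo any common divisor [g]. *)
Lemma coprimep_quartic (X Y : P) : coprimep X Y ->
  coprimep (quartic_dx ce X Y) (quartic_dy ce X Y).
Proof.
move=> XY; set g1 := quartic_dx _ _ _; set g2 := quartic_dy _ _ _.
apply/coprimepP => g gg1 gg2.
(* Modulo a common divisor of [g] and [X] the partial derivatives are [e 3] and [4 e 4] times
   [Y ^+ 3]; these constants are not both zero, since (0 : 1) is not a multiple zero. *)
have gX : coprimep g X.
  apply/coprimepP => h hg hX; rewrite -size_poly_eq1 -dvdp1.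
  have hY3 (c : C) (u : P) : h %| u * X + cst c * Y ^+ 3 -> c != 0 -> h %| 1.
    rewrite (dvdp_addr _ (dvdp_mull u hX)) => h3 c0.
    have hc := coprimep_dvdr hX (coprimep_expr 3 XY).
    rewrite (Gauss_dvdpl _ hc) in h3; apply: dvdp_trans h3 _.
    by rewrite /= dvdp1 size_polyC fmorph_eq0 c0.
  have [x0|x0] := eqVneq (e 3) 0; last first.
    apply: (hY3 (e 3) (4%:R * ce 0 * X ^+ 2 + 3%:R * ce 1 * X * Y
      + 2%:R * ce 2 * Y ^+ 2)) => //.
    rewrite (_ : _ + _ = g1); first exact: dvdp_trans gg1.
    by rewrite /g1 /quartic_dx /=; ring.
  apply: (hY3 (4%:R * e 4) (ce 1 * X ^+ 2 + 2%:R * ce 2 * X * Y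
      + 3%:R * ce 3 * Y ^+ 2)).
    rewrite (_ : _ + _ = g2); first exact: dvdp_trans gg2.
    by rewrite /g2 /quartic_dy rmorphM rmorph_nat /=; ring.
  apply/negP => /eqP y0; have [] := e_sep (a := 0) (b := 1).
  - by rewrite /quartic_dx x0; ring.
  - by rewrite /quartic_dy expr1n mulr1 y0; ring.
  - by move=> _ /eqP; rewrite oner_eq0.
have [[u v] /= uv] := Bezout_eq1_coprimepP _ _ gX.
(* As [v] inverts [X] modulo [g], the point (X : Y) is (1 : t) there, and the dehomogenised partial
   derivatives are the values at [t] of coprime polynomials over [C]. Their Bezout identity shows
   that [g] divides 1. *)
pose t : P := v * Y.
have vX1 : v * X - 1 = - u * g by rewrite -uv; ring.
pose m : {rmorphism {poly C} -> P} := horner_eval t \o map_poly cst.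
have mC c : m c%:P = cst c by rewrite /m /= map_polyC /horner_eval hornerC.
have mX : m 'X = t by rewrite /m /= map_polyX /horner_eval hornerX.
have mCe i : (m \o (polyC \o e)) i = cst (e i) by exact: mC.
have ceE i : ce i = cst (e i) by [].
have gx : g %| m (quartic_dx (polyC \o e) 1 'X).
  have -> : m (quartic_dx (polyC \o e) 1 'X) = v ^+ 3 * g1
     + g * (u * (4%:R * ce 0 * ((v * X) ^+ 2 + v * X + 1)
       + 3%:R * ce 1 * (v * X + 1) * t + 2%:R * ce 2 * t ^+ 2)).
    have -> : g * (u * (4%:R * ce 0 * ((v * X) ^+ 2 + v * X + 1)
       + 3%:R * ce 1 * (v * X + 1) * t + 2%:R * ce 2 * t ^+ 2))
       = - (v * X - 1) * (4%:R * ce 0 * ((v * X) ^+ 2 + v * X + 1)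
       + 3%:R * ce 1 * (v * X + 1) * t + 2%:R * ce 2 * t ^+ 2) by rewrite vX1; ring.
    rewrite rmorph_quartic_dx rmorph1 mX /g1 /quartic_dx !mCe !ceE /t.
    by move: (cst (e 0)) (cst (e 1)) (cst (e 2)) (cst (e 3)) => c0 c1 c2 c3; ring.
  by rewrite (dvdp_addl _ (dvdp_mulr _ (dvdpp g))) dvdp_mull.
have gy : g %| m (quartic_dy (polyC \o e) 1 'X).
  have -> : m (quartic_dy (polyC \o e) 1 'X) = v ^+ 3 * g2
     + g * (u * (ce 1 * ((v * X) ^+ 2 + v * X + 1)
       + 2%:R * ce 2 * (v * X + 1) * t + 3%:R * ce 3 * t ^+ 2)).
    have -> : g * (u * (ce 1 * ((v * X) ^+ 2 + v * X + 1)
       + 2%:R * ce 2 * (v * X + 1) * t + 3%:R * ce 3 * t ^+ 2))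
       = - (v * X - 1) * (ce 1 * ((v * X) ^+ 2 + v * X + 1)
       + 2%:R * ce 2 * (v * X + 1) * t + 3%:R * ce 3 * t ^+ 2) by rewrite vX1; ring.
    rewrite rmorph_quartic_dy rmorph1 mX /g2 /quartic_dy !mCe !ceE /t.
    by move: (cst (e 1)) (cst (e 2)) (cst (e 3)) (cst (e 4)) => c1 c2 c3 c4; ring.
  by rewrite (dvdp_addl _ (dvdp_mulr _ (dvdpp g))) dvdp_mull.
set qx := quartic_dx _ _ _ in gx; set qy := quartic_dy _ _ _ in gy.
have : coprimep qx qy.
  apply: Pdiv.ClosedField.root_coprimep => a; rewrite /root => /eqP qxa; apply/negP => /eqP qya.
  have [] := e_sep (a := 1) (b := a).
  - rewrite -qxa -[RHS]/(horner_eval a qx) rmorph_quartic_dx.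
    by rewrite /quartic_dx /= /horner_eval !hornerE.
  - rewrite -qya -[RHS]/(horner_eval a qy) rmorph_quartic_dy.
    by rewrite /quartic_dy /= /horner_eval !hornerE.
  - by move=> /eqP; rewrite oner_eq0.
case/Bezout_eq1_coprimepP => -[a b] /= /(congr1 m).
rewrite rmorphD !rmorphM rmorph1 => ab.
by rewrite -size_poly_eq1 -dvdp1 -ab dvdp_add ?dvdp_mull.
Qed.

End QuarticValues.

(** For a derivation [d], this is [X ^+ 2] times the derivative of [Y / X]. *)
Definition wronskian (R : pzRingType) (d : R -> R) (X Y : R) := X * d Y - Y * d X.

Lemma wronskianM (R : comNzRingType) (d : R -> R) (g X Y : R) : derivation d ->
  wronskian d (g * X) (g * Y) = g ^+ 2 * wronskian d X Y.
Proof. by move=> dP; rewrite /wronskian !(derM dP); ring. Qed.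

Section KummerSurface.
Variables (C : closedFieldType) (k : fieldType) (j : {rmorphism C -> k}).
Local Notation P := {poly k}.
Let cst : {rmorphism C -> P} := polyC \o j.

Variables (d1 d2 : P -> P).
Hypothesis d1P : derivation d1.
Hypothesis d2P : derivation d2.
Hypothesis d1C : forall c, d1 (cst c) = 0.
Hypothesis d2C : forall c, d2 (cst c) = 0.
Hypothesis d1_size : forall p, (size (d1 p) <= (size p).-1)%N.
Hypothesis d2_size : forall p, (size (d2 p) <= size p)%N.

(** Up to the factor [X ^+ 2 * Z ^+ 2], this is the Jacobian of [Y / X] and [T / Z] with respect to
    [d1] and [d2]. *)
Let J (X Y Z T : P) :=
  wronskian d1 X Y * wronskian d2 Z T - wronskian d2 X Y * wronskian d1 Z T.

(** A [size] is a degree plus one, so the degree is below [2m + 2n]: each product contains [d1]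
    exactly once, and [d1] lowers degrees while [d2] does not raise them. *)
Let J_size m n (X Y Z T : P) : (size X <= m.+1)%N -> (size Y <= m.+1)%N ->
  (size Z <= n.+1)%N -> (size T <= n.+1)%N ->
  (size (J X Y Z T) <= m.*2 + n.*2)%N.
Proof.
have leM (p q : P) a b : (size p <= a)%N -> (size q <= b)%N ->
    (size (p * q)%R <= (a + b).-1)%N.
  move=> pa qb; apply: leq_trans (size_polyMleq _ _) _.
  by rewrite -!subn1 leq_sub2r // leq_add.
have leB (p q : P) a : (size p <= a)%N -> (size q <= a)%N -> (size (p - q)%R <= a)%N.
  move=> pa qa; apply: leq_trans (size_polyD _ _) _.
  by rewrite size_polyN geq_max pa.
have w1 i (U V : P) : (size U <= i.+1)%N -> (size V <= i.+1)%N ->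
    (size (wronskian d1 U V) <= i.*2)%N.
  move=> hU hV; have d1i (W : P) : (size W <= i.+1)%N -> (size (d1 W) <= i)%N.
    by move=> hW; apply: leq_trans (d1_size _) _; rewrite -subn1 leq_subLR add1n.
  by rewrite -addnn; apply: leB; [have := leM _ _ _ _ hU (d1i _ hV)|
    have := leM _ _ _ _ hV (d1i _ hU)].
have w2 i (U V : P) : (size U <= i.+1)%N -> (size V <= i.+1)%N ->
    (size (wronskian d2 U V) <= i.*2.+1)%N.
  move=> hU hV; have d2i (W : P) : (size W <= i.+1)%N -> (size (d2 W) <= i.+1)%N.
    exact: leq_trans (d2_size _).
  rewrite -addnn -addnS; apply: leB;
   [have := leM _ _ _ _ hU (d2i _ hV)|have := leM _ _ _ _ hV (d2i _ hU)]; exact.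
move=> hX hY hZ hT.
have := w1 _ _ _ hX hY; have := w2 _ _ _ hX hY.
have := w1 _ _ _ hZ hT; have := w2 _ _ _ hZ hT => a1 a2 a3 a4.
rewrite /J; apply: leB; first by have := leM _ _ _ _ a4 a1; rewrite addnS.
by have := leM _ _ _ _ a3 a2; rewrite addSn.
Qed.

Variables e e' : nat -> C.
Hypothesis e_sep : separable_quartic e.
Hypothesis e'_sep : separable_quartic e'.
Local Notation D := (quartic (cst \o e)).
Local Notation D' := (quartic (cst \o e')).

(* With D(X, Y) = d^2 G and D'(Z, T) = b^2 G, the square root G d b of
   D(X, Y) D'(Z, T) divides the numerator J of the Kummer 2-form, whose degree
   is smaller: a Kummer surface carries a regular 2-form, the plane does not. *)
Let J_coprime m n (X Y Z T b d : P) : coprimep X Y -> coprimep Z T ->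
  (size X <= m.+1)%N -> (size Y <= m.+1)%N ->
  (size Z <= n.+1)%N -> (size T <= n.+1)%N ->
  size (D X Y) = (4 * m).+1 -> size (D' Z T) = (4 * n).+1 ->
  b != 0 -> d != 0 -> D' Z T * d ^+ 2 = D X Y * b ^+ 2 -> J X Y Z T = 0.
Proof.
move=> XY ZT hX hY hZ hT sD sD' b0 d0.
(* Reducing the fraction [b / d] makes the square of its denominator divide [D X Y]; the quotient is
   the common factor [G]. *)
have g0 : gcdp b d != 0 by rewrite gcdp_eq0 negb_and b0.
have : coprimep (b %/ gcdp b d) (d %/ gcdp b d) by apply: coprimep_div_gcd; rewrite b0.
move: (divpK (dvdp_gcdl b d)) (divpK (dvdp_gcdr b d)).
set b1 := b %/ _; set d1' := d %/ _; move=> bE dE bd DD.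
have {}DD : D' Z T * d1' ^+ 2 = D X Y * b1 ^+ 2.
  apply: (mulIf (expf_neq0 2 g0)).
  by rewrite -[LHS]mulrA -[RHS]mulrA -!exprMn bE dE.
have d1n0 : d1' != 0 by apply: contraNneq d0 => h; rewrite -dE h mul0r.
have /dvdpP[G DE] : d1' ^+ 2 %| D X Y.
  have co : coprimep (d1' ^+ 2) (b1 ^+ 2).
    by rewrite coprimep_expl // coprimep_expr // coprimep_sym.
  by rewrite -(Gauss_dvdpl _ co) -DD dvdp_mull.
have D'E : D' Z T = G * b1 ^+ 2.
  by apply: (mulIf (expf_neq0 2 d1n0)); rewrite DD DE; ring.
move: d1' b1 d1n0 bd DD DE D'E {bE dE} => u v u0 uv DD DE D'E.
have arith s2 s1 : s2.-1 = (s1.-1 * 2)%N -> s2 = ((4 * m).+1 + (4 * n).+1).-1 ->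
    (0 < s1)%N -> s1 = (m.*2 + n.*2).+1 by lia.
have sW : size (G * u * v) = (m.*2 + n.*2).+1.
  have W2 : (G * u * v) ^+ 2 = D X Y * D' Z T by rewrite DE D'E; ring.
  have D0 : D X Y != 0 by rewrite -size_poly_gt0 sD.
  have D'0 : D' Z T != 0 by rewrite -size_poly_gt0 sD'.
  have W0 : G * u * v != 0.
    by apply: contraNneq (mulf_neq0 D0 D'0) => h; rewrite -W2 h expr0n.
  have := size_mul D0 D'0; rewrite -W2 sD sD'.
  move: W0; rewrite -size_poly_gt0 => W0 sW; apply: arith sW W0.
  exact: size_exp.
(* The multipliers [a], [a'] will be partial derivatives of the quartics. In the antisymmetric
   expression the products of [d1 G] with [d2 G] cancel, and every remaining term carries [G]. *)
have key (a a' M M' N1 N2 N1' N2' : P) :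
    a * wronskian d1 X Y = u * (M * u * d1 G + G * N1) ->
    a * wronskian d2 X Y = u * (M * u * d2 G + G * N2) ->
    a' * wronskian d1 Z T = v * (M' * v * d1 G + G * N1') ->
    a' * wronskian d2 Z T = v * (M' * v * d2 G + G * N2') ->
    G * u * v %| a * (a' * J X Y Z T).
  move=> h1 h2 h1' h2'.
  have -> : a * (a' * J X Y Z T) = (a * wronskian d1 X Y) * (a' * wronskian d2 Z T)
      - (a * wronskian d2 X Y) * (a' * wronskian d1 Z T) by rewrite /J; ring.
  rewrite h1 h2 h1' h2'.
  apply/dvdpP; exists ((M * u * d1 G + G * N1) * N2' + N1 * (M' * v * d2 G)
     - (M * u * d2 G + G * N2) * N1' - N2 * (M' * v * d1 G)).
  by ring.
have dx_form (d0' : P -> P) : derivation d0' -> (forall c, d0' (cst c) = 0) ->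
    forall ee (U V w : P), quartic (cst \o ee) U V = G * w ^+ 2 ->
    quartic_dx (cst \o ee) U V * wronskian d0' U V
      = w * (- V * w * d0' G + G * (4%:R * w * d0' V - 2%:R * V * d0' w)).
  move=> dP dC ee U V w E.
  have := quartic_dx_wronskian (e := cst \o ee) U V dP (fun i => dC (ee i)).
  rewrite E /wronskian => ->; rewrite (derM dP) expr2 (derM dP); ring.
have dy_form (d0' : P -> P) : derivation d0' -> (forall c, d0' (cst c) = 0) ->
    forall ee (U V w : P), quartic (cst \o ee) U V = G * w ^+ 2 ->
    quartic_dy (cst \o ee) U V * wronskian d0' U V
      = w * (U * w * d0' G + G * (2%:R * U * d0' w - 4%:R * w * d0' U)).
  move=> dP dC ee U V w E.
  have := quartic_dy_wronskian (e := cst \o ee) U V dP (fun i => dC (ee i)).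
  rewrite E /wronskian => ->; rewrite (derM dP) expr2 (derM dP); ring.
have bez (g A B H : P) : coprimep A B -> g %| A * H -> g %| B * H -> g %| H.
  case/Bezout_eq1_coprimepP => -[s t] /= st gA gB.
  have -> : H = s * (A * H) + t * (B * H) by rewrite !mulrA -mulrDl st mul1r.
  by apply: dvdp_add; apply: dvdp_mull.
(* Coprimality of the two partial derivatives of each quartic removes the multipliers. *)
have WJ : G * u * v %| J X Y Z T.
  apply: (bez _ _ _ _ (coprimep_quartic j e'_sep ZT));
    apply: (bez _ _ _ _ (coprimep_quartic j e_sep XY)).
  - by apply: key; [exact: dx_form|exact: dx_form|exact: dx_form|exact: dx_form].
  - by apply: key; [exact: dy_form|exact: dy_form|exact: dx_form|exact: dx_form].
  - by apply: key; [exact: dx_form|exact: dx_form|exact: dy_form|exact: dy_form].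
  - by apply: key; [exact: dy_form|exact: dy_form|exact: dy_form|exact: dy_form].
apply/eqP; apply: contraT => J0; have := dvdp_leq J0 WJ.
by rewrite sW ltnNge (J_size hX hY hZ hT).
Qed.

(** Dividing by the gcd lowers the bound [m] by its degree and the degree of the quartic by four
    times as much, so the quartic keeps the full degree allowed by the bound. *)
Let reduce ee m (X Y : P) : (size X <= m.+1)%N -> (size Y <= m.+1)%N ->
  size (quartic (cst \o ee) X Y) = (4 * m).+1 ->
  exists g X1 Y1 : P, exists m1, [/\ g != 0, X = g * X1, Y = g * Y1, coprimep X1 Y1 &
    [/\ (size X1 <= m1.+1)%N, (size Y1 <= m1.+1)%N
      & size (quartic (cst \o ee) X1 Y1) = (4 * m1).+1]].
Proof.
move=> hX hY sD.
have D0 : quartic (cst \o ee) X Y != 0 by rewrite -size_poly_gt0 sD.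
have XY0 : (X != 0) || (Y != 0).
  rewrite -negb_and; apply: contraNN D0 => /andP[/eqP -> /eqP ->].
  by rewrite /quartic !expr0n /= !mulr0 !addr0.
have g0 : gcdp X Y != 0 by rewrite gcdp_eq0 negb_and.
have co := coprimep_div_gcd XY0.
have XE := divpK (dvdp_gcdl X Y); have YE := divpK (dvdp_gcdr X Y).
move: co XE YE g0; set X1 := X %/ _; set Y1 := Y %/ _; set g := gcdp X Y.
move=> co XE YE g0.
have DE : quartic (cst \o ee) X Y = g ^+ 4 * quartic (cst \o ee) X1 Y1.
  by rewrite -XE -YE ![_ * g]mulrC quarticZ.
have D1 : quartic (cst \o ee) X1 Y1 != 0.
  by apply: contraNneq D0 => h; rewrite DE h mulr0.
have g40 := expf_neq0 4 g0.
have sE : (4 * m).+1 = (size (g ^+ 4) + size (quartic (cst \o ee) X1 Y1)).-1.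
  by rewrite -size_mul // -DE sD.
have sg := size_exp g 4; have gn0 := g0; move: g0 g40 D1; rewrite -!size_poly_gt0 => sg0 sg4 sD1.
have arith' a b c : (4 * m).+1 = (a + b).-1 -> a.-1 = (c.-1 * 4)%N ->
  (0 < c)%N -> (0 < a)%N -> (0 < b)%N -> b = (4 * (m - c.-1)).+1 by lia.
have s1 (U V : P) : (size U <= m.+1)%N -> V * g = U ->
    (size V <= (m - (size g).-1).+1)%N.
  move=> hU VU; have [->|V0] := eqVneq V 0; first by rewrite size_poly0.
  have arith a b : ((a + b).-1 <= m.+1)%N -> (0 < a)%N -> (0 < b)%N ->
    (a <= (m - b.-1).+1)%N by lia.
  move: hU; rewrite -VU (size_mul V0 gn0) => hU.
  by apply: arith hU _ sg0; rewrite size_poly_gt0.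
exists g, X1, Y1, (m - (size g).-1)%N; split=> //.
- by rewrite mulrC XE.
- by rewrite mulrC YE.
- by split; [exact: s1 XE|exact: s1 YE|exact: arith' sE sg _ _ _].
Qed.

Lemma kummer_jacobian m n (X Y Z T b d : P) :
  (size X <= m.+1)%N -> (size Y <= m.+1)%N ->
  (size Z <= n.+1)%N -> (size T <= n.+1)%N ->
  size (D X Y) = (4 * m).+1 -> size (D' Z T) = (4 * n).+1 ->
  b != 0 -> d != 0 -> D' Z T * d ^+ 2 = D X Y * b ^+ 2 ->
  wronskian d1 X Y * wronskian d2 Z T = wronskian d2 X Y * wronskian d1 Z T.
Proof.
move=> hX hY hZ hT sD sD' b0 d0 DD.
have [g [X1 [Y1 [m1 [g0 XE YE co [hX1 hY1 sD1]]]]]] := reduce hX hY sD.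
have [h [Z1 [T1 [n1 [h0 ZE TE co' [hZ1 hT1 sD1']]]]]] := reduce hZ hT sD'.
have /eqP : J X1 Y1 Z1 T1 = 0.
  (* The quartics lose the factors [g ^+ 4] and [h ^+ 4], which are squares and are absorbed by [b]
     and [d]. *)
  apply: (J_coprime co co' hX1 hY1 hZ1 hT1 sD1 sD1' (b := g ^+ 2 * b) (d := h ^+ 2 * d));
    rewrite ?mulf_neq0 ?expf_neq0 //.
  move: DD; rewrite XE YE ZE TE !quarticZ => DD.
  move: DD; move: (quartic _ Z1 T1) (quartic _ X1 Y1) => A B DD.
  by transitivity (h ^+ 4 * A * d ^+ 2); [ring|rewrite DD; ring].
rewrite subr_eq0 => /eqP JE.
by rewrite XE YE ZE TE !wronskianM // mulrACA JE mulrACA.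
Qed.

End KummerSurface.

(** * Plane cubics *)

Section TopCoefficient.
Variable R : comNzRingType.
Implicit Types (p q : {poly R}) (c d : R).

(** The coefficient [c] may be zero: it is the value at infinity of [p] regarded as a form of degree
    [n], hence additive and multiplicative without conditions. *)
Definition top n p c := (size p <= n.+1)%N /\ p`_n = c.

Lemma topC c : top 0 c%:P c.
Proof. by rewrite /top size_polyC coefC; case: eqP. Qed.

Lemma topD n p q c d : top n p c -> top n q d -> top n (p + q) (c + d).
Proof.
move=> [sp <-] [sq <-]; split; last exact: coefD.
by apply: leq_trans (size_polyD _ _) _; rewrite geq_max sp.
Qed.

Lemma topM a b p q c d : top a p c -> top b q d -> top (a + b) (p * q) (c * d).
Proof.
move=> [sp <-] [sq <-]; split.
  apply: leq_trans (size_polyMleq _ _) _.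
  by rewrite -subn1 leq_subLR add1n (leq_trans (leq_add sp sq)) // addSn addnS.
have ha : (a < (a + b).+1)%N by rewrite ltnS leq_addr.
rewrite coefM (bigD1 (Ordinal ha)) //= big1 ?addr0 ?addKn // => i ia.
have [ai|ai] := ltnP a i; first by rewrite nth_default ?mul0r // (leq_trans sp).
have ia' : (i < a)%N by move: ia ai; rewrite -val_eqE /=; lia.
rewrite [X in _ * X]nth_default ?mulr0 //; apply: leq_trans sq _.
by lia.
Qed.

Lemma topX a p c n : top a p c -> top (n * a) (p ^+ n) (c ^+ n).
Proof.
move=> pa; elim: n => [|n IH]; first by rewrite !expr0 mul0n; exact: topC.
by rewrite !exprS mulSn; exact: topM.
Qed.

Lemma top_cast n m p c : top n p c -> n = m -> top m p c.
Proof. by move=> ? <-. Qed.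

Lemma topMC a p c d : top a p c -> top a (d%:P * p) (d * c).
Proof. by move=> pc; have := topM (topC d) pc. Qed.

Lemma top0 n : top n 0 0.
Proof. by rewrite /top size_poly0 coef0. Qed.

Lemma topMn n p c k : top n p c -> top n (p *+ k) (c *+ k).
Proof.
move=> pc; elim: k => [|k IH]; first by rewrite !mulr0n; exact: top0.
by rewrite !mulrS; exact: topD.
Qed.

Lemma top_linear c d : top 1 (c%:P + d *: 'X) d.
Proof.
split; last by rewrite coefD coefC coefZ coefX /= add0r mulr1.
apply: leq_trans (size_polyD _ _) _; rewrite geq_max; apply/andP; split.
  by apply: leq_trans (size_polyC_leq1 _) _.
by apply: leq_trans (size_scale_leq _ _) _; rewrite size_polyX.
Qed.

Lemma top_mmap (C : comNzRingType) (j : {rmorphism C -> R}) n (d : nat) (f : {mpoly C[n]}) a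
    (h : 'I_n -> {poly R}) (c : 'I_n -> R) : f \is d.-homog ->
  (forall i, top a (h i) (c i)) ->
  top (d * a) (mmap (polyC \o j) h f) (mmap j c f).
Proof.
move=> /dhomogP hf hc; rewrite /mmap.
have : {in msupp f, forall m : 'X_{1..n}, 
    top (d * a) ((polyC \o j) f@_m * mmap1 h m) (j f@_m * mmap1 c m)}.
  move=> m /hf md; apply: topMC; rewrite -md /= mdegE big_distrl /= /mmap1.
  elim/big_ind3: _ => [|x1 x2 x3 y1 y2 y3|i _]; [exact: topC|exact: topM|exact: topX].
elim: (msupp f) => [|m s IH] hs; first by rewrite !big_nil; exact: top0.
rewrite !big_cons; apply: topD; first by apply: hs; rewrite mem_head.
by apply: IH => m' m's; apply: hs; rewrite inE m's orbT.
Qed.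

End TopCoefficient.

Section Cubic.
Variable R : comNzRingType.
Implicit Types (a : nat -> R) (x y z : R).

Definition cubic a x y z : R := a 0 * x ^+ 3 + a 1 * (x ^+ 2 * y)
  + a 2 * (x * y ^+ 2) + a 3 * y ^+ 3 + a 4 * (x ^+ 2 * z) + a 5 * (x * y * z)
  + a 6 * (y ^+ 2 * z) + a 7 * (x * z ^+ 2) + a 8 * (y * z ^+ 2) + a 9 * z ^+ 3.
Definition cubic_x a x y z : R := (a 0 * x ^+ 2) *+ 3 + (a 1 * (x * y)) *+ 2
  + a 2 * y ^+ 2 + (a 4 * (x * z)) *+ 2 + a 5 * (y * z) + a 7 * z ^+ 2.
Definition cubic_y a x y z : R := a 1 * x ^+ 2 + (a 2 * (x * y)) *+ 2
  + (a 3 * y ^+ 2) *+ 3 + a 5 * (x * z) + (a 6 * (y * z)) *+ 2 + a 8 * z ^+ 2.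
Definition cubic_z a x y z : R := a 4 * x ^+ 2 + a 5 * (x * y) + a 6 * y ^+ 2
  + (a 7 * (x * z)) *+ 2 + (a 8 * (y * z)) *+ 2 + (a 9 * z ^+ 2) *+ 3.

Lemma cubicZ a c x y z : cubic a (c * x) (c * y) (c * z) = c ^+ 3 * cubic a x y z.
Proof. by rewrite /cubic; ring. Qed.

Lemma cubic_euler a x y z :
  cubic_x a x y z * x + cubic_y a x y z * y + cubic_z a x y z * z
  = cubic a x y z *+ 3.
Proof. by rewrite /cubic /cubic_x /cubic_y /cubic_z; ring. Qed.

Lemma der_cubic (d : R -> R) a x y z : derivation d -> (forall i, d (a i) = 0) ->
  d (cubic a x y z) = cubic_x a x y z * d x + cubic_y a x y z * d y
                      + cubic_z a x y z * d z.
Proof.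
move=> dP da; rewrite /cubic !(derD dP, derM dP, derX dP) !da.
by rewrite /cubic_x /cubic_y /cubic_z /=; ring.
Qed.

End Cubic.

Section RmorphCubic.
Variables (R S : comNzRingType) (f : {rmorphism R -> S}) (a : nat -> R).

Lemma rmorph_cubic x y z : f (cubic a x y z) = cubic (f \o a) (f x) (f y) (f z).
Proof. by rewrite /cubic !(rmorphD, rmorphM, rmorphXn). Qed.
Lemma rmorph_cubic_x x y z : f (cubic_x a x y z) = cubic_x (f \o a) (f x) (f y) (f z).
Proof. by rewrite /cubic_x !(rmorphD, rmorphM, rmorphXn, rmorphMn). Qed.
Lemma rmorph_cubic_y x y z : f (cubic_y a x y z) = cubic_y (f \o a) (f x) (f y) (f z).
Proof. by rewrite /cubic_y !(rmorphD, rmorphM, rmorphXn, rmorphMn). Qed.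
Lemma rmorph_cubic_z x y z : f (cubic_z a x y z) = cubic_z (f \o a) (f x) (f y) (f z).
Proof. by rewrite /cubic_z !(rmorphD, rmorphM, rmorphXn, rmorphMn). Qed.

End RmorphCubic.

Definition smooth_cubic (C : comNzRingType) (a : nat -> C) := forall x y z,
  cubic a x y z = 0 -> cubic_x a x y z = 0 -> cubic_y a x y z = 0 ->
  cubic_z a x y z = 0 -> [/\ x = 0, y = 0 & z = 0].

Section TopCubic.
Variables (R : comNzRingType) (n : nat).

Section Monomials.
Variables (c : R) (p q r : {poly R}) (x y z : R).
Hypotheses (px : top n p x) (qy : top n q y) (rz : top n r z).

Lemma top_m2 : top (2 * n) (c%:P * p ^+ 2) (c * x ^+ 2).
Proof. exact/topMC/topX. Qed.
Lemma top_m11 : top (2 * n) (c%:P * (p * q)) (c * (x * y)).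
Proof. by apply/topMC/(top_cast (topM px qy)); lia. Qed.
Lemma top_m3 : top (3 * n) (c%:P * p ^+ 3) (c * x ^+ 3).
Proof. exact/topMC/topX. Qed.
Lemma top_m21 : top (3 * n) (c%:P * (p ^+ 2 * q)) (c * (x ^+ 2 * y)).
Proof. by apply/topMC/(top_cast (topM (topX 2 px) qy)); lia. Qed.
Lemma top_m12 : top (3 * n) (c%:P * (p * q ^+ 2)) (c * (x * y ^+ 2)).
Proof. by apply/topMC/(top_cast (topM px (topX 2 qy))); lia. Qed.
Lemma top_m111 : top (3 * n) (c%:P * (p * q * r)) (c * (x * y * z)).
Proof. by apply/topMC/(top_cast (topM (topM px qy) rz)); lia. Qed.

End Monomials.

Variables (a : nat -> R) (p q r : {poly R}) (x y z : R).
Hypotheses (px : top n p x) (qy : top n q y) (rz : top n r z).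

Lemma top_cubic : top (3 * n) (cubic (polyC \o a) p q r) (cubic a x y z).
Proof.
exact: (topD (topD (topD (topD (topD (topD (topD (topD (topD (top_m3 _ px)
  (top_m21 _ px qy)) (top_m12 _ px qy)) (top_m3 _ qy)) (top_m21 _ px rz))
  (top_m111 _ px qy rz)) (top_m21 _ qy rz)) (top_m12 _ px rz))
  (top_m12 _ qy rz)) (top_m3 _ rz)).
Qed.
Lemma top_cubic_x : top (2 * n) (cubic_x (polyC \o a) p q r) (cubic_x a x y z).
Proof.
exact: (topD (topD (topD (topD (topD (topMn 3 (top_m2 _ px))
  (topMn 2 (top_m11 _ px qy))) (top_m2 _ qy)) (topMn 2 (top_m11 _ px rz)))
  (top_m11 _ qy rz)) (top_m2 _ rz)).
Qed.
Lemma top_cubic_y : top (2 * n) (cubic_y (polyC \o a) p q r) (cubic_y a x y z).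
Proof.
exact: (topD (topD (topD (topD (topD (top_m2 _ px)
  (topMn 2 (top_m11 _ px qy))) (topMn 3 (top_m2 _ qy))) (top_m11 _ px rz))
  (topMn 2 (top_m11 _ qy rz))) (top_m2 _ rz)).
Qed.
Lemma top_cubic_z : top (2 * n) (cubic_z (polyC \o a) p q r) (cubic_z a x y z).
Proof.
exact: (topD (topD (topD (topD (topD (top_m2 _ px)
  (top_m11 _ px qy)) (top_m2 _ qy)) (topMn 2 (top_m11 _ px rz)))
  (topMn 2 (top_m11 _ qy rz))) (topMn 3 (top_m2 _ rz))).
Qed.

End TopCubic.

(** * Smooth cubics are not dominated by rational curves *)

Section NoRationalCurve.
Variable C : closedFieldType.
Hypothesis char0 : forall n, n.+1%:R != 0 :> C.
Implicit Types p q r : {poly C}.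

Lemma deriv_eq0 p : p^`() = 0 -> p = (p`_0)%:P.
Proof.
move=> p'0; apply/polyP => -[|i]; rewrite coefC //=.
have := congr1 (coefp i) p'0; rewrite /= coef0 coef_deriv => /eqP.
by rewrite -mulr_natr mulf_eq0 (negPf (char0 _)) orbF => /eqP.
Qed.

(** After division by the gcd, coprimality makes [p1] divide its own derivative, which is then zero
    for reasons of degree; so both quotients are constants. *)
Lemma wronskian_proportional p q : wronskian (@deriv C) p q = 0 -> p != 0 ->
  exists c, q = c *: p.
Proof.
rewrite /wronskian => /eqP; rewrite subr_eq0 => /eqP W p0.
have g0 : gcdp p q != 0 by rewrite gcdp_eq0 negb_and p0.
have : coprimep (p %/ gcdp p q) (q %/ gcdp p q) by apply: coprimep_div_gcd; rewrite p0.
move: (divpK (dvdp_gcdl p q)) (divpK (dvdp_gcdr p q)).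
set p1 := p %/ _; set q1 := q %/ _; set g := gcdp _ _ in g0 *.
move=> pE qE co.
have W1 : p1 * q1^`() = q1 * p1^`().
  apply: (mulfI (expf_neq0 2 g0)); move: W; rewrite -pE -qE !derivM => W.
  apply/eqP; rewrite -subr_eq0; apply/eqP.
  move/eqP: W; rewrite -subr_eq0 => /eqP <-; ring.
have p10 : p1 != 0 by apply: contraNneq p0 => h; rewrite -pE h mul0r.
have p1C : p1^`() = 0.
  apply/eqP; apply: contraT => h; have : p1 %| p1^`().
    by rewrite -(Gauss_dvdpr _ co) -W1 dvdp_mulr.
  by move/(dvdp_leq h); rewrite leqNgt lt_size_deriv.
have q1C : q1^`() = 0.
  by apply/eqP; move/eqP: W1; rewrite p1C mulr0 mulf_eq0 (negPf p10).
have := deriv_eq0 p1C; have := deriv_eq0 q1C => q1E p1E.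
have c0 : p1`_0 != 0 by apply: contraNneq p10 => h; rewrite p1E h.
exists (q1`_0 / p1`_0); move: (p1`_0) (q1`_0) p1E q1E c0 => u v p1E q1E u0.
by rewrite -pE -qE q1E p1E -!mul_polyC mulrA -polyCM divfK.
Qed.

Variable a : nat -> C.
Hypothesis a_smooth : smooth_cubic a.
Let F := cubic (polyC \o a).
Let G1 := cubic_x (polyC \o a).
Let G2 := cubic_y (polyC \o a).
Let G3 := cubic_z (polyC \o a).
Local Notation W := (wronskian (@deriv C)).

Lemma horner_cubics p q r c :
  [/\ (F p q r).[c] = cubic a p.[c] q.[c] r.[c],
      (G1 p q r).[c] = cubic_x a p.[c] q.[c] r.[c],
      (G2 p q r).[c] = cubic_y a p.[c] q.[c] r.[c]
    & (G3 p q r).[c] = cubic_z a p.[c] q.[c] r.[c]].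
Proof.
split; rewrite -[LHS]/(horner_eval c _).
- by rewrite /F rmorph_cubic /cubic /= /horner_eval !hornerC.
- by rewrite /G1 rmorph_cubic_x /cubic_x /= /horner_eval !hornerC.
- by rewrite /G2 rmorph_cubic_y /cubic_y /= /horner_eval !hornerC.
- by rewrite /G3 rmorph_cubic_z /cubic_z /= /horner_eval !hornerC.
Qed.

(* The vector product of (p, q, r) with its derivative is a multiple of the
   gradient, which has no zero; so it vanishes for reasons of degree. *)
Let primitive_wronskian p q r : F p q r = 0 ->
  (forall c, ~ [/\ p.[c] = 0, q.[c] = 0 & r.[c] = 0]) ->
  [/\ W p q = 0, W q r = 0 & W r p = 0].
Proof.
move=> F0 prim.
pose m := maxn (size p).-1 (maxn (size q).-1 (size r).-1).
have tp : top m p p`_m.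
  by split=> //; apply: leq_trans (leqSpred _) _; rewrite ltnS /m !leq_max leqnn ?orbT.
have tq : top m q q`_m.
  by split=> //; apply: leq_trans (leqSpred _) _; rewrite ltnS /m !leq_max leqnn ?orbT.
have tr : top m r r`_m.
  by split=> //; apply: leq_trans (leqSpred _) _; rewrite ltnS /m !leq_max leqnn ?orbT.
(* The curve has a point at infinity as well: [m] is the largest of the three degrees. If all three
   polynomials are zero, [prim] gives the contradiction. *)
have lead : [/\ p`_m = 0, q`_m = 0 & r`_m = 0] -> False.
  case=> pm qm rm.
  have m0 : m = 0%N.
    have h (s : {poly C}) : s`_m = 0 -> m = (size s).-1 -> m = 0%N.
      move=> sm mE; have s0 : s = 0 by apply/eqP; rewrite -lead_coef_eq0 /lead_coef -mE sm.
      by rewrite mE s0 size_poly0.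
    have : [\/ m = (size p).-1, m = (size q).-1 | m = (size r).-1].
      by rewrite /m /maxn; case: ifP => _; [case: ifP => _|];
        [constructor 3|constructor 2|constructor 1].
    by case; exact: h.
  by apply: (prim 0); rewrite !horner_coef0 -m0.
have topF := top_cubic a tp tq tr.
have top1 := top_cubic_x a tp tq tr; have top2 := top_cubic_y a tp tq tr.
have top3 := top_cubic_z a tp tq tr.
rewrite -/F -/G1 -/G2 -/G3 F0 in topF top1 top2 top3.
have E1 : G1 p q r * p + G2 p q r * q + G3 p q r * r = 0.
  by rewrite /G1 cubic_euler -/F F0 mul0rn.
have E2 : G1 p q r * p^`() + G2 p q r * q^`() + G3 p q r * r^`() = 0.
  have := der_cubic (a := polyC \o a) p q r (deriv_derivation C) (fun i => derivC (a i)).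
  by rewrite -/F F0 deriv0.
move: (G1 p q r) (G2 p q r) (G3 p q r) top1 top2 top3 E1 E2 (horner_cubics p q r).
move=> g1 g2 g3 top1 top2 top3 E1 E2 hor.
(* The gradient is orthogonal to (p, q, r) by Euler's relation and to its derivative by the chain
   rule, so it is parallel to their vector product. *)
have cross (x y z x' y' z' u v w : {poly C}) : u * x + v * y + w * z = 0 ->
    u * x' + v * y' + w * z' = 0 -> v * (x * y' - y * x') = w * (z * x' - x * z').
  move=> e1 e2; apply/eqP; rewrite -subr_eq0; apply/eqP.
  transitivity (x * (u * x' + v * y' + w * z') - x' * (u * x + v * y + w * z)).
    by ring.
  by rewrite e1 e2 !mulr0 subr0.
have E1b : g2 * q + g3 * r + g1 * p = 0 by rewrite addrC addrA.
have E2b : g2 * q^`() + g3 * r^`() + g1 * p^`() = 0 by rewrite addrC addrA.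
have E1c : g3 * r + g1 * p + g2 * q = 0 by rewrite -addrA addrC.
have E2c : g3 * r^`() + g1 * p^`() + g2 * q^`() = 0 by rewrite -addrA addrC.
have c12 : g2 * W p q = g3 * W r p := cross _ _ _ _ _ _ _ _ _ E1 E2.
have c23 : g3 * W q r = g1 * W p q := cross _ _ _ _ _ _ _ _ _ E1b E2b.
have c31 : g1 * W r p = g2 * W q r := cross _ _ _ _ _ _ _ _ _ E1c E2c.
have [u1 [u2 [u3 bez]]] : exists u1 u2 u3, u1 * g1 + u2 * g2 + u3 * g3 = 1.
  have [[u v] /= uv] := Bezoutp g1 g2.
  have : coprimep (u * g1 + v * g2) g3.
    rewrite (eqp_coprimepl _ uv); apply: Pdiv.ClosedField.root_coprimep => c.
    rewrite root_gcd => /andP[/rootP r1 /rootP r2]; apply/negP => /eqP r3.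
    have [hF h1 h2 h3] := hor c; apply: (prim c).
    by apply: a_smooth; rewrite -?hF -?h1 -?h2 -?h3 // F0 horner0.
  case/Bezout_eq1_coprimepP => -[s t] /= st.
  by exists (s * u), (s * v), t; rewrite -[RHS]st; ring.
have sW s t : top m s s`_m -> top m t t`_m -> (size (W s t) <= m.*2)%N.
  have leW (x y : {poly C}) : (size x <= m.+1)%N -> (size y <= m.+1)%N ->
      (size (x * y^`())%R <= m.*2)%N.
    move=> sx sy; apply: leq_trans (size_polyMleq _ _) _.
    have sy' : (size y^`() <= m)%N.
      have [->|y0] := eqVneq y 0; first by rewrite deriv0 size_poly0.
      by rewrite -ltnS; apply: leq_trans (lt_size_deriv y0) sy.
    by move: sx sy'; lia.
  move=> [ss _] [st _]; rewrite /wronskian.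
  apply: leq_trans (size_polyD _ _) _; rewrite size_polyN geq_max.
  by rewrite !leW.
(* If [ga] is a partial derivative not vanishing at infinity, its degree is exactly [2m]. By the
   Bezout identity it divides [wa], whose degree is smaller. *)
have vanish (ga gb gc wa wb wc u v w : {poly C}) c :
    top (2 * m) ga c -> c != 0 -> u * ga + v * gb + w * gc = 1 ->
    gb * wa = ga * wb -> gc * wa = ga * wc -> (size wa <= m.*2)%N ->
    [/\ wa = 0, wb = 0 & wc = 0].
  move=> [_ gac] c0 uvw ab ac sw.
  have sg : (2 * m < size ga)%N.
    by rewrite ltnNge; apply: contra c0 => h; rewrite -gac nth_default.
  have wa0 : wa = 0.
    apply/eqP; apply: contraT => /dvdp_leq le; move: sg.
    rewrite ltnNge mul2n (leq_trans _ sw) // le //; apply/dvdpP.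
    exists (u * wa + v * wb + w * wc).
    transitivity ((u * ga + v * gb + w * gc) * wa); first by rewrite uvw mul1r.
    transitivity (u * ga * wa + v * (gb * wa) + w * (gc * wa)); first by ring.
    by rewrite ab ac; ring.
  have ga0 : ga != 0 by rewrite -size_poly_gt0 (leq_ltn_trans _ sg).
  split=> //; first by apply: (mulfI ga0); rewrite -ab wa0 !mulr0.
  by apply: (mulfI ga0); rewrite -ac wa0 !mulr0.
(* The point at infinity lies on the smooth cubic, so one of the three partial derivatives is
   nonzero there and can serve as [ga]. *)
have F00 : cubic a p`_m q`_m r`_m = 0 by case: topF => _ <-; rewrite coef0.
have bez2 : u2 * g2 + u3 * g3 + u1 * g1 = 1 by rewrite -bez addrC addrA.
have bez3 : u3 * g3 + u1 * g1 + u2 * g2 = 1 by rewrite -bez -addrA addrC.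
have [v1|v1] := eqVneq (cubic_x a p`_m q`_m r`_m) 0; last first.
  by case: (vanish _ _ _ _ _ _ _ _ _ _ top1 v1 bez (esym c31) c23 (sW _ _ tq tr)).
have [v2|v2] := eqVneq (cubic_y a p`_m q`_m r`_m) 0; last first.
  by case: (vanish _ _ _ _ _ _ _ _ _ _ top2 v2 bez2 (esym c12) c31 (sW _ _ tr tp)).
have [v3|v3] := eqVneq (cubic_z a p`_m q`_m r`_m) 0; last first.
  by case: (vanish _ _ _ _ _ _ _ _ _ _ top3 v3 bez3 (esym c23) c12 (sW _ _ tp tq)).
by case: lead; exact: a_smooth.
Qed.

Lemma plane_cubic_wronskian p q r : F p q r = 0 ->
  [/\ W p q = 0, W q r = 0 & W r p = 0].
Proof.
move=> F0; pose g := gcdp (gcdp p q) r.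
have [g0|g0] := eqVneq g 0.
  have : (p == 0) && (q == 0) && (r == 0) by rewrite -!gcdp_eq0 -/g g0.
  move=> /andP[/andP[/eqP -> /eqP ->] /eqP ->].
  by rewrite /wronskian deriv0 !mulr0 subr0.
have gp : g %| p := dvdp_trans (dvdp_gcdl _ _) (dvdp_gcdl p q).
have gq : g %| q := dvdp_trans (dvdp_gcdl _ _) (dvdp_gcdr p q).
have gr : g %| r := dvdp_gcdr _ _.
have pE : p = g * (p %/ g) by rewrite mulrC divpK.
have qE : q = g * (q %/ g) by rewrite mulrC divpK.
have rE : r = g * (r %/ g) by rewrite mulrC divpK.
have [|c [pc qc rc]|w1 w2 w3] := @primitive_wronskian (p %/ g) (q %/ g) (r %/ g).
- move: F0; rewrite pE qE rE /F cubicZ -pE -qE -rE => /eqP.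
  by rewrite mulf_eq0 expf_eq0 /= (negPf g0) => /eqP.
- have h s : g %| s -> (s %/ g).[c] = 0 -> ('X - c%:P) * g %| s.
    move=> gs /eqP; rewrite -[_ == _]/(root _ c) -dvdp_XsubCl => cs.
    by rewrite -(divpK gs) dvdp_mul2r.
  have : ('X - c%:P) * g %| g by rewrite !dvdp_gcd !h.
  move/(dvdp_leq g0); rewrite size_mul ?polyXsubC_eq0 // size_XsubC /=.
  by rewrite ltnn.
by rewrite pE qE rE !(wronskianM _ _ _ (deriv_derivation C)) w1 w2 w3 !mulr0.
Qed.

(** On the line [v + x w] a form of degree [d] has its value at [v] as constant coefficient and its
    value at [w] as coefficient of degree [d]. *)
Let line n (v w : 'I_n -> C) (f : {mpoly C[n]}) : {poly C} :=
  mmap (polyC \o idfun) (fun i => (v i)%:P + w i *: 'X) f.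

Let line0 n (v w : 'I_n -> C) f : (line v w f)`_0 = f.@[v].
Proof.
rewrite -horner_coef0 -[LHS]/(horner_eval 0 _) rmorph_mmap.
rewrite /meval /mmap; apply: eq_bigr => m _; congr (_ * _).
  by rewrite /= /horner_eval hornerC.
by apply: mmap1_eq => i; rewrite /= /horner_eval !hornerE.
Qed.

Let line_top n (v w : 'I_n -> C) (d : nat) f : f \is d.-homog ->
  (line v w f)`_d = f.@[w].
Proof.
move=> hf; have := top_mmap idfun hf (fun i => top_linear (v i) (w i)).
by rewrite muln1 => -[_].
Qed.

(* Restriction to the lines reduces this to maps from the projective line. *)
Lemma rational_map_to_cubic n (d : nat) (f g h : {mpoly C[n]}) :
  f \is d.-homog -> g \is d.-homog -> h \is d.-homog ->
  cubic (@mpolyC n C \o a) f g h = 0 ->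
  forall v w, [/\ f.@[v] * g.@[w] = g.@[v] * f.@[w],
    g.@[v] * h.@[w] = h.@[v] * g.@[w] & h.@[v] * f.@[w] = f.@[v] * h.@[w]].
Proof.
move=> fd gd hd F0 v w.
have [|w1 w2 w3] := @plane_cubic_wronskian (line v w f) (line v w g) (line v w h).
  pose ln : {rmorphism {mpoly C[n]} -> {poly C}} :=
    mmap (polyC \o idfun) (fun i => (v i)%:P + w i *: 'X).
  have := congr1 ln F0; rewrite rmorph_cubic rmorph0 => <-.
  by rewrite /F /cubic /= !mmapC.
have key (x y : {mpoly C[n]}) : x \is d.-homog -> y \is d.-homog ->
    W (line v w x) (line v w y) = 0 -> x.@[v] * y.@[w] = y.@[v] * x.@[w].
  move=> xd yd Wxy; rewrite -!(line0 v w) -(line_top v w xd) -(line_top v w yd).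
  have [->|x0] := eqVneq (line v w x) 0; first by rewrite !coef0 mul0r mulr0.
  by have [c ->] := wronskian_proportional Wxy x0; rewrite !coefZ; ring.
by split; apply: key.
Qed.

End NoRationalCurve.

(** * Ternary cubic forms and linear changes of coordinates *)

Definition i0 : 'I_3 := Ordinal (isT : 0 < 3)%N.
Definition i1 : 'I_3 := Ordinal (isT : 1 < 3)%N.
Definition i2 : 'I_3 := Ordinal (isT : 2 < 3)%N.

Lemma ord3P (P : 'I_3 -> Prop) : P i0 -> P i1 -> P i2 -> forall i, P i.
Proof.
by move=> h0 h1 h2 [[|[|[|//]]] hi];
   [move: h0|move: h1|move: h2]; congr P; exact: val_inj.
Qed.

Lemma big_ord3 (R : Type) (idx : R) (op : Monoid.law idx) (F : 'I_3 -> R) :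
  \big[op/idx]_(i < 3) F i = op (op (F i0) (F i1)) (F i2).
Proof.
rewrite !big_ord_recr big_ord0 Monoid.mul1m /=.
by congr (op (op (F _) (F _)) (F _)); exact: val_inj.
Qed.

Definition vec3 (R : pzRingType) (x y z : R) : 'rV[R]_3 :=
  \row_i nth 0 [:: x; y; z] i.

Lemma vec3_eq0 (R : pzRingType) (x y z : R) : vec3 x y z = 0 -> [/\ x = 0, y = 0 & z = 0].
Proof.
move=> v0; have h i : vec3 x y z 0 i = 0 by rewrite v0 mxE.
by split; [have := h i0|have := h i1|have := h i2]; rewrite mxE.
Qed.

Definition cubicv (R : comNzRingType) (a : nat -> R) (v : 'rV[R]_3) : R :=
  cubic a (v 0 i0) (v 0 i1) (v 0 i2).

Lemma cubicvZ (R : comNzRingType) (a : nat -> R) c v :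
  cubicv a (c *: v) = c ^+ 3 * cubicv a v.
Proof. by rewrite /cubicv !mxE cubicZ. Qed.

Section CubicForms.
Variable C : comNzRingType.

Lemma cubic_form (f : {mpoly C[3]}) : f \is 3.-homog ->
  exists a, f = cubic (@mpolyC 3 C \o a) 'X_i0 'X_i1 'X_i2.
Proof.
move/dhomogP => hf.
pose Q (g : {mpoly C[3]}) := exists a, g = cubic (@mpolyC 3 C \o a) 'X_i0 'X_i1 'X_i2.
have Q0 : Q 0.
  by exists (fun=> 0); rewrite /cubic /= mpolyC0 !mul0r !addr0.
have QD g h : Q g -> Q h -> Q (g + h).
  move=> [a ->] [b ->]; exists (fun i => a i + b i).
  by rewrite /cubic /= !mpolyCD; ring.
have QZ c g : Q g -> Q (c *: g).
  move=> [a ->]; exists (fun i => c * a i).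
  by rewrite /cubic /= !mpolyCM -mul_mpolyC; ring.
have Qm (k : nat) (m : 'X_{1..3}) : (k < 10)%N ->
    (forall b : nat -> {mpoly C[3]}, (forall i, b i = (i == k)%:R) ->
      'X_[m] = cubic b 'X_i0 'X_i1 'X_i2) -> Q 'X_[m].
  move=> _ h; exists (fun i => (i == k)%:R); apply: h => i /=.
  by rewrite mpolyC_nat.
have hm (m : 'X_{1..3}) : mdeg m = 3 -> Q 'X_[m].
  rewrite mdegE (big_ord3 _ (fun i => m i)) => md.
  have E : 'X_[m] = 'X_i0 ^+ m i0 * 'X_i1 ^+ m i1 * 'X_i2 ^+ m i2 :> {mpoly C[3]}.
    by rewrite mpolyXE_id (big_ord3 _ (fun i => 'X_i ^+ m i)).
  have [k kE] : exists k : 'I_10, forall b : nat -> {mpoly C[3]},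
      (forall i, b i = (i == k :> nat)%:R) -> 'X_[m] = cubic b 'X_i0 'X_i1 'X_i2.
    rewrite E; move: (m i0) (m i1) (m i2) md {E} => n0 n1 n2 md.
    (* The exponents are listed in the order in which [cubic] numbers its coefficients. *)
    pose s := [:: (3,0,0); (2,1,0); (1,2,0); (0,3,0); (2,0,1); (1,1,1); (0,2,1);
       (1,0,2); (0,1,2); (0,0,3)]%N.
    have sm : (n0, n1, n2) \in s.
      by move: md; case: n0 => [|[|[|[|?]]]] //; case: n1 => [|[|[|[|?]]]] //;
         case: n2 => [|[|[|[|?]]]].
    have [k ks] : exists2 k, (k < 10)%N & nth (0, 0, 0)%N s k = (n0, n1, n2).
      exists (index (n0, n1, n2) s); last exact: nth_index.
      by have := sm; rewrite -index_mem.
    move=> kE; exists (Ordinal ks) => b hb.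
    rewrite /cubic !hb /= {hb}; move: k ks kE {sm}.
    by do 10! [case=> [_|] /=; [case=> <- <- <-; ring|]].
  by apply: (Qm k); [exact: ltn_ord|exact: kE].
rewrite [f]mpolyE big_seq; elim/big_rec: _ => [|m g /hf md Qg]; first exact: Q0.
by apply: QD Qg; apply: QZ; exact: hm.
Qed.

End CubicForms.

Lemma mderiv_derivation n (C : comNzRingType) (i : 'I_n) : derivation (@mderiv n C i).
Proof. by split=> p q; rewrite ?mderivD ?mderivM. Qed.

Lemma mderivXU n (C : comNzRingType) (i j : 'I_n) :
  ('X_j : {mpoly C[n]})^`M(i) = (i == j)%:R%:MP.
Proof.
rewrite mderivX mnm1E eq_sym; case: eqP => [->|_]; last by rewrite scale0r mpolyC0.
by rewrite scale1r mpolyC1 -mpolyX0; congr 'X_[_]; apply/mnmP => k; rewrite mnmBE subnn mnm0E.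
Qed.

Section MmapCubic.
Variables (n : nat) (C S : comNzRingType) (f : {rmorphism C -> S}) (h : 'I_n -> S).
Variables (a : nat -> C) (p q r : {mpoly C[n]}).

Lemma mmap_cubic : mmap f h (cubic (@mpolyC n C \o a) p q r)
  = cubic (f \o a) (mmap f h p) (mmap f h q) (mmap f h r).
Proof. by rewrite rmorph_cubic /cubic /= !mmapC. Qed.
Lemma mmap_cubic_x : mmap f h (cubic_x (@mpolyC n C \o a) p q r)
  = cubic_x (f \o a) (mmap f h p) (mmap f h q) (mmap f h r).
Proof. by rewrite rmorph_cubic_x /cubic_x /= !mmapC. Qed.
Lemma mmap_cubic_y : mmap f h (cubic_y (@mpolyC n C \o a) p q r)
  = cubic_y (f \o a) (mmap f h p) (mmap f h q) (mmap f h r).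
Proof. by rewrite rmorph_cubic_y /cubic_y /= !mmapC. Qed.
Lemma mmap_cubic_z : mmap f h (cubic_z (@mpolyC n C \o a) p q r)
  = cubic_z (f \o a) (mmap f h p) (mmap f h q) (mmap f h r).
Proof. by rewrite rmorph_cubic_z /cubic_z /= !mmapC. Qed.

End MmapCubic.

Lemma dhomog_cubic n (C : comNzRingType) (a : nat -> C) (d : nat) (p q r : {mpoly C[n]}) :
  p \is d.-homog -> q \is d.-homog -> r \is d.-homog ->
  cubic (@mpolyC n C \o a) p q r \is (3 * d).-homog.
Proof.
move=> pd qd rd; have sq (x : {mpoly C[n]}) : x \is d.-homog -> x ^+ 2 \is (d + d).-homog.
  by move=> xd; rewrite expr2; exact: dhomogM.
have cb (x y z : {mpoly C[n]}) c : x \is d.-homog -> y \is d.-homog ->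
    z \is d.-homog -> c%:MP * (x * y * z) \is (3 * d).-homog.
  move=> xd yd zd; rewrite mul_mpolyC; apply: dhomogZ.
  by rewrite !mulSn mul0n addn0 addnA; apply: dhomogM zd; exact: dhomogM.
have E (x y : {mpoly C[n]}) : x ^+ 2 * y = x * x * y by rewrite expr2.
have E' (x y : {mpoly C[n]}) : x * y ^+ 2 = x * y * y by rewrite expr2 mulrA.
have E3 (x : {mpoly C[n]}) : x ^+ 3 = x * x * x by rewrite !exprS expr0 mulr1 mulrA.
rewrite /cubic /= !E !E' !E3.
by repeat apply: dhomogD; exact: cb.
Qed.

Lemma cubicv_linear_forms (C S : comNzRingType) (f : {rmorphism C -> S}) k l
    (M : 'M[C]_(k, l)) (x : 'rV[S]_k) (j : 'I_l) :
  mmap f (x 0) (\sum_i M i j *: 'X_i) = (x *m map_mx f M) 0 j.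
Proof.
rewrite mxE rmorph_sum; apply: eq_bigr => i _.
by rewrite /= mmapZ mmapXU mxE mulrC.
Qed.

Section LinearChange.
Variables (C : fieldType) (a : nat -> C) (M : 'M[C]_3).

(** The identity is stated over every ring [S] because it is applied both to closed points and to
    the generic point. By the chain rule the gradient of [a'] is [M] times that of [a], so an
    invertible [M] preserves smoothness. *)
Lemma cubic_linear_change : exists a' : nat -> C,
  (forall (S : comNzRingType) (f : {rmorphism C -> S}) (x : 'rV[S]_3),
    cubicv (f \o a) (x *m map_mx f M) = cubicv (f \o a') x) /\
  (M \in unitmx -> smooth_cubic a -> smooth_cubic a').
Proof.
pose l j : {mpoly C[3]} := \sum_i M i j *: 'X_i.
have hl j : l j \is 1.-homog.
  by apply: rpred_sum => i _; apply: dhomogZ; rewrite dhomogX /= mdeg1.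
have hF := dhomog_cubic a (hl i0) (hl i1) (hl i2).
have [a' aE] := cubic_form hF; exists a'; split.
  move=> S f x; have := congr1 (mmap f (x 0)) aE.
  by rewrite !mmap_cubic !mmapXU !cubicv_linear_forms.
move=> Mu sa x y z F0 Fx Fy Fz.
pose v := vec3 x y z; pose w := v *m M.
have lE j : mmap idfun (v 0) (l j) = w 0 j.
  by rewrite cubicv_linear_forms map_mx_id.
have vE : [/\ v 0 i0 = x, v 0 i1 = y & v 0 i2 = z] by rewrite !mxE.
have w0 : cubic a (w 0 i0) (w 0 i1) (w 0 i2) = 0.
  have := congr1 (mmap idfun (v 0)) aE; rewrite !mmap_cubic !lE !mmapXU.
  by case: vE => -> -> ->; rewrite [RHS]F0.
have mlE i j : (l j)^`M(i) = (M i j)%:MP.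
  rewrite /l (der_sum (mderiv_derivation C i)) (bigD1 i) //= big1 => [|k ki].
    by rewrite addr0 mderivZ mderivXU eqxx mpolyC1 -mul_mpolyC mulr1.
  by rewrite mderivZ mderivXU eq_sym (negPf ki) mpolyC0 scaler0.
pose g : 'cV[C]_3 := (vec3 (cubic_x a (w 0 i0) (w 0 i1) (w 0 i2))
  (cubic_y a (w 0 i0) (w 0 i1) (w 0 i2)) (cubic_z a (w 0 i0) (w 0 i1) (w 0 i2)))^T.
have gE : [/\ g i0 0 = cubic_x a (w 0 i0) (w 0 i1) (w 0 i2),
    g i1 0 = cubic_y a (w 0 i0) (w 0 i1) (w 0 i2)
  & g i2 0 = cubic_z a (w 0 i0) (w 0 i1) (w 0 i2)].
  by split; rewrite 2!mxE.
have grad i : (M *m g) i 0 = [:: cubic_x a' x y z; cubic_y a' x y z; cubic_z a' x y z]`_i.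
  have := congr1 (fun F => mmap idfun (v 0) (F^`M(i))) aE.
  have dC k : (mderiv i) ((@mpolyC 3 C \o a) k) = 0 by rewrite /= mderivC.
  have dC' k : (mderiv i) ((@mpolyC 3 C \o a') k) = 0 by rewrite /= mderivC.
  rewrite (der_cubic _ _ _ (mderiv_derivation C i) dC).
  rewrite (der_cubic _ _ _ (mderiv_derivation C i) dC') !mlE !mderivXU.
  rewrite !rmorphD !rmorphM /= mmap_cubic_x mmap_cubic_y mmap_cubic_z.
  rewrite mmap_cubic_x mmap_cubic_y mmap_cubic_z !lE !mmapXU !mmapC.
  case: vE => -> -> -> /= E; rewrite mxE (big_ord3 _ (fun j => M i j * g j 0)).
  have [-> -> ->] := gE; rewrite ![M i _ * _]mulrC; refine (etrans E _).
  by elim/ord3P: i {E dC dC'} => /=; rewrite ?mulr1 ?mulr0 ?addr0 ?add0r.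
have g0 : g = 0.
  apply: (can_inj (mulKmx Mu)); rewrite mulmx0; apply/colP; apply: ord3P;
  by rewrite grad mxE /= ?Fx ?Fy ?Fz.
have gz j : g j 0 = 0 by rewrite g0 mxE.
case: gE; rewrite !gz => g1 g2 g3.
have [w1 w2 w3] := sa _ _ _ w0 (esym g1) (esym g2) (esym g3).
have wz : w = 0 by apply/rowP; apply: ord3P; rewrite [RHS]mxE.
by apply: vec3_eq0; rewrite -/v -[v](mulmxK Mu) -/w wz mul0mx.
Qed.

End LinearChange.

Lemma complete_row (C : fieldType) (v : 'rV[C]_3) : v != 0 ->
  exists2 M : 'M[C]_3, M \in unitmx & row i2 M = v.
Proof.
move=> v0; pose N := row_ebase v; pose c := col_ebase v 0 0.
have rv : \rank v = 1%N by apply/eqP; rewrite rank_rV v0.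
have vE : v = c *: row i0 N.
  rewrite -{1}(mulmx_ebase v) rv -mulmxA.
  apply/rowP => j; rewrite mxE big_ord1 !mxE (bigD1 i0) //= big1 ?addr0.
    by rewrite !mxE /= mul1r.
  by move=> i ii; rewrite mxE /= eq_sym (_ : (i : nat) == 0 = false)%N ?mul0r //; apply/negbTE.
have c0 : c != 0 by apply: contraNneq v0 => c0; rewrite vE c0 scale0r.
(* The rank decomposition puts a multiple of [v] in the first row of [N]; the transposition moves it
   to the last, the image of (0 : 0 : 1). *)
exists (c *: (tperm_mx i0 i2 *m N)).
  by rewrite unitmxZ ?unitfE // unitmx_mul unitmx_perm row_ebase_unit.
by rewrite linearZ /= -xrowE vE; congr (_ *: _); apply/rowP => j; rewrite !mxE tpermR.
Qed.

Section EllipticCubic.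
Variables (C : closedFieldType) (E : projVariety C 2).

Lemma elliptic_cubic : elliptic_curve E -> exists a : nat -> C,
  smooth_cubic a /\ forall x, pv_set E x <-> x != 0 /\ cubicv a x = 0.
Proof.
case=> f [fd EE sm].
have [a aE] := cubic_form fd; exists a.
have fE (x : 'rV[C]_3) : f.@[x 0] = cubicv a x.
  by rewrite {1}aE /meval mmap_cubic !mmapXU.
have EP x : pv_set E x <-> x != 0 /\ cubicv a x = 0.
  rewrite EE; split=> [[x0 fx]|[x0 fx]]; split=> //; first by rewrite -fE; exact: fx.
  by move=> p ->; rewrite fE.
split=> // x y z F0 Fx Fy Fz; pose v := vec3 x y z.
have [v0|v0] := eqVneq v 0; first exact: vec3_eq0.
have Ev : pv_set E v by apply/EP; split=> //; rewrite /cubicv !mxE.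
have [j] := sm v Ev.
have dC k : (mderiv j) ((@mpolyC 3 C \o a) k) = 0 by rewrite /= mderivC.
rewrite {1}aE (der_cubic _ _ _ (mderiv_derivation C j) dC) !mderivXU.
rewrite /meval !rmorphD !rmorphM /= mmap_cubic_x mmap_cubic_y mmap_cubic_z.
by rewrite !mmapXU !mxE /= [X in X * _]Fx [X in _ + X * _ + _]Fy
  [X in _ + X * _]Fz !mul0r !addr0 eqxx.
Qed.

End EllipticCubic.

(** * The discriminant of the projection from a point of the cubic *)

Section Disc.
Variable R : comNzRingType.
Implicit Types (a : nat -> R).

(* A cubic through (0 : 0 : 1) is z^2 L + z Q + K with forms L, Q, K of degrees
   1, 2, 3 in x, y; [disc a] lists the coefficients of Q^2 - 4 L K. *)
Definition formL a x y : R := a 7 * x + a 8 * y.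
Definition formQ a x y : R := a 4 * x ^+ 2 + a 5 * (x * y) + a 6 * y ^+ 2.

Definition disc a (i : nat) : R := nth 0
  [:: a 4 ^+ 2 - 4%:R * (a 7 * a 0);
      2%:R * (a 4 * a 5) - 4%:R * (a 7 * a 1 + a 8 * a 0);
      a 5 ^+ 2 + 2%:R * (a 4 * a 6) - 4%:R * (a 7 * a 2 + a 8 * a 1);
      2%:R * (a 5 * a 6) - 4%:R * (a 7 * a 3 + a 8 * a 2);
      a 6 ^+ 2 - 4%:R * (a 8 * a 3)] i.

(** This completes the square in [z]: on the cubic, [2 L z + Q] is a square root of the discriminant
    quartic. *)
Lemma disc_square a x y z : a 9 = 0 ->
  (2%:R * formL a x y * z + formQ a x y) ^+ 2
  = quartic (disc a) x y + 4%:R * formL a x y * cubic a x y z.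
Proof. by move=> a9; rewrite /formL /formQ /quartic /cubic /disc /= a9; ring. Qed.

End Disc.

Lemma rmorph_disc (R S : comNzRingType) (f : {rmorphism R -> S}) a :
  disc (f \o a) =1 f \o disc a.
Proof.
by move=> [|[|[|[|[|i]]]]]; rewrite /disc /= ?nth_nil ?rmorph0 //;
   rewrite !(rmorph_nat, rmorphD, rmorphN, rmorphM, rmorphXn).
Qed.

Section DiscSeparable.
Variables (C : closedFieldType) (a : nat -> C).
Hypothesis char0 : forall n, n.+1%:R != 0 :> C.
Hypothesis a_smooth : smooth_cubic a.
Hypothesis a9 : a 9 = 0.

(** The form [L] is the tangent line at (0 : 0 : 1), which is not a singular point. *)
Lemma formL_neq0 : ~ (a 7 = 0 /\ a 8 = 0).
Proof.
move=> [a7 a8]; have [||||_ _ /eqP] := a_smooth (x := 0) (y := 0) (z := 1).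
- by rewrite /cubic a9; ring.
- by rewrite /cubic_x a7; ring.
- by rewrite /cubic_y a8; ring.
- by rewrite /cubic_z a9; ring.
- by rewrite oner_eq0.
Qed.

Lemma quadratic_root (u v w : C) : u != 0 -> exists z, u * z ^+ 2 + v * z + w = 0.
Proof.
move=> u0; have [|z] := closed_rootP (u *: 'X^2 + (v *: 'X + w%:P)) _.
  rewrite size_polyDl size_scale ?size_polyXn //.
  apply: leq_ltn_trans (size_polyD _ _) _; rewrite gtn_max.
  rewrite (leq_ltn_trans (size_scale_leq _ _)) ?size_polyX //.
  by rewrite (leq_ltn_trans (size_polyC_leq1 _)).
rewrite /root !hornerD !hornerZ hornerXn hornerX hornerC => /eqP h.
by exists z; rewrite -addrA.
Qed.

(** A multiple zero of the discriminant would produce a singular point of the cubic on the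
    corresponding line through (0 : 0 : 1). *)
Lemma disc_separable : separable_quartic (disc a).
Proof.
move=> x y Dx Dy.
pose L := formL a x y; pose Q := formQ a x y.
pose K := a 0 * x ^+ 3 + a 1 * (x ^+ 2 * y) + a 2 * (x * y ^+ 2) + a 3 * y ^+ 3.
pose Qx := 2%:R * a 4 * x + a 5 * y; pose Qy := a 5 * x + 2%:R * a 6 * y.
pose Kx := 3%:R * a 0 * x ^+ 2 + 2%:R * a 1 * x * y + a 2 * y ^+ 2.
pose Ky := a 1 * x ^+ 2 + 2%:R * a 2 * x * y + 3%:R * a 3 * y ^+ 2.
have DxE : quartic_dx (disc a) x y = 2%:R * Q * Qx - 4%:R * (a 7 * K + L * Kx).
  by rewrite /quartic_dx /disc /Q /Qx /L /K /Kx /formQ /formL /=; ring.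
have DyE : quartic_dy (disc a) x y = 2%:R * Q * Qy - 4%:R * (a 8 * K + L * Ky).
  by rewrite /quartic_dy /disc /Q /Qy /L /K /Ky /formQ /formL /=; ring.
have n2 : 2%:R != 0 :> C := char0 1.
have n4 : 4%:R != 0 :> C := char0 3.
have D0 : Q ^+ 2 - 4%:R * (L * K) = 0.
  apply: (mulfI n4); rewrite mulr0.
  transitivity (x * quartic_dx (disc a) x y + y * quartic_dy (disc a) x y).
    by rewrite DxE DyE /Q /Qx /Qy /L /K /Kx /Ky /formQ /formL; ring.
  by rewrite Dx Dy !mulr0 addr0.
have cE z : cubic a x y z = L * z ^+ 2 + Q * z + K.
  by rewrite /cubic /L /Q /K /formL /formQ a9; ring.
have cxE z : cubic_x a x y z = a 7 * z ^+ 2 + Qx * z + Kx.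
  by rewrite /cubic_x /Qx /Kx; ring.
have cyE z : cubic_y a x y z = a 8 * z ^+ 2 + Qy * z + Ky.
  by rewrite /cubic_y /Qy /Ky; ring.
have czE z : cubic_z a x y z = 2%:R * L * z + Q.
  by rewrite /cubic_z /L /Q /formL /formQ a9; ring.
rewrite DxE in Dx; rewrite DyE in Dy.
have singular z : cubic a x y z = 0 -> cubic_x a x y z = 0 ->
    cubic_y a x y z = 0 -> cubic_z a x y z = 0 -> x = 0 /\ y = 0.
  by move=> h0 h1 h2 h3; have [] := a_smooth h0 h1 h2 h3.
have [L0|L0] := eqVneq L 0; last first.
  (* This is the double root of the quadratic in [z], the point where the line touches the cubic;
     the derivatives of [Q ^+ 2 - 4 L K] become the partial derivatives there. *)
  pose z := - Q / (2%:R * L).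
  have z0 : 2%:R * L * z + Q = 0 by rewrite /z; field; rewrite L0 n2.
  have L4 : 4%:R * L != 0 by rewrite mulf_neq0.
  have h0 : cubic a x y z = 0.
    apply: (mulfI L4); rewrite mulr0 cE.
    transitivity ((2%:R * L * z + Q) ^+ 2 - (Q ^+ 2 - 4%:R * (L * K))); first by ring.
    by rewrite z0 D0; ring.
  have h1 : cubic_x a x y z = 0.
    apply: (mulfI L4); rewrite mulr0.
    transitivity (2%:R * (2%:R * L * z + Q) * (2%:R * a 7 * z + Qx)
      - (2%:R * Q * Qx - 4%:R * (a 7 * K + L * Kx)) - 4%:R * a 7 * cubic a x y z).
      by rewrite cxE cE; ring.
    by rewrite z0 Dx h0; ring.
  have h2 : cubic_y a x y z = 0.
    apply: (mulfI L4); rewrite mulr0.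
    transitivity (2%:R * (2%:R * L * z + Q) * (2%:R * a 8 * z + Qy)
      - (2%:R * Q * Qy - 4%:R * (a 8 * K + L * Ky)) - 4%:R * a 8 * cubic a x y z).
      by rewrite cyE cE; ring.
    by rewrite z0 Dy h0; ring.
  by apply: (singular z) => //; rewrite czE.
have Q0 : Q = 0.
  by apply/eqP; move/eqP: D0; rewrite L0 mul0r mulr0 subr0 sqrf_eq0.
have K0 : K = 0.
  apply: contrapT => /eqP K0; apply: formL_neq0; split; apply/eqP.
    move/eqP: Dx; rewrite Q0 L0 mulr0 !mul0r addr0 sub0r oppr_eq0.
    by rewrite !mulf_eq0 (negPf n4) (negPf K0) orbF.
  move/eqP: Dy; rewrite Q0 L0 mulr0 !mul0r addr0 sub0r oppr_eq0.
  by rewrite !mulf_eq0 (negPf n4) (negPf K0) orbF.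
(* Now the whole line lies on the cubic. Euler's relation leaves one partial derivative to
   annihilate, and it is a quadratic polynomial in [z]. *)
have h0 z : cubic a x y z = 0 by rewrite cE L0 Q0 K0; ring.
have h3 z : cubic_z a x y z = 0 by rewrite czE L0 Q0; ring.
have eul z : cubic_x a x y z * x + cubic_y a x y z * y = 0.
  by have := cubic_euler a x y z; rewrite h0 h3 mul0r addr0 mul0rn.
have [y0|y0] := eqVneq y 0.
  have [//|x0] := eqVneq x 0.
  have a7 : a 7 = 0.
    by apply/eqP; move/eqP: L0; rewrite /L /formL y0 mulr0 addr0 mulf_eq0 (negPf x0) orbF.
  have a8 : a 8 != 0 by apply/eqP => a8; exact: formL_neq0.
  have [z hz] := quadratic_root Qy Ky a8.
  apply: (singular z); rewrite ?cyE //.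
  by apply/eqP; move/eqP: (eul z); rewrite y0 mulr0 addr0 mulf_eq0 (negPf x0) orbF.
have a7 : a 7 != 0.
  apply/eqP => a7; apply: formL_neq0; split=> //; apply/eqP.
  by move/eqP: L0; rewrite /L /formL a7 mul0r add0r mulf_eq0 (negPf y0) orbF.
have [z hz] := quadratic_root Qx Kx a7.
apply: (singular z); rewrite ?cxE //.
by apply/eqP; move/eqP: (eul z); rewrite cxE hz mul0r add0r mulf_eq0 (negPf y0) orbF.
Qed.

End DiscSeparable.

(** * Projection of a plane cubic from one of its points *)

(* Coordinates in which the cubic [a] becomes the cubic [nf_cubic] through
   (0 : 0 : 1). *)
Record normal_form (C : fieldType) (a : nat -> C) := NormalForm {
  nf_mx : 'M[C]_3;
  nf_cubic : nat -> C;
  nf_unit : nf_mx \in unitmx;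
  nf_eq : forall (S : comNzRingType) (f : {rmorphism C -> S}) (x : 'rV[S]_3),
    cubicv (f \o a) (x *m map_mx f nf_mx) = cubicv (f \o nf_cubic) x;
  nf_smooth : smooth_cubic nf_cubic;
  nf_origin : nf_cubic 9 = 0
}.
Arguments nf_smooth {C a} _.

Lemma exists_normal_form (C : fieldType) (a : nat -> C) (v : 'rV[C]_3) :
  smooth_cubic a -> v != 0 -> cubicv a v = 0 ->
  exists N : normal_form a, row i2 (nf_mx N) = v.
Proof.
move=> sa v0 av; have [M Mu Mv] := complete_row v0.
have [a' [aE sa']] := cubic_linear_change a M.
have a9 : a' 9 = 0.
  have := aE C idfun (vec3 0 0 1); rewrite map_mx_id //.
  have -> : vec3 0 0 1 *m M = v.
    rewrite -Mv; apply/rowP => j.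
    rewrite mxE (big_ord3 _ (fun i => vec3 0 0 1 0 i * M i j)) !mxE /=.
    by rewrite !mul0r !add0r mul1r.
  move=> E; have := etrans (esym E) av.
  by rewrite /cubicv !mxE /= /cubic => <-; rewrite /=; ring.
by exists (NormalForm Mu aE (sa' Mu sa) a9).
Qed.

Section ClosedPoints.
Variables (C : closedFieldType) (a : nat -> C) (N : normal_form a).
Local Notation M := (nf_mx N).
Local Notation a' := (nf_cubic N).

(** Where [L] does not vanish, the quadratic in [z] has a root; these closed points serve to test
    identities satisfied by the generic point. *)
Lemma nf_point (x : C) : formL a' 1 x != 0 ->
  exists v : 'rV[C]_3, [/\ v != 0, cubicv a v = 0,
    (v *m invmx M) 0 i0 = 1 & (v *m invmx M) 0 i1 = x].
Proof.
move=> L0; have [z hz] := quadratic_root (formQ a' 1 x)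
  (a' 0 + a' 1 * x + a' 2 * x ^+ 2 + a' 3 * x ^+ 3) L0.
exists (vec3 1 x z *m M).
have vM : vec3 1 x z *m M *m invmx M = vec3 1 x z by rewrite mulmxK ?nf_unit.
split; rewrite ?vM ?mxE //.
  apply: contraTneq isT => h; have := congr1 (fun v => (v *m invmx M) 0 i0) h.
  by rewrite vM mul0mx !mxE => /eqP; rewrite oner_eq0.
have := nf_eq N idfun (vec3 1 x z); rewrite map_mx_id // => E.
refine (etrans E _); rewrite /cubicv !mxE -[RHS]hz /cubic /formL /formQ /=.
by rewrite nf_origin; ring.
Qed.

End ClosedPoints.

Section GenericPoint.
Variables (C : closedFieldType) (L : fieldType) (iota : {rmorphism C -> L}).
Hypothesis char0 : forall n, n.+1%:R != 0 :> C.
Variables (a : nat -> C) (N : normal_form a) (xi : 'rV[L]_3).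
Hypothesis xi_cubic : cubicv (iota \o a) xi = 0.

Local Notation M := (nf_mx N).
Local Notation a' := (nf_cubic N).

Definition nf_coord : 'rV[L]_3 := xi *m map_mx iota (invmx M).
Local Notation rho := nf_coord.

Lemma nf_coordK : xi = rho *m map_mx iota M.
Proof. by rewrite /nf_coord -mulmxA -map_mxM mulVmx ?nf_unit // map_mx1 mulmx1. Qed.

Lemma nf_coord_cubic : cubicv (iota \o a') rho = 0.
Proof. by rewrite -nf_eq -nf_coordK. Qed.

(** The projection from (0 : 0 : 1) is [t]; adjoining the square root [w] of the discriminant gives
    the function field of the curve as a double cover of the line. *)
Definition nf_t : L := rho 0 i1 / rho 0 i0.
Definition nf_w : L := 2%:R * formL (iota \o a') 1 nf_t * (rho 0 i2 / rho 0 i0)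
  + formQ (iota \o a') 1 nf_t.
Local Notation t := nf_t.
Local Notation w := nf_w.

Hypothesis rho0 : rho 0 i0 != 0.

Lemma nf_w_square : w ^+ 2 = quartic (iota \o disc a') 1 t.
Proof.
have a9 : (iota \o a') 9 = 0 by rewrite /= nf_origin rmorph0.
have -> : quartic (iota \o disc a') 1 t = quartic (disc (iota \o a')) 1 t.
  by rewrite /quartic !rmorph_disc.
rewrite /nf_w (disc_square _ _ _ a9).
have -> : cubic (iota \o a') 1 t (rho 0 i2 / rho 0 i0) = 0.
  apply: (mulfI (expf_neq0 3 rho0)); rewrite mulr0 -cubicZ.
  rewrite mulr1 /nf_t !mulrA ![rho 0 i0 * _]mulrC !mulfK //.
  exact: nf_coord_cubic.
by rewrite mulr0 addr0.
Qed.

Hypothesis t_nonconstant : ~ range iota t.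

Lemma nf_formL_neq0 : formL (iota \o a') 1 t != 0.
Proof.
apply/negP; rewrite /formL /= mulr1 => /eqP h.
have [a8|a8] := eqVneq (a' 8) 0.
  case: (formL_neq0 (nf_smooth N) (nf_origin N)); split=> //.
  by apply/eqP; move/eqP: h; rewrite a8 rmorph0 mul0r addr0 fmorph_eq0.
apply: t_nonconstant; exists (- a' 7 / a' 8) => //.
rewrite fmorph_div rmorphN; apply: (canLR (mulfK _)); first by rewrite fmorph_eq0.
by apply/eqP; rewrite eq_sym -addr_eq0 addrC mulrC h.
Qed.

(** As [t] is not constant, [L] is nonzero at [t] and [z = (w - Q) / (2 L)]. The coordinates are
    thus known up to a common factor, which the coordinate equal to 1 determines. *)
Lemma nf_generators (F : subfld L) : (forall c, F (iota c)) -> F t -> F w ->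
  (exists i, xi 0 i = 1) -> forall i, F (xi 0 i).
Proof.
move=> FC Ft Fw [k xik].
have n2 : 2%:R != 0 :> L by rewrite -(rmorph_nat iota) fmorph_eq0 (char0 1).
have z0 := nf_formL_neq0.
have FL : F (formL (iota \o a') 1 t).
  by apply: sfD; apply: sfM; rewrite ?mulr1 //=; [exact: sf1].
have FQ : F (formQ (iota \o a') 1 t).
  by do 2?[apply: sfD]; apply: sfM; rewrite ?expr1n ?mul1r //=; [exact: sf1|exact: sfX].
pose z := rho 0 i2 / rho 0 i0.
have Fz : F z.
  have -> : z = (w - formQ (iota \o a') 1 t) / (2%:R * formL (iota \o a') 1 t).
    by rewrite /nf_w addrK mulrAC mulfV ?mul1r // mulf_neq0.
  by apply: sf_div; [apply: sfB|apply: sfM => //; exact: sf_nat].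
have E i : xi 0 i = rho 0 i0 * (vec3 1 t z *m map_mx iota M) 0 i.
  rewrite {1}nf_coordK mxE [X in _ = _ * X]mxE mulr_sumr; apply: eq_bigr => j _; rewrite mulrA.
  congr (_ * _); rewrite [vec3 _ _ _ _ _]mxE; move: j; apply: ord3P => /=.
  - by rewrite mulr1.
  - by rewrite mulrC divfK.
  - by rewrite mulrC divfK.
have Fv i : F ((vec3 1 t z *m map_mx iota M) 0 i).
  rewrite mxE; apply: sf_sum => j _; apply: sfM; rewrite mxE //.
  by move: j; apply: ord3P => //=; exact: sf1.
move=> i; rewrite E; apply: sfM => //.
have -> : rho 0 i0 = ((vec3 1 t z *m map_mx iota M) 0 k)^-1.
  apply: (mulIf (x := (vec3 1 t z *m map_mx iota M) 0 k)).
    by apply: contra_eq_neq xik => h; rewrite E h mulr0 eq_sym oner_eq0.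
  rewrite mulVf -?E //; apply: contra_eq_neq xik => h.
  by rewrite E h mulr0 eq_sym oner_eq0.
exact: sfV.
Qed.

Lemma nf_sub (F : subfld L) : (forall c, F (iota c)) -> (forall i, F (xi 0 i)) ->
  F t /\ F w.
Proof.
move=> FC Fxi.
have Frho i : F (rho 0 i).
  by rewrite mxE; apply: sf_sum => j _; apply: sfM => //; rewrite mxE.
have Ft : F t by exact: sf_div.
split=> //; apply: sfD.
  apply: sfM; last exact: sf_div.
  apply: sfM; first exact: sf_nat.
  by apply: sfD; apply: sfM; rewrite ?mulr1 //=; [exact: sf1].
by do 2?[apply: sfD]; apply: sfM; rewrite ?expr1n ?mul1r //=; [exact: sf1|exact: sfX].
Qed.

Lemma nf_not_constant k (c : 'rV[C]_3) : xi <> k *: map_mx iota c.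
Proof.
move=> xiE; apply: t_nonconstant; pose d := c *m invmx M.
have rE i : rho 0 i = k * iota (d 0 i).
  by rewrite /nf_coord xiE -scalemxAl -map_mxM !mxE.
exists (d 0 i1 / d 0 i0) => //; rewrite /nf_t !rE fmorph_div -mulf_div mulfV ?mul1r //.
by apply: contraNneq rho0 => k0; rewrite rE k0 mul0r.
Qed.

End GenericPoint.

(** * Function fields of planes *)

Lemma dhomog_mpolyC n (C : comNzRingType) (c : C) : c%:MP_[n] \is 0.-homog.
Proof. by rewrite -[c%:MP]mulr1 mul_mpolyC; apply: dhomogZ; exact: dhomog1. Qed.

Lemma dhomog_quartic n (C : comNzRingType) (e : nat -> C) (d : nat) (p q : {mpoly C[n]}) :
  p \is d.-homog -> q \is d.-homog ->
  quartic (@mpolyC n C \o e) p q \is (4 * d).-homog.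
Proof.
move=> pd qd; have mn c i j : (i + j = 4)%N ->
    c%:MP * (p ^+ i * q ^+ j) \is (4 * d).-homog.
  move=> ij; rewrite mul_mpolyC; apply: dhomogZ.
  by rewrite -ij mulnDl ![(_ * d)%N]mulnC; apply: dhomogM; exact: dhomogMn.
have E : quartic (@mpolyC n C \o e) p q = (e 0)%:MP * (p ^+ 4 * q ^+ 0)
    + (e 1)%:MP * (p ^+ 3 * q ^+ 1) + (e 2)%:MP * (p ^+ 2 * q ^+ 2)
    + (e 3)%:MP * (p ^+ 1 * q ^+ 3) + (e 4)%:MP * (p ^+ 0 * q ^+ 4).
  by rewrite /quartic /=; ring.
by rewrite E; repeat apply: dhomogD; exact: mn.
Qed.

Lemma mmap_quartic n (C S : comNzRingType) (f : {rmorphism C -> S}) (h : 'I_n -> S)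
  (e : nat -> C) (p q : {mpoly C[n]}) :
  mmap f h (quartic (@mpolyC n C \o e) p q) = quartic (f \o e) (mmap f h p) (mmap f h q).
Proof. by rewrite rmorph_quartic /quartic /= !mmapC. Qed.

Section LinearCombinations.
Variable R : pzRingType.
Implicit Types u v x y : R.
Lemma linear_combination0 u v x y : x = 0 -> y = 0 -> u * x + v * y = 0.
Proof. by move=> -> ->; rewrite !mulr0 addr0. Qed.
Lemma linear_combination1 u v x y : x = 1 -> y = 0 -> u * x + v * y = u.
Proof. by move=> -> ->; rewrite mulr0 mulr1 addr0. Qed.
Lemma linear_combination2 u v x y : x = 0 -> y = 1 -> u * x + v * y = v.
Proof. by move=> -> ->; rewrite mulr0 mulr1 add0r. Qed.
End LinearCombinations.

Lemma independent_jacobian (k : fieldType) (x1 x2 y1 y2 : k) :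
  (forall u v, u * x1 + v * x2 = 0 -> u * y1 + v * y2 = 0 -> u = 0 /\ v = 0) ->
  x1 * y2 <> x2 * y1.
Proof.
move=> h xy.
have [|| x20 /eqP] := h x2 (- x1); [by ring| |].
  by rewrite mulNr xy subrr.
rewrite oppr_eq0 => /eqP x10.
have [||y20 /eqP] := h y2 (- y1); [by rewrite x10 x20; ring|by ring|].
rewrite oppr_eq0 => /eqP y10.
have [||/eqP] := h 1 0; rewrite ?x10 ?x20 ?y10 ?y20 ?oner_eq0 //; ring.
Qed.

Lemma dfrac_wronskian (R : idomainType) (d : R -> R) (X Y : R) : X != 0 ->
  derivation d ->
  dfrac d (Y%:F / X%:F) = (wronskian d X Y)%:F / X%:F ^+ 2.
Proof.
move=> X0 dP; rewrite (dfracE dP) // /wronskian.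
pose f : {rmorphism R -> {fraction R}} := @FracField.tofrac R.
rewrite -[X%:F]/(f X) -[Y%:F]/(f Y) -[(d Y)%:F]/(f (d Y)) -[(d X)%:F]/(f (d X)).
by rewrite -[(_ - _)%:F]/(f _) rmorphB !rmorphM [f X * _]mulrC.
Qed.

Lemma dfrac_jacobian (R : idomainType) (d1 d2 : R -> R) (X Y Z T : R) :
  derivation d1 -> derivation d2 -> X != 0 -> Z != 0 ->
  wronskian d1 X Y * wronskian d2 Z T = wronskian d2 X Y * wronskian d1 Z T ->
  dfrac d1 (Y%:F / X%:F) * dfrac d2 (T%:F / Z%:F)
  = dfrac d2 (Y%:F / X%:F) * dfrac d1 (T%:F / Z%:F).
Proof.
move=> d1P d2P X0 Z0 W; rewrite !dfrac_wronskian // !mulf_div.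
by rewrite -[LHS]/((FracField.tofrac _ * FracField.tofrac _) / _) -tofracM W tofracM.
Qed.

Section DerivationThroughEmbedding.
Variables (C : closedFieldType) (L E : fieldType) (iota : {rmorphism C -> L}).
Hypothesis char0 : forall n, n.+1%:R != 0 :> E.
Variables (K : subfld L) (theta : {rmorphism sf_type K -> E}) (d : E -> E).
Hypothesis dP : derivation d.
Variable S : set L.
Hypothesis K_iota : forall c, K (iota c).
Hypothesis K_S : S `<=` K.
Hypothesis d_iota : forall c y, sf_val y = iota c -> d (theta y) = 0.
Hypothesis d_S : forall y, S (sf_val y) -> d (theta y) = 0.

Let F := [set z | exists2 y : sf_type K, sf_val y = z & d (theta y) = 0].

Let F_closed : [/\ F 1, forall x y, F x -> F y -> F (x - y)
  & forall x y, F x -> F y -> F (x / y)].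
Proof.
have [c1 cB cdiv] := der_kernel_closed dP.
split=> [|_ _ [x <- dx] [y <- dy]|_ _ [x <- dx] [y <- dy]].
- by exists 1; [exact: rmorph1|rewrite rmorph1].
- by exists (x - y); [exact: rmorphB|rewrite rmorphB; exact: cB].
- by exists (x / y); [exact: fmorph_div|rewrite fmorph_div; exact: cdiv].
Qed.

(** The elements of [K] whose image is killed form a subfield containing the constants and [S];
    [theta] carries algebraic equations over it to [E], where [der_algebraic] applies. *)
Lemma derivation_through_embedding : (forall z, K z -> algcl (adj iota S) z) ->
  forall y, d (theta y) = 0.
Proof.
move=> Kalg y.
have sub : adj iota S `<=` Subfld F_closed.
  apply: adj_le => [c|z Sz].
    by have [x xE] := sf_valE (K_iota c); exists x => //; exact: d_iota xE.
  by have [x xE] := sf_valE (K_S Sz); exists x => //; apply: d_S; rewrite xE.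
have [p [p0 Fp py]] := algOverS sub (Kalg _ (sf_valP y)).
have Kp i : K p`_i by have [x <- _] := Fp i; exact: sf_valP.
have [q qE] := sf_map_poly Kp.
apply: (der_algebraic dP (F := [set x | d x = 0]) char0) => // [x n dx|].
  elim: n => [|n IH] /=; first by rewrite mulr0n (der0 dP).
  by rewrite mulrS (derD dP) [d x]dx add0r IH.
exists (map_poly theta q); split.
- by rewrite map_poly_eq0 -(map_poly_eq0 (@sf_val L K)) qE.
- move=> i; have [x xE dx] := Fp i; rewrite coef_map /=.
  suff -> : q`_i = x by [].
  have qi : sf_val q`_i = p`_i by rewrite -qE coef_map.
  by apply: (fmorph_inj (@sf_val L K)); exact: etrans qi (esym xE).
- by rewrite fmorph_root -(fmorph_root (@sf_val L K)) qE.
Qed.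

End DerivationThroughEmbedding.

Lemma rmorph_mul_sqr (R S : pzRingType) (f : {rmorphism R -> S}) x y u v x' y' :
  f x = x' -> f y = y' -> x * u ^+ 2 = y * v ^+ 2 -> x' * f u ^+ 2 = y' * f v ^+ 2.
Proof. by move=> <- <- xy; rewrite -!rmorphXn -!rmorphM xy. Qed.

Lemma affine_cancel (k : fieldType) (s a b : k) : b != 0 ->
  (s%:P + a *: 'X) - (a / b)%:P * (0%:P + b *: 'X) = s%:P.
Proof. by move=> b0; rewrite add0r mul_polyC scalerA divfK // addrK. Qed.

Lemma affine_scale (k : fieldType) (b : k) : b != 0 ->
  b^-1%:P * (0%:P + b *: 'X) = 'X.
Proof. by move=> b0; rewrite add0r mul_polyC scalerA mulVf // scale1r. Qed.

(* A field of fractions [p(phi) / q(phi)] of forms of equal degree in three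
   independent quantities [phi], that is, the function field of a plane. *)
Section PlaneField.
Variables (C : closedFieldType) (L : fieldType) (iota : {rmorphism C -> L}).
Hypothesis char0 : forall n, n.+1%:R != 0 :> C.
Variables (K : subfld L) (phi : 'I_3 -> L).
Local Notation ev := (mmap iota phi).
Hypothesis K_forms : forall z, K z <-> exists d (p q : {mpoly C[3]}),
  [/\ p \is d.-homog, q \is d.-homog, ev q != 0 & z = ev p / ev q].
Hypothesis phi_inj : forall (d : nat) p, p \is d.-homog -> ev p = 0 -> p = 0.

Variable B : 'I_3 -> C.
Hypothesis B0 : B i0 != 0.

Local Notation k := {fraction {poly C}}.
Local Notation P := {poly k}.
Local Notation E := {fraction P}.

Let j : {rmorphism C -> k} := @FracField.tofrac _ \o polyC.
Let S : k := ('X)%:F.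
(** The lines through [B] are parametrised by their point (0 : S : 1), and a point of such a line is
    (0, S, 1) + x B. Along it the top coefficient of a form is its value at [B]. *)
Let off (i : 'I_3) : k := nth 0 [:: 0; S; 1] i.
Let psi : {rmorphism {mpoly C[3]} -> P} :=
  mmap (polyC \o j) (fun i => (off i)%:P + j (B i) *: 'X).

Let psi_top (d : nat) f : f \is d.-homog -> top d (psi f) (j f.@[B]).
Proof.
move=> fd; have := top_mmap j fd (fun i => top_linear (off i) (j (B i))).
by rewrite muln1 /meval rmorph_mmap.
Qed.

Let psi_inj (d : nat) f : f \is d.-homog -> psi f = 0 -> f = 0.
Proof.
move=> fd f0.
pose offC (s : C) (i : 'I_3) : C := nth 0 [:: 0; s; 1] i.
pose offP (i : 'I_3) : {poly C} := nth 0 [:: 0; 'X; 1] i.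
have h1 x s : f.@[fun i => offC s i + B i * x] = 0.
  have : mmap (@polyC C \o idfun) (fun i => offP i + (B i * x)%:P) f = 0.
    apply/eqP; rewrite -(tofrac_eq0 (_ : {poly C})); apply/eqP.
    rewrite rmorph_mmap; have := congr1 (horner_eval (j x)) f0.
    rewrite /horner_eval horner0 => <-; rewrite -[RHS]/(horner_eval (j x) _) rmorph_mmap.
    rewrite /mmap; apply: eq_bigr => m _; congr (_ * _).
      by rewrite /= /horner_eval hornerC.
    apply: mmap1_eq => i; rewrite /= /horner_eval hornerD hornerC hornerZ hornerX.
    rewrite tofracD polyCM tofracM; congr (_ + _).
    by rewrite /off /offP; move: i; apply: ord3P; rewrite /= ?tofrac0 ?tofrac1.
  move/(congr1 (horner_eval s)); rewrite rmorph_mmap rmorph0 => <-.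
  rewrite /meval /mmap; apply: eq_bigr => m _; congr (_ * _).
    by rewrite /= /horner_eval hornerC.
  apply: mmap1_eq => i; rewrite /= /horner_eval hornerD hornerC; congr (_ + _).
  by rewrite /offC /offP; move: i; apply: ord3P; rewrite /= ?hornerE.
(* Off the line [g = 0], which joins [B] to (0 : 1 : 0), every vector is a multiple [r] of some (0,
   s, 1) + x B; hence [g * f] vanishes everywhere. *)
pose g : {mpoly C[3]} := (B i0)%:MP * 'X_i2 - (B i2)%:MP * 'X_i0.
have g0 : g != 0.
  apply/eqP => /(congr1 (meval (fun i => (i == i2)%:R))).
  rewrite meval0 /g mevalB !mevalM !mevalC !mevalXU eqxx mulr1.
  by rewrite (_ : i0 == i2 = false) // mulr0 subr0 => /eqP; apply/negP.
have : g * f = 0.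
  apply: mpoly_eq0 => v; rewrite mevalM.
  have [->|gv] := eqVneq g.@[v] 0; first by rewrite mul0r.
  pose x := v i0 / B i0; pose r := v i2 - B i2 * x; pose s := v i1 - B i1 * x.
  have r0 : r != 0.
    apply: contraNneq gv => r0; rewrite /g mevalB !mevalM !mevalC !mevalXU.
    have -> : v i2 = B i2 * x by apply/eqP; rewrite -subr_eq0 -/r r0.
    by rewrite /x; apply/eqP; field.
  have vE : v =1 fun i => r * (offC (s / r) i + B i * (x / r)).
    move=> i; have -> : r * (offC (s / r) i + B i * (x / r)) = r * offC (s / r) i + B i * x.
      by field.
    move: i; apply: ord3P; rewrite /offC /=.
    - by rewrite mulr0 add0r /x mulrC divfK.
    - by rewrite mulrC divfK // /s subrK.
    - by rewrite mulr1 /r subrK.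
  have -> : f.@[v] = r ^+ d * f.@[fun i => offC (s / r) i + B i * (x / r)].
    by rewrite (meval_eq _ vE); exact: mmap_homogZ.
  by rewrite h1 !mulr0.
by move/eqP; rewrite mulf_eq0 (negPf g0) => /eqP.
Qed.

Definition plane_rep z (a b : {mpoly C[3]}) :=
  exists d, [/\ a \is d.-homog, b \is d.-homog, ev b != 0 & z = ev a / ev b].

Let Psi : {rmorphism {mpoly C[3]} -> E} := @FracField.tofrac _ \o psi.

Let Psi_neq0 (d : nat) b : b \is d.-homog -> ev b != 0 -> Psi b != 0.
Proof.
move=> bd b0; rewrite /= tofrac_eq0; apply: contra b0 => /eqP /(psi_inj bd) ->.
by rewrite rmorph0.
Qed.

Let rep_exists (z : sf_type K) : exists ab, plane_rep (sf_val z) ab.1 ab.2.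
Proof.
have /K_forms[d [p [q h]]] := sf_valP z.
by exists (p, q); exists d.
Qed.

(** A representation as a quotient of forms is chosen; by [phi_inj] two choices differ by an
    identity between forms, so the value does not depend on it. *)
Definition plane_embed (z : sf_type K) : E :=
  let ab := projT1 (cid (rep_exists z)) in Psi ab.1 / Psi ab.2.
Local Notation theta := plane_embed.

Let plane_embedE z a b : plane_rep (sf_val z) a b -> theta z = Psi a / Psi b.
Proof.
move=> [d [ad bd b0 zE]]; rewrite /theta; case: (cid _) => -[a' b'] [d' [a'd b'd b'0 zE']].
apply: quotient_eq; [exact: Psi_neq0 b'd b'0|exact: Psi_neq0 bd b0|].
suff -> : a' * b - a * b' = 0 by rewrite rmorph0.
apply: (@phi_inj (d' + d)).
  by apply: rpredB; [exact: dhomogM|rewrite addnC; exact: dhomogM].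
move/eqP: zE; rewrite zE' eqr_div // => /eqP zz.
by rewrite rmorphB !rmorphM zz subrr.
Qed.

Let rep0 (z : sf_type K) : exists a b, plane_rep (sf_val z) a b.
Proof. by have [[a b] h] := rep_exists z; exists a, b. Qed.

Fact plane_embed_zmod : zmod_morphism theta.
Proof.
move=> y z; have [a [b ab]] := rep0 y; have [a' [b' ab']] := rep0 z.
rewrite (plane_embedE ab) (plane_embedE ab').
move: ab ab' => [d [ad bd b0 yE]] [d' [a'd b'd b'0 zE]].
rewrite (quotientB _ _ (Psi_neq0 bd b0) (Psi_neq0 b'd b'0)).
apply: plane_embedE; exists (d + d')%N; split; rewrite ?rmorphM ?mulf_neq0 //.
- by apply: rpredB; [exact: dhomogM|rewrite addnC; exact: dhomogM].
- exact: dhomogM.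
- rewrite (_ : sf_val (y - z) = sf_val y - sf_val z); last exact: rmorphB.
  by rewrite yE zE (quotientB _ _ b0 b'0) rmorphM.
Qed.

Fact plane_embed_monoid : monoid_morphism theta.
Proof.
split=> [|y z].
  rewrite (@plane_embedE _ 1 1) ?rmorph1 ?divr1 //.
  by exists 0%N; rewrite !rmorph1 divr1 oner_neq0 dhomog1.
have [a [b ab]] := rep0 y; have [a' [b' ab']] := rep0 z.
rewrite (plane_embedE ab) (plane_embedE ab') quotientM.
move: ab ab' => [d [ad bd b0 yE]] [d' [a'd b'd b'0 zE]].
have yzE : sf_val (y * z) = sf_val y * sf_val z by exact: rmorphM.
apply: plane_embedE; exists (d + d')%N; split; [exact: dhomogM|exact: dhomogM| |].
  by rewrite rmorphM mulf_neq0.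
by rewrite yzE yE zE mulf_div !rmorphM.
Qed.

HB.instance Definition _ := GRing.isZmodMorphism.Build (sf_type K) E theta plane_embed_zmod.
HB.instance Definition _ :=
  GRing.isMonoidMorphism.Build (sf_type K) E theta plane_embed_monoid.

Let d1 : P -> P := @deriv k.
Let dk : k -> k := dfrac (@deriv C).
Let dkP : derivation dk := dfrac_derivation (deriv_derivation C).
Let d2 : P -> P := map_poly dk.
Let d1P : derivation d1 := deriv_derivation k.
Let d2P : derivation d2 := der_map_poly dkP.
Let D1 : E -> E := dfrac d1.
Let D2 : E -> E := dfrac d2.
Let D1P : derivation D1 := dfrac_derivation d1P.
Let D2P : derivation D2 := dfrac_derivation d2P.

Let D1F a : D1 a%:F = (d1 a)%:F := dfrac_tofrac d1P a.
Let D2F a : D2 a%:F = (d2 a)%:F := dfrac_tofrac d2P a.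

Let psiC c : psi c%:MP = (j c)%:P. Proof. exact: mmapC. Qed.
Let psiX i : psi 'X_i = (off i)%:P + j (B i) *: 'X. Proof. exact: mmapXU. Qed.

Let dkS : dk S = 1.
Proof. by rewrite /dk /S (dfrac_tofrac (deriv_derivation C)) derivX tofrac1. Qed.

Let dkC c : dk (j c) = 0.
Proof. by rewrite /dk /= (dfrac_tofrac (deriv_derivation C)) derivC tofrac0. Qed.

Let d2C c : d2 c%:P = (dk c)%:P := der_map_polyC c dkP.
Let d2X : d2 'X = 0 := der_map_polyX dkP.

(** This linear form restricts to 1 on the pencil, so dividing a linear form by it realises its
    restriction as an element of the image of [theta]. *)
Let den : {mpoly C[3]} := 'X_i2 - (B i2 / B i0)%:MP * 'X_i0.

Let jB0 : j (B i0) != 0. Proof. by rewrite fmorph_eq0. Qed.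

Let psi_den : psi den = 1.
Proof.
rewrite rmorphB rmorphM psiC !psiX fmorph_div.
exact: (affine_cancel 1 _ jB0).
Qed.

Let den_neq0 : ev den != 0.
Proof.
apply/eqP => /(@phi_inj 1) h; have := psi_den; rewrite h ?rmorph0.
  by move/eqP; rewrite eq_sym oner_eq0.
by apply: rpredB; rewrite ?mul_mpolyC; [|apply: dhomogZ]; rewrite dhomogX /= mdeg1.
Qed.

Let den_homog : den \is 1.-homog.
Proof.
by apply: rpredB; rewrite ?mul_mpolyC; [|apply: dhomogZ]; rewrite dhomogX /= mdeg1.
Qed.

Let coord (f : {mpoly C[3]}) : f \is 1.-homog ->
  exists z : sf_type K, theta z = (psi f)%:F.
Proof.
move=> fd; have [|z zE] := @sf_valE _ K (ev f / ev den).
  by apply/K_forms; exists 1%N, f, den.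
exists z; rewrite (@plane_embedE z f den); last by exists 1%N.
by rewrite /= psi_den tofrac1 divr1.
Qed.

Let coord_X : exists z : sf_type K, theta z = ('X)%:F.
Proof.
have [|z zE] := @coord ((B i0)^-1%:MP * 'X_i0).
  by rewrite mul_mpolyC; apply: dhomogZ; rewrite dhomogX /= mdeg1.
exists z; apply: (etrans zE); congr (FracField.tofrac _); rewrite rmorphM psiC psiX fmorphV.
exact: affine_scale.
Qed.

Let coord_S : exists z : sf_type K, theta z = (S%:P)%:F.
Proof.
have [|z zE] := @coord ('X_i1 - (B i1 / B i0)%:MP * 'X_i0).
  by apply: rpredB; rewrite ?mul_mpolyC; [|apply: dhomogZ]; rewrite dhomogX /= mdeg1.
exists z; apply: (etrans zE); congr (FracField.tofrac _).
rewrite rmorphB rmorphM psiC !psiX fmorph_div.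
exact: (affine_cancel S _ jB0).
Qed.

Let K_iota c : K (iota c).
Proof.
apply/K_forms; exists 0%N, c%:MP, 1; rewrite rmorph1 mmapC divr1 oner_neq0.
by rewrite dhomog1; split=> //; exact: dhomog_mpolyC.
Qed.

Let theta_iota c y : sf_val y = iota c -> theta y = ((j c)%:P)%:F.
Proof.
move=> yE; rewrite (@plane_embedE y c%:MP 1).
  by rewrite rmorph1 divr1 /= psiC.
exists 0%N; rewrite rmorph1 mmapC divr1 oner_neq0.
by rewrite dhomog1; split=> //; exact: dhomog_mpolyC.
Qed.

Let E_char0 n : n.+1%:R != 0 :> E.
Proof.
pose G : {rmorphism C -> E} := @FracField.tofrac _ \o (polyC \o j).
by rewrite -(rmorph_nat G) fmorph_eq0.
Qed.

Let D1c c : D1 ((j c)%:P)%:F = 0.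
Proof. exact: etrans (D1F _) (etrans (congr1 _ (derivC _)) (tofrac0 _)). Qed.
Let D2c c : D2 ((j c)%:P)%:F = 0.
Proof.
apply: (etrans (D2F _)); apply: (etrans (congr1 _ (d2C _))).
by apply: (etrans (congr1 _ (congr1 _ (dkC c)))); exact: rmorph0.
Qed.
Let D1X : D1 ('X)%:F = 1.
Proof. exact: etrans (D1F _) (etrans (congr1 _ (derivX _)) (tofrac1 _)). Qed.
Let D2X : D2 ('X)%:F = 0.
Proof. exact: etrans (D2F _) (etrans (congr1 _ d2X) (tofrac0 _)). Qed.
Let D1S : D1 (S%:P)%:F = 0.
Proof. exact: etrans (D1F _) (etrans (congr1 _ (derivC _)) (tofrac0 _)). Qed.
Let D2S : D2 (S%:P)%:F = 1.
Proof.
apply: (etrans (D2F _)); apply: (etrans (congr1 _ (d2C _))).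
by apply: (etrans (congr1 _ (congr1 _ dkS))); exact: rmorph1.
Qed.

(** The derivation [u * D1 + v * D2] kills [t] and [t'], hence all of [K]; its values at the images
    ['X] and [S] of elements of [K] are [u] and [v]. *)
Let no_derivation (t t' : sf_type K) (u v : E) :
  (forall z, K z -> algcl (adj iota [set sf_val t; sf_val t']) z) ->
  u * D1 (theta t) + v * D2 (theta t) = 0 ->
  u * D1 (theta t') + v * D2 (theta t') = 0 -> u = 0 /\ v = 0.
Proof.
move=> Kalg dt dt'; pose d (z : E) := u * D1 z + v * D2 z.
have dP : derivation d.
  split=> x y; rewrite /d ?(derD D1P) ?(derD D2P) ?(derM D1P) ?(derM D2P).
    by rewrite !mulrDr addrACA.
  by ring.
have kill : forall y, d (theta y) = 0.
  apply: (derivation_through_embedding E_char0 dP K_iota _ _ _ Kalg).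
  - by move=> _ [->|->]; exact: sf_valP.
  - move=> c y /theta_iota yE; apply: (etrans (congr1 d yE)).
    exact: linear_combination0 (D1c c) (D2c c).
  - move=> y [yE|yE].
      have -> : y = t by exact: (fmorph_inj (@sf_val L K)) yE.
      exact: dt.
    have -> : y = t' by exact: (fmorph_inj (@sf_val L K)) yE.
    exact: dt'.
have [x xE] := coord_X; have [s sE] := coord_S.
have dX : d ('X)%:F = 0 := etrans (esym (congr1 d xE)) (kill x).
have dSS : d (S%:P)%:F = 0 := etrans (esym (congr1 d sE)) (kill s).
split; first exact: etrans (esym (linear_combination1 u v D1X D2X)) dX.
exact: etrans (esym (linear_combination2 u v D1S D2S)) dSS.
Qed.

Let top_size n p (c : k) : top n p c -> c != 0 -> size p = n.+1.
Proof.
move=> [sp <-] c0; apply/eqP; rewrite eqn_leq sp ltnNge.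
by apply: contra c0 => h; rewrite nth_default.
Qed.

(** Since the two quartics are nonzero at [B], their restrictions have the exact degrees [4m] and
    [4n] that [kummer_jacobian] requires. The Jacobian it annihilates is nonzero by
    [no_derivation]. *)
Lemma no_kummer_forms (e e' : nat -> C) (m n l l' : nat) (p q r s b d : {mpoly C[3]})
    (t t' : L) :
  separable_quartic e -> separable_quartic e' ->
  p \is m.-homog -> q \is m.-homog -> r \is n.-homog -> s \is n.-homog ->
  b \is l.-homog -> d \is l'.-homog -> b != 0 -> d != 0 ->
  ev q != 0 -> ev s != 0 -> t = ev p / ev q -> t' = ev r / ev s ->
  quartic e q.@[B] p.@[B] != 0 -> quartic e' s.@[B] r.@[B] != 0 ->
  quartic (@mpolyC 3 C \o e') s r * d ^+ 2 = quartic (@mpolyC 3 C \o e) q p * b ^+ 2 ->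
  (forall z, K z -> algcl (adj iota [set t; t']) z) -> False.
Proof.
move=> e_sep e'_sep pm qm rn sn bl dl b0 d0 q0 s0 tE t'E De De' DD Kalg.
have [|y yE] := @sf_valE _ K t; first by apply/K_forms; exists m, p, q.
have [|y' y'E] := @sf_valE _ K t'; first by apply/K_forms; exists n, r, s.
have psi0 u i : u \is i.-homog -> u != 0 -> psi u != 0.
  by move=> ui; apply: contra => /eqP h; apply/eqP; exact: psi_inj ui h.
have psiD ee u v : psi (quartic (@mpolyC 3 C \o ee) u v) =
    quartic ((polyC \o j) \o ee) (psi u) (psi v) by exact: mmap_quartic.
have size_quartic ee i u v : u \is i.-homog -> v \is i.-homog ->
    quartic ee u.@[B] v.@[B] != 0 ->
    size (quartic ((polyC \o j) \o ee) (psi u) (psi v)) = (4 * i).+1.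
  move=> ul vl uv0; rewrite -psiD.
  apply: (top_size (psi_top (dhomog_quartic ee ul vl))).
  by rewrite fmorph_eq0 /meval mmap_quartic.
have d1C c : d1 (j c)%:P = 0 := derivC _.
have d2C0 c : d2 (j c)%:P = 0.
  by apply: (etrans (d2C _)); apply: (etrans (congr1 _ (dkC c))); exact: rmorph0.
have d1s f : (size (d1 f) <= (size f).-1)%N by exact: size_poly.
have d2s f : (size (d2 f) <= size f)%N by exact: size_poly.
have DDpsi : quartic ((polyC \o j) \o e') (psi s) (psi r) * psi d ^+ 2
    = quartic ((polyC \o j) \o e) (psi q) (psi p) * psi b ^+ 2.
  exact: rmorph_mul_sqr (psiD _ _ _) (psiD _ _ _) DD.
have b0' := psi0 _ _ bl b0; have d0' := psi0 _ _ dl d0.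
have Xs := size_quartic e _ _ _ qm pm De.
have Zs := size_quartic e' _ _ _ sn rn De'.
have jac0 := @kummer_jacobian C k j d1 d2 d1P d2P.
have jac1 := jac0 d1C d2C0 d1s d2s.
have jac2 := jac1 e e' e_sep e'_sep m n _ _ _ _ (psi b) (psi d)
  (psi_top qm).1 (psi_top pm).1 (psi_top sn).1 (psi_top rn).1.
have jac3 := jac2 Xs Zs b0' d0'.
have jac := jac3 DDpsi.
have nz u : ev u != 0 -> u != 0 by apply: contraNneq => ->; rewrite rmorph0.
have q0' := psi0 _ _ qm (nz _ q0); have s0' := psi0 _ _ sn (nz _ s0).
have ty : theta y = (psi p)%:F / (psi q)%:F.
  have rep : plane_rep (sf_val y) p q by exists m; exact: And4 pm qm q0 (etrans yE tE).
  exact: plane_embedE rep.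
have ty' : theta y' = (psi r)%:F / (psi s)%:F.
  have rep : plane_rep (sf_val y') r s by exists n; exact: And4 rn sn s0 (etrans y'E t'E).
  exact: plane_embedE rep.
apply: (@independent_jacobian E (D1 (theta y)) (D2 (theta y)) (D1 (theta y')) (D2 (theta y'))).
  by move=> u v; apply: no_derivation; rewrite yE y'E.
rewrite ty ty'; exact: dfrac_jacobian d1P d2P q0' s0' jac.
Qed.

End PlaneField.

Lemma square_ratio (R : comPzRingType) (k : fieldType) (f : {rmorphism R -> k})
    (b d q s X Y : R) (D D' : k) : f d != 0 ->
  f Y = D' * f s ^+ 4 -> f X = D * f q ^+ 4 -> D' = (f b / f d) ^+ 2 * D ->
  f (Y * (q ^+ 2 * d) ^+ 2 - X * (s ^+ 2 * b) ^+ 2) = 0.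
Proof.
move=> d0 YE XE DE; have fE u v w : f (u * (v ^+ 2 * w) ^+ 2) = f u * (f v ^+ 2 * f w) ^+ 2.
  by rewrite rmorphM (rmorphXn f 2) rmorphM (rmorphXn f 2).
rewrite rmorphB !fE YE XE DE; move: (f b) (f d) (f q) (f s) d0 => B A Q S A0.
by field.
Qed.

Section NoKummer.
Variables (C : closedFieldType) (L : fieldType) (iota : {rmorphism C -> L}).
Hypothesis char0 : forall n, n.+1%:R != 0 :> C.
Variables (K : subfld L) (phi : 'I_3 -> L).
Local Notation ev := (mmap iota phi).
Hypothesis K_forms : forall z, K z <-> exists d (p q : {mpoly C[3]}),
  [/\ p \is d.-homog, q \is d.-homog, ev q != 0 & z = ev p / ev q].
Hypothesis phi_inj : forall (d : nat) p, p \is d.-homog -> ev p = 0 -> p = 0.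

Let homogeneous_quartic (e : nat -> C) (p q : {mpoly C[3]}) : ev q != 0 ->
  ev (quartic (@mpolyC 3 C \o e) q p) = quartic (iota \o e) 1 (ev p / ev q) * ev q ^+ 4.
Proof.
move=> q0; rewrite mmap_quartic /quartic; field.
exact: q0.
Qed.

Lemma no_kummer (e e' : nat -> C) (t t' c : L) :
  separable_quartic e -> separable_quartic e' -> K t -> K t' -> K c -> c != 0 ->
  quartic (iota \o e) 1 t != 0 ->
  quartic (iota \o e') 1 t' = c ^+ 2 * quartic (iota \o e) 1 t ->
  (forall z, K z -> algcl (adj iota [set t; t']) z) -> False.
Proof.
move=> e_sep e'_sep /K_forms[m [p [q [pm qm q0 tE]]]] /K_forms[n [r [s [rn sn s0 t'E]]]].
move=> /K_forms[l [b [d [bl dl d0 cE]]]] c0 De0 De Kalg.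
have De'0 : quartic (iota \o e') 1 t' != 0 by rewrite De mulf_neq0 ?expf_neq0.
pose X := quartic (@mpolyC 3 C \o e) q p; pose Y := quartic (@mpolyC 3 C \o e') s r.
have XE : ev X = quartic (iota \o e) 1 t * ev q ^+ 4 by rewrite tE; exact: homogeneous_quartic.
have YE : ev Y = quartic (iota \o e') 1 t' * ev s ^+ 4 by rewrite t'E; exact: homogeneous_quartic.
have nz u : ev u != 0 -> u != 0 by apply: contraNneq => ->; rewrite rmorph0.
have X0 : X != 0 by apply: nz; rewrite XE mulf_neq0 ?expf_neq0.
have Y0 : Y != 0 by apply: nz; rewrite YE mulf_neq0 ?expf_neq0.
have b0 : ev b != 0.
  by move: c0; rewrite cE mulf_eq0 negb_or => /andP[].
have x0 : 'X_i0 != 0 :> {mpoly C[3]}.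
  apply/eqP => /(congr1 (meval (fun=> 1))); rewrite meval0 mevalXU.
  by apply/eqP; exact: oner_neq0.
(* The base point of the pencil must avoid both quartic curves and the line on which the parameters
   (0 : S : 1) lie. *)
have [|B] := @mpoly_nonzero C 3 (X * Y * 'X_i0); first by rewrite !mulf_neq0.
rewrite !mevalM mevalXU !mulf_eq0 !negb_or => /andP[/andP[XB YB] B0].
have qd : q ^+ 2 * d \is (m * 2 + l).-homog by apply: dhomogM => //; exact: dhomogMn.
have sb : s ^+ 2 * b \is (n * 2 + l).-homog by apply: dhomogM => //; exact: dhomogMn.
have quarticB ee u v : (quartic (@mpolyC 3 C \o ee) u v).@[B] = quartic ee u.@[B] v.@[B].
  by rewrite /meval mmap_quartic.
(* The squares of [q ^+ 2] and [s ^+ 2] are the denominators introduced when the quartics in [t] and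
   [t'] are made homogeneous. *)
have id0 : Y * (q ^+ 2 * d) ^+ 2 - X * (s ^+ 2 * b) ^+ 2 = 0.
  apply: (@phi_inj (4 * n + (m * 2 + l) * 2)%N).
    have YH := dhomogM (dhomog_quartic e' sn rn) (dhomogMn 2 qd).
    have XH := dhomogM (dhomog_quartic e qm pm) (dhomogMn 2 sb).
    have E : (4 * m + (n * 2 + l) * 2 = 4 * n + (m * 2 + l) * 2)%N by clear; lia.
    by move: XH; rewrite E => XH; exact: rpredB YH XH.
  have De' : quartic (iota \o e') 1 t' = (ev b / ev d) ^+ 2 * quartic (iota \o e) 1 t.
    exact: etrans De (congr1 (fun z => z ^+ 2 * _) cE).
  exact: (@square_ratio _ _ (mmap iota phi) b d q s X Y _ _ d0 YE XE De').
have nzM u v i : ev u != 0 -> ev v != 0 -> u ^+ i * v != 0.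
  by move=> u0 v0; rewrite mulf_neq0 ?expf_neq0 ?nz.
apply: (@no_kummer_forms C L iota char0 K phi K_forms phi_inj B B0 e e' m n _ _
  p q r s (s ^+ 2 * b) (q ^+ 2 * d) t t' e_sep e'_sep pm qm rn sn sb qd
  (nzM _ _ 2 s0 b0) (nzM _ _ 2 q0 d0) q0 s0 tE t'E _ _ _ Kalg).
- by rewrite -quarticB.
- by rewrite -quarticB.
- by apply/eqP; rewrite -subr_eq0 id0.
Qed.

End NoKummer.

(** * Generic points of products of plane cubics *)

(** Degree 0 is impossible and degree 1 gives [F = K]. In degree 2 a basis is changed to one
    containing 1, and completing the square supplies [delta]. *)
Lemma quadratic_extension (L : fieldType) (K F : subfld L) (e : nat) :
  2%:R != 0 :> L -> (forall x, K x -> F x) ->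
  extension_degree K F e -> (e < 3)%N ->
  (forall x, F x -> K x) \/ exists delta, [/\ F delta, ~ K delta, K (delta ^+ 2)
    & forall x, F x -> exists u v, [/\ K u, K v & x = u + v * delta]].
Proof.
move=> n2 KF [b [Fb bP]] e3.
have [eps Feps epsP] : exists2 eps, F eps &
    forall x, F x -> exists u v, [/\ K u, K v & x = u + v * eps].
  have span x : F x -> exists c : {ffun 'I_e -> L},
      (forall i, K (c i)) /\ x = \sum_i c i * b i.
    by move=> /bP[c [cP _]]; exists c.
  have [c [Kc c1]] := span 1 (sf1 F).
  case: e b Fb {bP} span c Kc c1 e3 => [|[|[|//]]] b Fb span c Kc.
  - by rewrite big_ord0 => /eqP; rewrite oner_eq0.
  - rewrite big_ord1 => c1 _; exists 0; first exact: sf0.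
    have Kb : K (b ord0).
      have c0 : c ord0 != 0.
        by apply: contra_eq_neq c1 => ->; rewrite mul0r oner_neq0.
      have -> : b ord0 = (c ord0)^-1 by apply: (mulfI c0); rewrite -c1 mulfV.
      exact: sfV.
    move=> x /span[d [Kd ->]]; exists (d ord0 * b ord0), 0.
    by rewrite big_ord1 mulr0 addr0; split; [exact: sfM|exact: sf0|].
  - rewrite big_ord_recl big_ord1 => c1 _.
    (* The given basis need not contain 1; a basis vector with nonzero coefficient in the expansion
       of 1 is exchanged for it. *)
    have red i j : 1 = c i * b i + c j * b j -> c i != 0 ->
        (forall x, F x -> exists u v, [/\ K u, K v & x = u * b i + v * b j]) ->
        exists2 eps, F eps &
          forall x, F x -> exists u v, [/\ K u, K v & x = u + v * eps].
      move=> cij ci sp; exists (b j) => // x /sp[u [v [Ku Kv ->]]].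
      exists (u / c i), (v - u * c j / c i); split; first exact: sf_div.
        by apply: sfB => //; apply: sf_div => //; exact: sfM.
      apply: (mulfI ci); have -> : c i * (u * b i + v * b j) =
        u * (c i * b i) + c i * v * b j by ring.
      have -> : c i * b i = 1 - c j * b j by rewrite cij addrK.
      by field.
    have [c0|c0] := eqVneq (c ord0) 0.
      apply: (red (lift ord0 ord0) ord0); first by rewrite addrC.
        apply: contra_eq_neq c1 => h.
        by rewrite c0 h !mul0r addr0 oner_neq0.
      move=> x /span[d [Kd ->]]; exists (d (lift ord0 ord0)), (d ord0).
      by rewrite big_ord_recl big_ord1 addrC.
    apply: (red ord0 (lift ord0 ord0)) => // x /span[d [Kd ->]].
    by exists (d ord0), (d (lift ord0 ord0)); rewrite big_ord_recl big_ord1.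
have [Keps|Keps] := pselect (K eps).
  by left=> x /epsP[u [v [Ku Kv ->]]]; apply: sfD => //; exact: sfM.
right; have [u [v [Ku Kv E]]] := epsP _ (sfX 2 Feps).
have K2 : K (v / 2%:R) by apply: sf_div => //; exact: sf_nat.
exists (eps - v / 2%:R); split.
- by apply: sfB => //; exact: KF.
- by move=> h; apply: Keps; rewrite -[eps](subrK (v / 2%:R)); exact: sfD.
- have -> : (eps - v / 2%:R) ^+ 2 = u + (v / 2%:R) ^+ 2.
    transitivity (eps ^+ 2 - v * eps + (v / 2%:R) ^+ 2); first by field.
    by rewrite E; ring.
  by apply: sfD => //; exact: sfX.
- move=> x /epsP[r [s [Kr Ks ->]]]; exists (r + s * (v / 2%:R)), s.
  by split=> //; [apply: sfD => //; exact: sfM|ring].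
Qed.

Definition pair2 (T : Type) (x y : T) (i : 'I_2) : T := if i == ord0 then x else y.

(* [(xi, eta)] is a generic point of a product of two plane cubics. *)
Record generic_pair (C L : fieldType) (iota : {rmorphism C -> L})
    (a b : nat -> C) (xi eta : 'rV[L]_3) : Prop := GenericPair {
  gp_cubic1 : cubicv (iota \o a) xi = 0;
  gp_cubic2 : cubicv (iota \o b) eta = 0;
  gp_norm1 : exists i, xi 0 i = 1;
  gp_norm2 : exists i, eta 0 i = 1;
  gp_linear1 : forall (M : 'M[C]_3) i, (xi *m map_mx iota M) 0 i = 0 ->
    forall v, cubicv a v = 0 -> (v *m M) 0 i = 0;
  gp_linear2 : forall (M : 'M[C]_3) i, (eta *m map_mx iota M) 0 i = 0 ->
    forall v, cubicv b v = 0 -> (v *m M) 0 i = 0;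
  gp_relation : forall (M N : 'M[C]_3) (F : {mpoly C[2]}),
    let x := xi *m map_mx iota M in let y := eta *m map_mx iota N in
    x 0 i0 != 0 -> y 0 i0 != 0 ->
    mmap iota (pair2 (x 0 i1 / x 0 i0) (y 0 i1 / y 0 i0)) F = 0 ->
    forall v w, cubicv a v = 0 -> cubicv b w = 0 ->
    (v *m M) 0 i0 != 0 -> (w *m N) 0 i0 != 0 ->
    F.@[pair2 ((v *m M) 0 i1 / (v *m M) 0 i0) ((w *m N) 0 i1 / (w *m N) 0 i0)] = 0
}.

Definition coordinates (L : fieldType) (xi eta : 'rV[L]_3) : set L :=
  [set z | exists i, z = xi 0 i \/ z = eta 0 i].

Lemma algcl_sqrt (L : fieldType) (F : subfld L) x : F (x ^+ 2) -> algcl F x.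
Proof.
move=> Fx; exists ('X^2 - (x ^+ 2)%:P); split.
- by rewrite -size_poly_eq0 size_XnsubC.
- move=> i; rewrite coefB coefXn coefC; apply: sfB; first by case: eqP => _; [exact: sf1|exact: sf0].
  by case: ifP => _ //; exact: sf0.
- by rewrite rootE hornerD hornerN hornerC hornerXn subrr.
Qed.

Section Independence.
Variables (C : closedFieldType) (L : fieldType) (iota : {rmorphism C -> L}).
Hypothesis char0 : forall n, n.+1%:R != 0 :> C.
Variables (a b : nat -> C) (xi eta : 'rV[L]_3).
Hypothesis gp : generic_pair iota a b xi eta.

Lemma nf_good (c : nat -> C) (N : normal_form c) : exists x, formL (nf_cubic N) 1 x != 0.
Proof.
rewrite /formL; have [a7|a7] := eqVneq (nf_cubic N 7) 0.
  exists 1; rewrite a7 mul0r add0r mulr1; apply/eqP => a8.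
  exact: formL_neq0 (nf_smooth N) (nf_origin N) (conj a7 a8).
by exists 0; rewrite mulr0 addr0 mulr1.
Qed.

(** A linear form vanishing at the generic point would vanish on the whole curve, but [nf_point]
    gives a point where this one is 1. *)
Lemma gp_coord1_neq0 (N : normal_form a) : nf_coord iota N xi 0 i0 != 0.
Proof.
have [x /nf_point[v [v0 av v1 _]]] := nf_good N.
apply/eqP => /(gp_linear1 gp)/(_ v av)/eqP.
by rewrite v1 oner_eq0.
Qed.

Lemma gp_coord2_neq0 (N : normal_form b) : nf_coord iota N eta 0 i0 != 0.
Proof.
have [x /nf_point[v [v0 av v1 _]]] := nf_good N.
apply/eqP => /(gp_linear2 gp)/(_ v av)/eqP.
by rewrite v1 oner_eq0.
Qed.

Variables (N : normal_form a) (N' : normal_form b).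
Local Notation t := (nf_t iota N xi).
Local Notation t' := (nf_t iota N' eta).

(** A relation specialises to all pairs of closed points, and these realise every pair of values at
    which the forms [L] of the two cubics are nonzero. Multiplying by both forms gives a polynomial
    that vanishes everywhere. *)
Lemma gp_independent (F : {mpoly C[2]}) : mmap iota (pair2 t t') F = 0 -> F = 0.
Proof.
move=> F0; pose form (c : nat -> C) (i : 'I_2) : {mpoly C[2]} := (c 7)%:MP + (c 8)%:MP * 'X_i.
have formE c i v : (form c i).@[v] = formL c 1 (v i).
  by rewrite mevalD mevalM !mevalC mevalXU /formL mulr1.
have form0 c (M : normal_form c) i : form (nf_cubic M) i != 0.
  have [x hx] := nf_good M; apply: contraNneq hx => h.
  by rewrite -(formE _ i (fun=> x)) h meval0.
have : F * form (nf_cubic N) ord0 * form (nf_cubic N') ord_max = 0.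
  apply: mpoly_eq0 => v; rewrite !mevalM !formE.
  have [->|] := eqVneq (formL (nf_cubic N) 1 (v ord0)) 0; first by rewrite mulr0 mul0r.
  move=> /nf_point[p [p0 ap p1 px]].
  have [->|] := eqVneq (formL (nf_cubic N') 1 (v ord_max)) 0; first by rewrite mulr0.
  move=> /nf_point[q [q0 bq q1 qx]].
  have := gp_relation gp (gp_coord1_neq0 N) (gp_coord2_neq0 N') F0 ap bq.
  rewrite p1 q1 px qx !divr1 => /(_ (oner_neq0 _) (oner_neq0 _)) FE.
  rewrite (_ : F.@[v] = 0) ?mul0r // -[RHS]FE; apply: meval_eq => -[[|[|//]] hi];
  by rewrite /pair2 /=; congr v; exact: val_inj.
move/eqP; rewrite !mulf_eq0 (negPf (form0 _ _ _)) (negPf (form0 _ _ _)) !orbF.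
by move/eqP.
Qed.

Lemma gp_nonconstant1 : ~ range iota t.
Proof.
case=> c _ ct; have /eqP : 'X_ord0 - c%:MP = 0 :> {mpoly C[2]}.
  by apply: gp_independent; rewrite rmorphB /= mmapXU mmapC /pair2 /= ct subrr.
move/eqP/(congr1 (meval (fun=> c + 1))); rewrite meval0 mevalB mevalXU mevalC.
by rewrite addrC addKr => /eqP; rewrite oner_eq0.
Qed.

Lemma gp_nonconstant2 : ~ range iota t'.
Proof.
case=> c _ ct; have /eqP : 'X_ord_max - c%:MP = 0 :> {mpoly C[2]}.
  by apply: gp_independent; rewrite rmorphB /= mmapXU mmapC /pair2 /= ct subrr.
move/eqP/(congr1 (meval (fun=> c + 1))); rewrite meval0 mevalB mevalXU mevalC.
by rewrite addrC addKr => /eqP; rewrite oner_eq0.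
Qed.

Lemma gp_transcendental2 : ~ algcl (adj iota [set t]) t'.
Proof.
move=> h; have [|F /eqP F0 FE] := @algebraic_dependent C L iota 1 (pair2 t t').
  apply: (algcl_adj _ _ h) => [c|_ ->]; first exact: adj_iota.
  by apply: algOver_id; apply: adj_sub; exists ord0.
exact/F0/gp_independent.
Qed.

(** The coordinates are rational in [t], [w] and in [t'], [w'], and the squares of [w], [w'] are
    polynomials in [t], [t']. *)
Lemma gp_algebraic : adj iota (coordinates xi eta) `<=` algcl (adj iota [set t; t']).
Proof.
set F := algcl _.
have FC c : F (iota c) by apply: algOver_id; exact: adj_iota.
have Fquartic (e : nat -> C) x : F x -> F (quartic (iota \o e) 1 x).
  move=> Fx; rewrite /quartic.
  by repeat first [exact: FC|exact: Fx|exact: sf1|apply: sfX|apply: sfD|apply: sfM].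
have [Ft Ft'] : F t /\ F t'.
  by split; apply: algOver_id; apply: adj_sub; [left|right].
have Fsqrt x : F (x ^+ 2) -> F x by move=> /algcl_sqrt/algcl_trans.
apply: adj_le => // z [i [->|->]].
  apply: (nf_generators char0 (gp_coord1_neq0 N) gp_nonconstant1 FC Ft _ (gp_norm1 gp)).
  by apply: Fsqrt; rewrite (nf_w_square (gp_cubic1 gp) (gp_coord1_neq0 N)); exact: Fquartic.
apply: (nf_generators char0 (gp_coord2_neq0 N') gp_nonconstant2 FC Ft' _ (gp_norm2 gp)).
by apply: Fsqrt; rewrite (nf_w_square (gp_cubic2 gp) (gp_coord2_neq0 N')); exact: Fquartic.
Qed.

End Independence.

Lemma dhomog_prod3 n (C : comNzRingType) (d e f : nat) (p q r : {mpoly C[n]}) :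
  p \is d.-homog -> q \is e.-homog -> r \is f.-homog ->
  p * q * r \is (d + e + f).-homog.
Proof. by move=> pd qe rf; apply: dhomogM => //; exact: dhomogM. Qed.

Lemma vec_neq0 (R : pzRingType) n (v : 'rV[R]_n) : v != 0 -> exists i, v 0 i != 0.
Proof. by case/rV0Pn => i vi; exists i. Qed.

(* The solution [R] of [c0 + c2 s = c1 + c3 s = 0] is the third point of the
   line through the conjugate points [A + d B] and [A - d B] on the cubic. *)
Lemma cubic_conjugate_points (L : fieldType) (K : subfld L) (a : nat -> L)
    (A B : 'rV[L]_3) (d : L) :
  (forall i, K (a i)) -> (forall i, K (A 0 i)) -> (forall i, K (B 0 i)) ->
  K (d ^+ 2) -> ~ K d -> cubicv a (A + d *: B) = 0 ->
  cubicv a B = 0 \/ exists2 s, K s & cubicv a (A - s *: B) = 0.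
Proof.
move=> Ka KA KB Kd nKd E.
pose x := A 0 i0; pose y := A 0 i1; pose z := A 0 i2.
pose u := B 0 i0; pose v := B 0 i1; pose w := B 0 i2.
pose c1 := cubic_x a x y z * u + cubic_y a x y z * v + cubic_z a x y z * w.
pose c2 := cubic_x a u v w * x + cubic_y a u v w * y + cubic_z a u v w * z.
have taylor s : cubicv a (A + s *: B) =
    cubicv a A + c1 * s + c2 * s ^+ 2 + cubicv a B * s ^+ 3.
  rewrite /cubicv !mxE -/x -/y -/z -/u -/v -/w /c1 /c2 /cubic /cubic_x /cubic_y /cubic_z.
  by ring.
have Kx i : K (A 0 i) by []. have Ku i : K (B 0 i) by [].
have Kcub p q r : K p -> K q -> K r -> [/\ K (cubic a p q r), K (cubic_x a p q r),
    K (cubic_y a p q r) & K (cubic_z a p q r)].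
  have Kn g i : K g -> K (g *+ i).
    by move=> Kg; rewrite -mulr_natr; apply: sfM => //; exact: sf_nat.
  move=> Kp Kq Kr; rewrite /cubic /cubic_x /cubic_y /cubic_z.
  by split; repeat first [exact: Kp|exact: Kq|exact: Kr|exact: Ka|apply: sfX|apply: Kn
    |apply: sfD|apply: sfM].
have [c0K _ _ _] := Kcub x y z (Kx _) (Kx _) (Kx _).
have [c3K u1 u2 u3] := Kcub u v w (Ku _) (Ku _) (Ku _).
have Kc1 : K c1.
  have [_ h1 h2 h3] := Kcub x y z (Kx _) (Kx _) (Kx _).
  exact: sfD (sfD (sfM h1 (Ku _)) (sfM h2 (Ku _))) (sfM h3 (Ku _)).
have Kc2 : K c2.
  exact: sfD (sfD (sfM u1 (Kx _)) (sfM u2 (Kx _))) (sfM u3 (Kx _)).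
move: E; rewrite taylor => E.
(* As [d ^+ 2] is in [K] and [d] is not, the odd and the even part of the expansion in [d] vanish
   separately. *)
have odd0 : c1 + cubicv a B * d ^+ 2 = 0.
  have [//|h] := eqVneq (c1 + cubicv a B * d ^+ 2) 0; case: nKd.
  have -> : d = - (cubicv a A + c2 * d ^+ 2) / (c1 + cubicv a B * d ^+ 2).
    apply: (mulIf h); rewrite divfK //; apply/eqP; rewrite -addr_eq0 -[X in _ == X]E.
    by apply/eqP; ring.
  apply: sf_div; first by apply: sfN; apply: sfD => //; exact: sfM.
  by apply: sfD => //; exact: sfM.
have even0 : cubicv a A + c2 * d ^+ 2 = 0.
  by rewrite -[RHS]E -[LHS]addr0 -(mul0r d) -odd0; ring.
have [|c3] := eqVneq (cubicv a B) 0; first by left.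
(* Along [A + s B] the cubic is now [(s^2 - d^2) (c3 s + c2)] with [c3 = cubicv a B], whose third
   root is [- c2 / c3]. For [c3 = 0] the third point is [B] itself. *)
right; exists (c2 / cubicv a B); first exact: sf_div.
rewrite -scaleNr taylor; apply: (mulfI c3); rewrite mulr0.
have -> : c1 = - (cubicv a B * d ^+ 2) by apply/eqP; rewrite -addr_eq0 odd0.
have -> : cubicv a A = - (c2 * d ^+ 2) by apply/eqP; rewrite -addr_eq0 even0.
by field.
Qed.

(** * The lower bound for the degree over the function field of a plane *)

Section PlaneSubfield.
Variables (C : closedFieldType) (L : fieldType) (iota : {rmorphism C -> L}).
Hypothesis char0 : forall n, n.+1%:R != 0 :> C.
Variables (K : subfld L) (phi : 'I_3 -> L).
Local Notation ev := (mmap iota phi).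
Hypothesis K_forms : forall z, K z <-> exists d (p q : {mpoly C[3]}),
  [/\ p \is d.-homog, q \is d.-homog, ev q != 0 & z = ev p / ev q].
Hypothesis phi_inj : forall (d : nat) p, p \is d.-homog -> ev p = 0 -> p = 0.

Lemma plane_constants c : K (iota c).
Proof.
have h := dhomog_mpolyC 3 c.
apply/K_forms; exists 0%N, c%:MP, 1.
by rewrite rmorph1 mmapC divr1 oner_neq0 dhomog1 h.
Qed.

(** Clearing denominators turns a point over [K] into three forms of one degree, a rational map from
    the plane to the cubic; [rational_map_to_cubic] makes it constant. *)
Lemma plane_points_constant (a : nat -> C) (R : 'rV[L]_3) : smooth_cubic a ->
  (forall i, K (R 0 i)) -> R != 0 -> cubicv (iota \o a) R = 0 ->
  exists k c, [/\ c != 0, cubicv a c = 0 & R = k *: map_mx iota c].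
Proof.
move=> sa KR R0 aR.
have /K_forms[d0 [p0 [q0 [p0d q0d q00 E0]]]] := KR i0.
have /K_forms[d1 [p1 [q1 [p1d q1d q10 E1]]]] := KR i1.
have /K_forms[d2 [p2 [q2 [p2d q2d q20 E2]]]] := KR i2.
pose f i : {mpoly C[3]} := nth 0 [:: p0 * q1 * q2; q0 * p1 * q2; q0 * q1 * p2] (i : 'I_3).
pose Q := ev q0 * ev q1 * ev q2.
have Q0 : Q != 0 by rewrite !mulf_neq0.
have evM3 x y z : ev (x * y * z) = ev x * ev y * ev z by rewrite !rmorphM.
have fE i : ev (f i) = Q * R 0 i.
  move: i; apply: ord3P; rewrite /f /Q /nth [val _]/= evM3 ?E0 ?E1 ?E2.
  - move: (ev p0) (ev q0) (ev q1) (ev q2) q00 => P X Y Z X0; by field.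
  - move: (ev p1) (ev q0) (ev q1) (ev q2) q10 => P X Y Z X0; by field.
  - move: (ev p2) (ev q0) (ev q1) (ev q2) q20 => P X Y Z X0; by field.
have fd i : f i \is (d0 + d1 + d2).-homog.
  by move: i; apply: ord3P; exact: dhomog_prod3.
have F0 : cubic (@mpolyC 3 C \o a) (f i0) (f i1) (f i2) = 0.
  apply: (phi_inj (dhomog_cubic a (fd i0) (fd i1) (fd i2))).
  apply: (etrans (mmap_cubic iota phi a _ _ _)); rewrite !fE cubicZ.
  by rewrite -[cubic _ _ _ _]/(cubicv (iota \o a) R) aR mulr0.
have [k Rk] := vec_neq0 R0.
have fk : f k != 0.
  apply: contraNneq Rk => h; have := fE k; rewrite h rmorph0 => /esym/eqP.
  by rewrite mulf_eq0 (negPf Q0).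
have [w wk] := mpoly_nonzero fk.
have prop v := rational_map_to_cubic char0 sa (fd i0) (fd i1) (fd i2) F0 v w.
pose c : 'rV[C]_3 := \row_i (f i).@[w].
have all_prop i l v : (f i).@[v] * (f l).@[w] = (f l).@[v] * (f i).@[w].
  have [h1 h2 h3] := prop v.
  by move: i l; apply: ord3P; apply: ord3P => //; exact: esym.
have ck : iota (c 0 k) != 0 by rewrite fmorph_eq0 mxE.
have Rprop i : R 0 i * iota (c 0 k) = R 0 k * iota (c 0 i).
  have : (f i) * (c 0 k)%:MP - (f k) * (c 0 i)%:MP = 0.
    apply: mpoly_eq0 => v; rewrite mevalB !mevalM !mevalC !mxE.
    by rewrite all_prop subrr.
  move/(congr1 ev); rewrite rmorph0 rmorphB !rmorphM /= !mmapC !fE => /eqP.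
  by rewrite subr_eq0 => /eqP h; apply: (mulfI Q0); rewrite !mulrA.
exists (R 0 k / iota (c 0 k)), c; split.
- by apply: contraNneq ck => ->; rewrite mxE rmorph0.
- have := congr1 (meval w) F0; rewrite meval0 => <-.
  by rewrite /meval mmap_cubic /cubicv !mxE.
- apply/rowP => i; rewrite [RHS]mxE [X in _ = _ * X]mxE; apply: (mulIf ck).
  by rewrite Rprop mulrAC divfK.
Qed.

Section Half.
Variables (F : subfld L) (delta : L).
Hypothesis K_F : forall x, K x -> F x.
Hypothesis n2 : 2%:R != 0 :> L.
Hypothesis K_delta : ~ K delta.
Hypothesis K_delta2 : K (delta ^+ 2).
Hypothesis F_span : forall x, F x -> exists u v, [/\ K u, K v & x = u + v * delta].
Variables (a : nat -> C) (xi : 'rV[L]_3).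
Hypothesis a_smooth : smooth_cubic a.
Hypothesis xi_cubic : cubicv (iota \o a) xi = 0.
Hypothesis xi_norm : exists i, xi 0 i = 1.
Hypothesis F_xi : forall i, F (xi 0 i).
Hypothesis xi_generic : forall N : normal_form a,
  nf_coord iota N xi 0 i0 != 0 /\ ~ range iota (nf_t iota N xi).

Let xi0 : xi != 0.
Proof.
have [k xk] := xi_norm; apply/eqP => h.
by have /eqP := xk; rewrite h mxE eq_sym oner_eq0.
Qed.

Lemma generic_not_in_plane_field : ~ forall i, K (xi 0 i).
Proof.
move=> Kxi; have [k [c [c0 ac E]]] := plane_points_constant a_smooth Kxi xi0 xi_cubic.
have [N _] := exists_normal_form a_smooth c0 ac; have [h1 h2] := xi_generic N.
exact: (nf_not_constant h1 h2 E).
Qed.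

(** The third point on the line through the generic point and its conjugate is fixed by conjugation,
    so it has coordinates in [K] and is constant; [V] is a second point of that line over [K]. *)
Lemma projection_from_constant : exists (r : 'rV[C]_3) (alpha beta : L) (V : 'rV[L]_3),
  [/\ r != 0, cubicv a r = 0, forall i, K (V 0 i)
    & xi = alpha *: map_mx iota r + beta *: V].
Proof.
have rep i : exists uv : L * L, [/\ K uv.1, K uv.2 & xi 0 i = uv.1 + uv.2 * delta].
  by have [u [v h]] := F_span (F_xi i); exists (u, v).
pose uv i := projT1 (cid (rep i)).
have uvP i : [/\ K (uv i).1, K (uv i).2 & xi 0 i = (uv i).1 + (uv i).2 * delta].
  exact: projT2 (cid (rep i)).
pose A : 'rV[L]_3 := \row_i (uv i).1; pose B : 'rV[L]_3 := \row_i (uv i).2.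
have KA i : K (A 0 i) by rewrite mxE; have [] := uvP i.
have KB i : K (B 0 i) by rewrite mxE; have [] := uvP i.
have xiE : xi = A + delta *: B.
  by apply/rowP => i; rewrite !mxE mulrC; have [] := uvP i.
have Ka i : K ((iota \o a) i) by exact: plane_constants.
have xiA := xi_cubic; rewrite xiE in xiA.
have [aB|[s Ks aR]] := cubic_conjugate_points Ka KA KB K_delta2 K_delta xiA.
  have B0 : B != 0.
    apply/eqP => h; apply: generic_not_in_plane_field => i.
    by rewrite xiE h scaler0 addr0.
  have [k [c [c0 ac E]]] := plane_points_constant a_smooth KB B0 aB.
  exists c, (delta * k), 1, A; split=> //.
  by rewrite xiE scale1r addrC E scalerA.
have KR i : K ((A - s *: B) 0 i).
  by rewrite [A]lock [B]lock !mxE -!lock; apply: sfB => //; exact: sfM.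
have xiR : xi = (A - s *: B) + (delta + s) *: B.
  by rewrite xiE scalerDl addrACA addrA addrAC addrK addrC.
(* A zero vector represents no point. Here it would make [xi] proportional to [B], a point over [K]
   and thus constant. *)
have R0 : A - s *: B != 0.
  apply/eqP => h; have xiB : xi = (delta + s) *: B by rewrite xiR h add0r.
  have ds : delta + s != 0.
    apply/eqP => /eqP; rewrite addr_eq0 => /eqP d; apply: K_delta.
    by rewrite d; exact: sfN.
  have B0 : B != 0 by apply: contraNneq xi0 => B0; rewrite xiB B0 scaler0.
  have aB : cubicv (iota \o a) B = 0.
    apply: (mulfI (expf_neq0 3 ds)).
    by rewrite mulr0 -cubicvZ -xiB.
  have [k [c [c0 ac E]]] := plane_points_constant a_smooth KB B0 aB.
  have [N _] := exists_normal_form a_smooth c0 ac; have [h1 h2] := xi_generic N.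
  by apply: (@nf_not_constant _ _ iota _ N xi h1 h2 ((delta + s) * k) c); rewrite xiB E scalerA.
have [k [c [c0 ac E]]] := plane_points_constant a_smooth KR R0 aR.
by exists c, k, (delta + s), B; split=> //; rewrite {1}xiR E.
Qed.

(** Seen from [r], the generic point and [V] have the same projection, so [t] is in [K] and so is
    [w ^+ 2]; but [w] is not, since [t] and [w] generate the coordinates. *)
Lemma kummer_coordinates : exists N : normal_form a,
  K (nf_t iota N xi) /\ exists2 v, K v /\ v != 0 & nf_w iota N xi = v * delta.
Proof.
have [r [al [be [V [r0 ar KV xiE]]]]] := projection_from_constant.
have [N Nr] := exists_normal_form a_smooth r0 ar; exists N.
have [rho0 tC] := xi_generic N.
pose W := V *m map_mx iota (invmx (nf_mx N)).
have KW i : K (W 0 i).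
  by rewrite mxE; apply: sf_sum => j _; apply: sfM => //; rewrite mxE; exact: plane_constants.
have rM : map_mx iota r *m map_mx iota (invmx (nf_mx N)) = map_mx iota (delta_mx 0 i2).
  by rewrite -map_mxM -Nr rowE mulmxK ?nf_unit.
have rhoE i : i != i2 -> nf_coord iota N xi 0 i = be * W 0 i.
  move=> ii; rewrite /nf_coord xiE mulmxDl -!scalemxAl rM -/W [W]lock !mxE -lock.
  by rewrite (negPf ii) andbF rmorph0 mulr0 add0r.
have Kt : K (nf_t iota N xi).
  have be0 : be != 0.
    by apply: contraNneq rho0 => h; rewrite rhoE // h mul0r.
  rewrite /nf_t !rhoE // -mulf_div divff // mul1r; exact: sf_div.
split=> //.
have FC c : F (iota c) by exact/K_F/plane_constants.
have [_ Fw] := nf_sub N FC F_xi.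
have Kw2 : K (nf_w iota N xi ^+ 2).
  rewrite (nf_w_square xi_cubic rho0) /quartic.
  by repeat first [exact: Kt|exact: plane_constants|exact: sf1|apply: sfX|apply: sfD
    |apply: sfM].
have nKw : ~ K (nf_w iota N xi).
  move=> Kw; apply: generic_not_in_plane_field.
  exact: (@nf_generators _ _ iota char0 _ N xi rho0 tC K plane_constants Kt Kw xi_norm).
have [u [v [Ku Kv wE]]] := F_span Fw.
have v0 : v != 0.
  by apply/eqP => v0; apply: nKw; rewrite wE v0 mul0r addr0.
exists v => //; rewrite wE; have [->|u0] := eqVneq u 0; first by rewrite add0r.
(* If [w = u + v delta] had [u] nonzero, the cross term of [w ^+ 2] would put [delta] in [K]. *)
case: K_delta; have -> : delta = ((nf_w iota N xi) ^+ 2 - u ^+ 2 - v ^+ 2 * delta ^+ 2)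
    / (2%:R * u * v).
  by rewrite wE; field; rewrite u0 v0 n2.
apply: sf_div; first by apply: sfB; [apply: sfB => //; exact: sfX|apply: sfM => //; exact: sfX].
by do 2?[apply: sfM => //]; exact: sf_nat.
Qed.

End Half.

Variables (a b : nat -> C) (xi eta : 'rV[L]_3).
Hypotheses (a_smooth : smooth_cubic a) (b_smooth : smooth_cubic b).
Hypothesis gp : generic_pair iota a b xi eta.
Variable F : subfld L.
Hypothesis F_coordinates : forall i, F (xi 0 i) /\ F (eta 0 i).
Hypothesis F_adj : forall z, F z -> adj iota (coordinates xi eta) z.
Hypothesis K_F : forall x, K x -> F x.
Hypothesis b_point : exists2 v : 'rV[C]_3, v != 0 & cubicv b v = 0.
Hypothesis a_point : exists2 v : 'rV[C]_3, v != 0 & cubicv a v = 0.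

Lemma plane_degree_ge3 e : extension_degree K F e -> (3 <= e)%N.
Proof.
have n2 : 2%:R != 0 :> L by rewrite -(rmorph_nat iota) fmorph_eq0 (char0 1).
move=> deg; rewrite leqNgt; apply/negP => e3.
have [v0 v00 av0] := a_point; have [w0 w00 bw0] := b_point.
have [M0 _] := exists_normal_form a_smooth v00 av0.
have [N0 _] := exists_normal_form b_smooth w00 bw0.
have gen1 (N : normal_form a) : nf_coord iota N xi 0 i0 != 0 /\ ~ range iota (nf_t iota N xi).
  by split; [exact: (@gp_coord1_neq0 _ _ _ _ _ _ _ gp N)|
    exact: (@gp_nonconstant1 _ _ _ _ _ _ _ gp N N0)].
have gen2 (N : normal_form b) : nf_coord iota N eta 0 i0 != 0 /\ ~ range iota (nf_t iota N eta).
  by split; [exact: (@gp_coord2_neq0 _ _ _ _ _ _ _ gp N)|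
    exact: (@gp_nonconstant2 _ _ _ _ _ _ _ gp M0 N)].
have [FK|[d [Fd nKd Kd span]]] := quadratic_extension n2 K_F deg e3.
  apply: (generic_not_in_plane_field a_smooth (gp_cubic1 gp) (gp_norm1 gp) gen1) => i.
  by apply: FK; case: (F_coordinates i).
have Fxi i : F (xi 0 i) by case: (F_coordinates i).
have Feta i : F (eta 0 i) by case: (F_coordinates i).
have [N [Kt [v [Kv nzv] wE]]] :=
  kummer_coordinates K_F n2 nKd Kd span a_smooth (gp_cubic1 gp) (gp_norm1 gp) Fxi gen1.
have [N' [Kt' [v' [Kv' nzv'] wE']]] :=
  kummer_coordinates K_F n2 nKd Kd span b_smooth (gp_cubic2 gp) (gp_norm2 gp) Feta gen2.
have d0 : d != 0 by apply: contra_not_neq nKd => ->; exact: sf0.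
have W := nf_w_square (gp_cubic1 gp) (gen1 N).1.
have W' := nf_w_square (gp_cubic2 gp) (gen2 N').1.
(* Both [w] and [w'] are multiples of the same [d] by elements of [K], so their ratio [v' / v] is in
   [K]. *)
apply: (no_kummer char0 K_forms phi_inj (c := v' / v)
  (disc_separable char0 (nf_smooth N) (nf_origin N))
  (disc_separable char0 (nf_smooth N') (nf_origin N')) Kt Kt').
- exact: sf_div.
- by rewrite mulf_neq0 ?invr_neq0.
- by rewrite -W wE expf_neq0 ?mulf_neq0.
- by rewrite -W' -W wE wE'; field.
- by move=> z /K_F/F_adj; exact: (@gp_algebraic _ _ _ char0 _ _ _ _ gp N N' z).
Qed.

End PlaneSubfield.

(** * Cubic extensions from inflexion points *)

Lemma quartic_taylor (R : comNzRingType) (e : nat -> R) (t s : R) :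
  quartic e 1 (t + s) = quartic e 1 t + quartic_dy e 1 t * s
    + (e 2 + 3%:R * e 3 * t + 6%:R * e 4 * t ^+ 2) * s ^+ 2
    + (e 3 + 4%:R * e 4 * t) * s ^+ 3 + e 4 * s ^+ 4.
Proof. by rewrite /quartic /quartic_dy; ring. Qed.

Lemma closed_root_coef (C : closedFieldType) (p : {poly C}) i :
  p`_i.+1 != 0 -> exists x, p.[x] = 0.
Proof.
move=> pi; have [|x /rootP] := closed_rootP p _; last by exists x.
by apply: contraNneq pi => sp; rewrite nth_default // sp.
Qed.

Lemma horner_poly5 (C : comNzRingType) (e : nat -> C) x :
  (\poly_(i < 5) e i).[x] = quartic e 1 x.
Proof. by rewrite horner_poly !big_ord_recr big_ord0 /= /quartic; ring. Qed.

Section Flex.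
Variables (C : closedFieldType) (e : nat -> C).
Hypothesis char0 : forall n, n.+1%:R != 0 :> C.
Hypothesis e_sep : separable_quartic e.

(** Without a finite zero the form would be a multiple of the fourth power of the first variable,
    which is not separable. By Euler's relation a zero of a separable form is simple. *)
Lemma quartic_root : exists t, quartic e 1 t = 0 /\ quartic_dy e 1 t != 0.
Proof.
have [t te] : exists t, quartic e 1 t = 0.
  have [i [i3 ei]] : exists i, (i < 4)%N /\ e i.+1 != 0.
    apply: contrapT => h.
    have e0 i : (i < 4)%N -> e i.+1 = 0.
      by move=> i4; apply/eqP; apply: contra_notT h => ei; exists i.
    have [||_ /eqP] := @e_sep 0 1; rewrite /quartic_dx /quartic_dy ?e0 ?oner_eq0 //; ring.
  have [|t] := @closed_root_coef C (\poly_(i < 5) e i) i; last first.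
    by rewrite horner_poly5; exists t.
  by rewrite coef_poly ltnS i3.
exists t; split=> //; apply/eqP => dy.
have [|//|/eqP] := e_sep (a := 1) (b := t); last by rewrite oner_eq0.
have : quartic_dx e 1 t + t * quartic_dy e 1 t = 4%:R * quartic e 1 t.
  by rewrite /quartic /quartic_dx /quartic_dy; ring.
by rewrite dy te !mulr0 addr0.
Qed.

(* The tangent [y = m (x - c) + n] at an inflexion point of the cubic meets it
   only there. *)
Lemma flex_tangent (al be ga : C) :
  (forall r, r ^+ 3 + al * r ^+ 2 + be * r + ga = 0 ->
    3%:R * r ^+ 2 + 2%:R * al * r + be = 0 -> False) ->
  exists c m n, n != 0 /\ forall (L : comNzRingType) (f : {rmorphism C -> L}) x,
    x ^+ 3 + f al * x ^+ 2 + f be * x + f ga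
    = (x - f c) ^+ 3 + (f m * (x - f c) + f n) ^+ 2.
Proof.
move=> sep.
(* These are the coefficients of the 3-division polynomial of the curve
   [y^2 = x^3 + al x^2 + be x + ga]; its zeros are the abscissas of the finite inflexion points. *)
pose q i := nth 0 [:: 4%:R * al * ga - be ^+ 2; 12%:R * ga; 6%:R * be; 4%:R * al; 3%:R] i.
have [|c] := @closed_root_coef C (\poly_(i < 5) q i) 3.
  by rewrite coef_poly; exact: char0.
rewrite horner_poly5 /quartic /q /= => cE.
pose h := c ^+ 3 + al * c ^+ 2 + be * c + ga.
pose h' := 3%:R * c ^+ 2 + 2%:R * al * c + be.
have flex : h' ^+ 2 = 4%:R * (3%:R * c + al) * h.
  by apply/eqP; rewrite -subr_eq0 -[X in _ == X]oppr0 -cE /h /h'; apply/eqP; ring.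
have [n nE] := @quadratic_root C 1 0 (- h) (oner_neq0 _).
have n2 : n ^+ 2 = h by apply/eqP; rewrite -subr_eq0 -[X in _ == X]nE; apply/eqP; ring.
have n0 : n != 0.
  apply/eqP => n0; have h0 : h = 0 by rewrite -n2 n0; ring.
  apply: (sep c h0); apply/eqP; move/eqP: flex.
  by rewrite h0 mulr0 -/h' sqrf_eq0.
have two : 2%:R != 0 :> C := char0 1.
(* The slope of the tangent at the point (c, n), from differentiating [y ^+ 2]. *)
exists c, (h' / (2%:R * n)), n; split=> // L f x; set m := h' / _.
have mn : 2%:R * m * n = h' by rewrite /m; field; rewrite n0 two.
have mm : m ^+ 2 = 3%:R * c + al.
  apply: (mulfI (expf_neq0 2 (mulf_neq0 two n0))); rewrite -exprMn.
  have -> : 2%:R * n * m = h' by rewrite -mn; ring.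
  by rewrite flex exprMn n2; ring.
clearbody m.
have {}mm : f m ^+ 2 = 3%:R * f c + f al by rewrite -rmorphXn mm rmorphD rmorphM rmorph_nat.
have {}mn : 2%:R * f m * f n = 3%:R * f c ^+ 2 + 2%:R * f al * f c + f be.
  have := congr1 f mn; rewrite /h' !(rmorph_nat, rmorphXn, rmorphD, rmorphM).
  by move=> ->.
have {}n2 : f n ^+ 2 = f c ^+ 3 + f al * f c ^+ 2 + f be * f c + f ga.
  by rewrite -rmorphXn n2 /h !(rmorphD, rmorphXn, rmorphM).
rewrite sqrrD exprMn mm n2 -[RHS]addr0.
have -> : f m * (x - f c) * f n *+ 2 = (2%:R * f m * f n) * (x - f c).
  by rewrite -mulr_natl; ring.
rewrite mn; ring.
Qed.

Section Inflexion.
Variables (L : fieldType) (iota : {rmorphism C -> L}) (t w : L).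
Hypothesis tC : ~ range iota t.
Hypothesis wt : w ^+ 2 = quartic (iota \o e) 1 t.

(** Sending a simple root [t0] to infinity by [x = d1 / (t - t0)], [y = w x^2 / d1] turns the
    quartic into a monic cubic, to which [flex_tangent] applies. The equivalences hold for every [F]
    because the change of coordinates is invertible over the constants. *)
Lemma inflexion_coordinates : exists (m n : C) (X Y : L),
  [/\ n != 0, Y ^+ 2 = X ^+ 3 + (iota m * X + iota n) ^+ 2 &
    forall F : subfld L, (forall c, F (iota c)) ->
      (F t <-> F X) /\ (F t /\ F w <-> F X /\ F Y)].
Proof.
have [t0 [t0e d0]] := quartic_root.
pose d1 := quartic_dy e 1 t0; pose d2 := e 2 + 3%:R * e 3 * t0 + 6%:R * e 4 * t0 ^+ 2.
pose d3 := e 3 + 4%:R * e 4 * t0; pose d4 := e 4.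
have [|c [m [n [n0 flex]]]] := @flex_tangent d2 (d3 * d1) (d4 * d1 ^+ 2).
  move=> r h h'.
  (* A multiple root [r] of the cubic would give a multiple zero (r : t0 r + d1) of the separable
     quartic. *)
  have dy0 : quartic_dy e r (t0 * r + d1) = 0.
    apply: (mulfI d0); rewrite mulr0 -/d1.
    transitivity (d1 ^+ 2 * (4%:R * (r ^+ 3 + d2 * r ^+ 2 + d3 * d1 * r + d4 * d1 ^+ 2)
      - r * (3%:R * r ^+ 2 + 2%:R * d2 * r + d3 * d1))); last by rewrite h h'; ring.
    have -> z : quartic_dy e r (t0 * r + z) = d1 * r ^+ 3 + 2%:R * d2 * r ^+ 2 * z
        + 3%:R * d3 * r * z ^+ 2 + 4%:R * d4 * z ^+ 3.
      by rewrite /d1 /d2 /d3 /d4 /quartic_dy; ring.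
    by ring.
  have dx0 : quartic_dx e r (t0 * r + d1) = 0.
    have : quartic_dx e r (t0 * r + d1) + t0 * quartic_dy e r (t0 * r + d1) =
       4%:R * quartic e 1 t0 * r ^+ 3
       + d1 ^+ 2 * (3%:R * r ^+ 2 + 2%:R * d2 * r + d3 * d1).
      have -> z : quartic_dx e r (t0 * r + z) + t0 * quartic_dy e r (t0 * r + z) =
         4%:R * quartic e 1 t0 * r ^+ 3 + 3%:R * d1 * r ^+ 2 * z
         + 2%:R * d2 * r * z ^+ 2 + d3 * z ^+ 3.
        by rewrite /d1 /d2 /d3 /d4 /quartic_dx /quartic_dy /quartic; ring.
      by ring.
    by rewrite dy0 t0e h' !mulr0 mul0r !addr0.
  have [r0 /eqP] := e_sep dx0 dy0.
  by rewrite r0 mulr0 add0r -/d1 (negPf d0).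
have d1L : iota d1 != 0 by rewrite fmorph_eq0.
pose s := t - iota t0; have s0 : s != 0.
  by apply/eqP => /eqP; rewrite subr_eq0 => /eqP h; apply: tC; exists t0.
pose x := iota d1 / s; have x0 : x != 0 by rewrite mulf_neq0 ?invr_neq0.
exists m, n, (x - iota c), (w * x ^+ 2 / iota d1); split=> //.
  rewrite -flex exprMn exprMn wt.
  have -> : t = iota t0 + s by rewrite addrC subrK.
  rewrite quartic_taylor.
  have -> : quartic (iota \o e) 1 (iota t0) = 0.
    by rewrite -(rmorph1 iota) -rmorph_quartic t0e rmorph0.
  have -> : quartic_dy (iota \o e) 1 (iota t0) = iota d1.
    by rewrite -(rmorph1 iota) -rmorph_quartic_dy.
  have -> : (iota \o e) 2 + 3%:R * (iota \o e) 3 * iota t0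
      + 6%:R * (iota \o e) 4 * iota t0 ^+ 2 = iota d2.
    by rewrite /d2 !(rmorphD, rmorphM, rmorph_nat, rmorphXn).
  have -> : (iota \o e) 3 + 4%:R * (iota \o e) 4 * iota t0 = iota d3.
    by rewrite /d3 !(rmorphD, rmorphM, rmorph_nat).
  rewrite -[(iota \o e) 4]/(iota d4) !rmorphM /x.
  move: (iota d1) (iota d2) (iota d3) (iota d4) d1L s0 => a1 a2 a3 a4 a10 s0.
  by field; rewrite a10 s0.
move=> F FC.
have Fx : F t <-> F (x - iota c).
  split=> [Ft|FX]; first by apply: sfB => //; apply: sf_div => //; exact: sfB.
  have -> : t = iota t0 + iota d1 / ((x - iota c) + iota c).
    by rewrite subrK /x invf_div mulrCA divff // mulr1 addrC subrK.
  by apply: sfD => //; apply: sf_div => //; exact: sfD.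
split=> //; split=> [[Ft Fw]|[FX FY]].
  split; first exact/Fx.
  have Fxx : F x by rewrite -[x](subrK (iota c)); apply: sfD => //; exact/Fx.
  by apply: sf_div => //; apply: sfM => //; exact: sfX.
split; first exact/Fx.
have Fxx : F x by rewrite -[x](subrK (iota c)); exact: sfD.
have -> : w = (w * x ^+ 2 / iota d1) * iota d1 / x ^+ 2.
  by rewrite divfK // mulfK // expf_neq0.
by apply: sf_div; [exact: sfM|exact: sfX].
Qed.

End Inflexion.
End Flex.

(** The powers of [x] below the degree of an annihilator of least size form a basis. As [p] may be
    reducible, only a bound for the degree results. *)
Lemma simple_extension_degree (L : fieldType) (K F : subfld L) (x : L) (p : {poly L}) :
  (forall z, K z -> F z) -> F x -> p != 0 -> (forall i, K p`_i) -> root p x ->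
  (forall z, F z -> gen (K `|` [set x]) z) ->
  exists2 d, (d < size p)%N & extension_degree K F d.
Proof.
move=> KF Fx p0 Kp px Fgen.
pose val_poly (q : {poly sf_type K}) := map_poly (@sf_val L K) q.
pose P n := `[< exists q : {poly sf_type K}, [/\ q != 0, size q = n & root (val_poly q) x] >].
have Pp : exists n, P n.
  have [q qE] := sf_map_poly Kp; exists (size q); apply/asboolP; exists q.
  by rewrite -(map_poly_eq0 (@sf_val L K)) /val_poly qE.
case: (ex_minnP Pp) => n /asboolP[q [q0 qn qx]] n_min.
have np : (n <= size p)%N.
  have [q' qE] := sf_map_poly Kp; apply: n_min; apply/asboolP; exists q'.
  by rewrite -(map_poly_eq0 (@sf_val L K)) /val_poly qE -(size_map_poly (@sf_val L K)) qE.
have n0 : (0 < n)%N by rewrite -qn lt0n size_poly_eq0.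
exists n.-1; first by rewrite prednK.
have eval (r : {poly sf_type K}) : (size r <= n.-1)%N ->
    (val_poly r).[x] = \sum_(i < n.-1) sf_val r`_i * x ^+ i.
  move=> rn; rewrite (horner_coef_wide _ (_ : (size (val_poly r) <= n.-1)%N)) ?size_map_poly //.
  by apply: eq_bigr => i _; rewrite coef_map.
exists (fun i => x ^+ i); split=> [i|z Fz]; first exact: sfX.
have [r Kr ->] := gen_alg_poly (ex_intro _ p (And3 p0 Kp px)) (Fgen z Fz).
have [r' rE] := sf_map_poly Kr; pose s : {poly sf_type K} := r' %% q.
have sn : (size s <= n.-1)%N by rewrite -ltnS prednK // -qn ltn_modp.
have rs : r.[x] = (val_poly s).[x].
  rewrite -rE {1}(divp_eq r' q) rmorphD rmorphM hornerD hornerM.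
  by rewrite (rootP qx) mulr0 add0r.
exists [ffun i : 'I_n.-1 => sf_val s`_i]; split=> [|c [Kc cE]].
  split=> [i|]; first by rewrite ffunE; exact: sf_valP.
  by rewrite rs eval //; apply: eq_bigr => i _; rewrite ffunE.
have [u uE] : exists u : 'I_n.-1 -> sf_type K, forall i, sf_val (u i) = c i.
  by exists (fun i => projT1 (sf_valE (Kc i))) => i; exact: (projT2 (sf_valE (Kc i))).
pose v : {poly sf_type K} := \poly_(i < n.-1) (if insub i is Some j then u j else 0).
have vE (i : 'I_n.-1) : v`_i = u i by rewrite coef_poly ltn_ord valK.
have vs : (size (s - v)%R <= n.-1)%N.
  by rewrite (leq_trans (size_polyD _ _)) // geq_max sn size_polyN size_poly.
(* A nonzero difference of two expressions for [z] would annihilate [x] with a size below the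
   minimum. *)
have sv0 : s - v = 0.
  apply/eqP; apply: contraTT isT => sv; move: vs; rewrite leqNgt => /negP[].
  rewrite prednK //; apply: n_min; apply/asboolP; exists (s - v); split=> //.
  rewrite /root /val_poly rmorphB hornerD hornerN -/(val_poly s) -/(val_poly v).
  rewrite -rs (eval v) ?size_poly // cE subr_eq0; apply/eqP; apply: eq_bigr => i _.
  by rewrite vE uE.
apply/ffunP => i; rewrite ffunE -uE -vE.
by move/eqP: sv0; rewrite subr_eq0 => /eqP ->.
Qed.

(** * The upper bound: a cubic extension of a plane field *)

Section UpperBound.
Variables (C : closedFieldType) (L : fieldType) (iota : {rmorphism C -> L}).
Hypothesis char0 : forall n, n.+1%:R != 0 :> C.
Variables (m n m' n' : C) (X Y U V : L).
Hypothesis n0 : n != 0.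
Hypothesis XY : Y ^+ 2 = X ^+ 3 + (iota m * X + iota n) ^+ 2.
Hypothesis UV : V ^+ 2 = U ^+ 3 + (iota m' * U + iota n') ^+ 2.
Hypothesis X_nonconstant : ~ range iota X.
Hypothesis U_transcendental : ~ algcl (adj iota [set X]) U.

Let A := Y - (iota m * X + iota n).
Let A' := V - (iota m' * U + iota n').
Let lam := U / X.
Let mu := A' / A.
Let K := adj iota [set lam; mu].
Let F := adj iota [set x | [\/ x = X, x = Y, x = U | x = V]].

Let AB : A * (A + 2%:R * (iota m * X + iota n)) = X ^+ 3.
Proof.
by transitivity (Y ^+ 2 - (iota m * X + iota n) ^+ 2); [rewrite /A; ring|rewrite XY addrK].
Qed.

Let AB' : A' * (A' + 2%:R * (iota m' * U + iota n')) = U ^+ 3.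
Proof.
by transitivity (V ^+ 2 - (iota m' * U + iota n') ^+ 2); [rewrite /A'; ring|rewrite UV addrK].
Qed.

Let X0 : X != 0.
Proof. by apply/eqP => h; apply: X_nonconstant; exists 0; rewrite ?rmorph0. Qed.

Let U0 : U != 0.
Proof. by apply/eqP => h; apply: U_transcendental; rewrite h; exact: sf0. Qed.

Let A0 : A != 0.
Proof.
apply/eqP => h; move/eqP: AB; rewrite h mul0r eq_sym expf_eq0.
by rewrite (negPf X0) andbF.
Qed.

Let A'0 : A' != 0.
Proof.
apply/eqP => h; move/eqP: AB'; rewrite h mul0r eq_sym expf_eq0.
by rewrite (negPf U0) andbF.
Qed.

Let mu0 : mu != 0. Proof. by rewrite mulf_neq0 ?invr_neq0. Qed.
Let UE : U = lam * X. Proof. by rewrite /lam divfK. Qed.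
Let A'E : A' = mu * A. Proof. by rewrite /mu divfK. Qed.

(** With [B] and [B'] for the tangent lines, the curve equations give
    [mu A (mu A + 2 B') = lam^3 A (A + 2 B)]. Dividing by [mu A] leaves an equation of degree one in
    [A]. *)
Let linear : (lam ^+ 3 / mu - mu) * A
  = 2%:R * (iota m' * U + iota n') - 2%:R * (lam ^+ 3 / mu) * (iota m * X + iota n).
Proof.
have := AB'; rewrite A'E {2}UE exprMn -AB => h.
have {}h : mu * A + 2%:R * (iota m' * U + iota n')
    = lam ^+ 3 / mu * (A + 2%:R * (iota m * X + iota n)).
  have swap (a l B u : L) : u != 0 -> l ^+ 3 * (a * B) = u * a * (l ^+ 3 / u * B).
    by move=> u0; field.
  by apply: (mulfI (mulf_neq0 mu0 A0)); rewrite h; exact: swap.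
transitivity (lam ^+ 3 / mu * (A + 2%:R * (iota m * X + iota n)) - mu * A
   - 2%:R * (lam ^+ 3 / mu) * (iota m * X + iota n)); first by ring.
by rewrite -h; ring.
Qed.

(** If the coefficient of [A] vanished, then [lam^3 = mu^2] and the two tangent lines would have
    ratio [mu], so [U^3 (m X + n)^2 = X^3 (m' U + n')^2]. This makes [U] algebraic over [X]: the
    leading coefficient is nonzero because [n] is. *)
Let lam_mu : lam ^+ 3 / mu - mu != 0.
Proof.
apply/eqP => h; apply: U_transcendental.
have lm : lam ^+ 3 / mu = mu by apply/eqP; rewrite -subr_eq0 h.
have l3 : lam ^+ 3 = mu ^+ 2 by rewrite expr2 -{1}lm divfK.
have n2 : 2%:R != 0 :> L by rewrite -(rmorph_nat iota) fmorph_eq0 (char0 1).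
have E : iota m' * U + iota n' = mu * (iota m * X + iota n).
  apply: (mulfI n2); apply/eqP; rewrite -subr_eq0 mulrA; apply/eqP.
  by have := linear; rewrite h mul0r lm.
have cub : U ^+ 3 * (iota m * X + iota n) ^+ 2 = X ^+ 3 * (iota m' * U + iota n') ^+ 2.
  by rewrite E {1}UE exprMn l3; ring.
have lin0 : iota m * X + iota n != 0.
  apply/eqP => mX; have [m0|m0] := eqVneq m 0.
    by move/eqP: mX; rewrite m0 rmorph0 mul0r add0r fmorph_eq0 (negPf n0).
  apply: X_nonconstant; exists (- n / m) => //; rewrite fmorph_div rmorphN.
  have m0' : iota m != 0 by rewrite fmorph_eq0.
  by apply: (mulfI m0'); rewrite mulrC divfK //; apply/eqP; rewrite eq_sym -addr_eq0 mX.
pose Fx := adj iota [set X].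
have FX : Fx X by exact: adj_sub.
have FC c : Fx (iota c) by exact: adj_iota.
pose c3 := (iota m * X + iota n) ^+ 2.
pose e i := nth 0 [:: - (X ^+ 3 * iota n' ^+ 2); - (X ^+ 3 * (2%:R * iota m' * iota n'));
  - (X ^+ 3 * iota m' ^+ 2); c3] i.
have Fc i : Fx (e i).
  have F2 : Fx 2%:R := sf_nat _ 2.
  case: i => [|[|[|[|i]]]]; rewrite /e [nth _ _ _]/=.
  - by apply: sfN; apply: sfM; exact: sfX.
  - by apply: sfN; apply: sfM; [exact: sfX|apply: sfM => //; exact: sfM].
  - by apply: sfN; apply: sfM; exact: sfX.
  - by apply: sfX; apply: sfD => //; exact: sfM.
  - by rewrite nth_nil; exact: sf0.
exists (\poly_(i < 4) e i); split=> [|i|].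
- apply/eqP => /(congr1 (coefp 3)); rewrite /= coef_poly coef0 /=; apply/eqP.
  exact: expf_neq0.
- by rewrite coef_poly; case: ifP => // _; exact: sf0.
- apply/rootP; rewrite horner_poly !big_ord_recr big_ord0 /= /e /= /c3.
  transitivity (U ^+ 3 * (iota m * X + iota n) ^+ 2 - X ^+ 3 * (iota m' * U + iota n') ^+ 2).
    by ring.
  by rewrite cub subrr.
Qed.

Let FX : F X. Proof. by apply: adj_sub; constructor 1. Qed.
Let FY : F Y. Proof. by apply: adj_sub; constructor 2. Qed.
Let FU : F U. Proof. by apply: adj_sub; constructor 3. Qed.
Let FV : F V. Proof. by apply: adj_sub; constructor 4. Qed.

Let FA : F A.
Proof. by apply: sfB => //; apply: sfD; [apply: sfM => //|]; exact: adj_iota. Qed.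
Let FA' : F A'.
Proof. by apply: sfB => //; apply: sfD; [apply: sfM => //|]; exact: adj_iota. Qed.

Let Kl : K lam. Proof. by apply: adj_sub; left. Qed.
Let Km : K mu. Proof. by apply: adj_sub; right. Qed.

Lemma cubic_over_plane : exists (l u : L), let K := adj iota [set l; u] in
  [/\ F l, F u, ~ range iota l, ~ algcl (adj iota [set l]) u &
   exists2 d, (d <= 3)%N & extension_degree K F d].
Proof.
exists lam, mu; have Fl : F lam by exact: sf_div.
have Fm : F mu by exact: sf_div.
pose D := lam ^+ 3 / mu - mu.
have KD : K D by apply: sfB => //; apply: sf_div => //; exact: sfX.
have Klm : K (lam ^+ 3 / mu) by apply: sf_div => //; exact: sfX.
have KC c : K (iota c) by exact: adj_iota.
have K2 : K 2%:R := sf_nat _ 2.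
pose P := (2%:R * (iota m' * lam) - 2%:R * (lam ^+ 3 / mu) * iota m) / D.
pose Q := (2%:R * iota n' - 2%:R * (lam ^+ 3 / mu) * iota n) / D.
have KP : K P.
  by apply: sf_div => //; apply: sfB; apply: sfM => //; exact: sfM.
have KQ : K Q.
  by apply: sf_div => //; apply: sfB; apply: sfM => //; exact: sfM.
have AE : A = P * X + Q.
  have DP : D * P = 2%:R * (iota m' * lam) - 2%:R * (lam ^+ 3 / mu) * iota m.
    by rewrite mulrC divfK.
  have DQ : D * Q = 2%:R * iota n' - 2%:R * (lam ^+ 3 / mu) * iota n.
    by rewrite mulrC divfK.
  apply: (mulfI lam_mu); rewrite linear UE -/D [RHS]mulrDr [D * (P * X)]mulrA DP DQ.
  by ring.
(* The factors are [A] and [A + 2 (m X + n)] written as affine functions of [X] over [K], so [p]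
   encodes that their product is [X ^+ 3]. *)
pose lp : {poly L} := P%:P * 'X + Q%:P.
pose lq : {poly L} := (P + 2%:R * iota m)%:P * 'X + (Q + 2%:R * iota n)%:P.
pose p := 'X^3 - lp * lq.
have lin_size (c d : L) : (size (c%:P * 'X + d%:P)%R <= 2)%N.
  rewrite (leq_trans (size_polyD _ _)) // geq_max (leq_trans (size_polyC_leq1 _)) // andbT.
  by rewrite mul_polyC (leq_trans (size_scale_leq _ _)) // size_polyX.
have lpq : (size (lp * lq)%R <= 3)%N.
  rewrite (leq_trans (size_polyMleq _ _)) //.
  have : (size lp + size lq <= 4)%N by exact: leq_add (lin_size _ _) (lin_size _ _).
  by case: (size lp + size lq)%N.
have ps : size p = 4 by rewrite /p size_polyDl ?size_polyXn // size_polyN ltnS.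
have p0 : p != 0 by rewrite -size_poly_eq0 ps.
have Kpoly_lin c d : K c -> K d -> forall i, K (c%:P * 'X + d%:P)`_i.
  move=> Kc Kd i; rewrite coefD mul_polyC coefZ coefX coefC.
  apply: sfD; first by apply: sfM => //; case: eqP => _; [exact: sf1|exact: sf0].
  by case: ifP => _ //; exact: sf0.
have Kp i : K p`_i.
  rewrite coefB coefXn coefM; apply: sfB; first by case: eqP => _; [exact: sf1|exact: sf0].
  apply: sf_sum => j _; apply: sfM; apply: Kpoly_lin => //.
    by apply: sfD => //; exact: sfM.
  by apply: sfD => //; exact: sfM.
have px : root p X.
  apply/rootP; rewrite /p hornerD hornerXn hornerN hornerM !hornerD !hornerM !hornerC !hornerX.
  rewrite -AE -AB; have -> : (P + 2%:R * iota m) * X + (Q + 2%:R * iota n)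
    = A + 2%:R * (iota m * X + iota n) by rewrite AE; ring.
  by rewrite subrr.
have KX : algcl K X by exists p.
have KF z : K z -> F z.
  by apply: adj_le => [c|_ [->|->]] //; exact: adj_iota.
have FKX z : F z -> gen (K `|` [set X]) z.
  pose G := gen (K `|` [set X]).
  have GK y : K y -> G y by move=> Ky; apply: sub_gen; left.
  have GX : G X by apply: sub_gen; right.
  have GU : G U by rewrite UE; apply: sfM => //; exact: GK.
  have GA : G A by rewrite AE; apply: sfD; [apply: sfM => //|]; exact: GK.
  have GA' : G A' by rewrite A'E; apply: sfM => //; exact: GK.
  apply: adj_le => [c|_ [->|->|->|->]] //; first exact/GK.
    rewrite -[Y](subrK (iota m * X + iota n)); apply: sfD => //.
    by apply: sfD; [apply: sfM => //|]; exact: GK.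
  rewrite -[V](subrK (iota m' * U + iota n')); apply: sfD => //.
  by apply: sfD; [apply: sfM => //|]; exact: GK.
have KU : algcl K U by rewrite UE; apply: sfM => //; exact: algOver_id.
have [lC ml] := generators_independent X_nonconstant U_transcendental KX KU.
split=> //; have [d dp deg] := simple_extension_degree KF FX p0 Kp px FKX.
by exists d => //; move: dp; rewrite ps ltnS.
Qed.

End UpperBound.

Section GenericPairFibration.
Variables (C : closedFieldType) (L : fieldType) (iota : {rmorphism C -> L}).
Hypothesis char0 : forall n, n.+1%:R != 0 :> C.
Variables (a b : nat -> C) (xi eta : 'rV[L]_3).
Hypothesis gp : generic_pair iota a b xi eta.
Variables (N : normal_form a) (N' : normal_form b).
Local Notation F := (adj iota (coordinates xi eta)).

Lemma generic_pair_cubic : exists l u, let K := adj iota [set l; u] in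
  [/\ F l, F u, ~ range iota l, ~ algcl (adj iota [set l]) u &
   exists2 d, (d <= 3)%N & extension_degree K F d].
Proof.
pose t := nf_t iota N xi; pose t' := nf_t iota N' eta.
have tC : ~ range iota t := @gp_nonconstant1 _ _ _ _ _ _ _ gp N N'.
have t'C : ~ range iota t' := @gp_nonconstant2 _ _ _ _ _ _ _ gp N N'.
have tt' : ~ algcl (adj iota [set t]) t' := @gp_transcendental2 _ _ _ _ _ _ _ gp N N'.
have r0 := gp_coord1_neq0 gp N; have r0' := gp_coord2_neq0 gp N'.
have [m [n [X [Y [n0 XY XP]]]]] := inflexion_coordinates char0
  (disc_separable char0 (nf_smooth N) (nf_origin N)) tC (nf_w_square (gp_cubic1 gp) r0).
have [m' [n' [U [V [n'0 UV UP]]]]] := inflexion_coordinates char0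
  (disc_separable char0 (nf_smooth N') (nf_origin N')) t'C (nf_w_square (gp_cubic2 gp) r0').
have XC : ~ range iota X.
  (* Applied to the field of constants, the equivalence says that [t] is constant exactly when [X]
     is. *)
  move=> h; apply: tC; have [tX _] := XP (constants iota) (fun c => ex_intro2 _ _ c I erefl).
  exact/tX.
have Ut : ~ algcl (adj iota [set X]) U.
  move=> h; apply: tt'.
  have tE : adj iota [set t] t by exact: adj_sub.
  have tFC c : adj iota [set t] (iota c) by exact: adj_iota.
  have [[/(_ tE) tX _] _] := XP _ tFC.
  have FC c : algcl (adj iota [set t]) (iota c) by apply: algOver_id; exact: adj_iota.
  have [tU _] := UP _ FC; apply/tU; apply: (algcl_adj _ _ h) => [c|_ ->].
    exact: adj_iota.
  exact: algOver_id.
have [l [u [Gl Gu lC ul [d d3 deg]]]] := cubic_over_plane char0 n0 XY UV XC Ut.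
set G := adj iota [set x | _] in Gl Gu deg.
(* The inflexion coordinates generate the same field as the projective ones, through [t], [w] and
   [t'], [w']. *)
have FE : (F : set L) = G.
  have FC c : F (iota c) by exact: adj_iota.
  have GC c : G (iota c) by exact: adj_iota.
  have Fxi i : F (xi 0 i) by apply: adj_sub; exists i; left.
  have Feta i : F (eta 0 i) by apply: adj_sub; exists i; right.
  apply/seteqP; split.
    have GX : G X by apply: adj_sub; constructor 1.
    have GY : G Y by apply: adj_sub; constructor 2.
    have GU : G U by apply: adj_sub; constructor 3.
    have GV : G V by apply: adj_sub; constructor 4.
    have [_ [_ /(_ (conj GX GY))[Gt Gw]]] := XP G GC.
    have [_ [_ /(_ (conj GU GV))[Gt' Gw']]] := UP G GC.
    apply: adj_le => // z [i [->|->]].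
      exact: (@nf_generators _ _ iota char0 _ N xi r0 tC G GC Gt Gw (gp_norm1 gp)).
    exact: (@nf_generators _ _ iota char0 _ N' eta r0' t'C G GC Gt' Gw' (gp_norm2 gp)).
  have [_ [/(_ (nf_sub N FC Fxi))[FX FY] _]] := XP F FC.
  have [_ [/(_ (nf_sub N' FC Feta))[FU FV] _]] := UP F FC.
  by apply: adj_le => // z [->|->|->|->].
by exists l, u; rewrite FE; split=> //; exists d.
Qed.

End GenericPairFibration.

(** * Function fields of Segre products *)

Section FormsField.
Variables (C : fieldType) (n : nat) (L : fieldType) (ev : {rmorphism {mpoly C[n]} -> L}).

(** The function field, the pullback field and the field of a plane all have this shape, for
    different evaluations [ev]. *)
Definition forms_set : set L := [set u | exists (d : nat) (a b : {mpoly C[n]}),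
  [/\ a \is d.-homog, b \is d.-homog, ev b != 0 & u = ev a / ev b]].

Fact forms_closed : [/\ forms_set 1,
  forall x y, forms_set x -> forms_set y -> forms_set (x - y)
  & forall x y, forms_set x -> forms_set y -> forms_set (x / y)].
Proof.
have F0 : forms_set 0.
  exists 0%N, 0, 1; rewrite dhomog0 dhomog1 rmorph1 rmorph0 mul0r oner_neq0.
  by split.
split.
- by exists 0%N, 1, 1; rewrite dhomog1 rmorph1 divr1 oner_neq0; split.
- move=> _ _ [d [a [b [ad bd b0 ->]]]] [d' [a' [b' [ad' bd' b'0 ->]]]].
  exists (d + d')%N, (a * b' - a' * b), (b * b'); split.
  + by apply: rpredB; [exact: dhomogM|rewrite addnC; exact: dhomogM].
  + exact: dhomogM.
  + by rewrite rmorphM mulf_neq0.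
  + rewrite rmorphB !rmorphM; move: (ev a) (ev b) (ev a') (ev b') b0 b'0 => p q r s q0 s0.
    by field; rewrite q0 s0.
- move=> _ _ [d [a [b [ad bd b0 ->]]]] [d' [a' [b' [ad' bd' b'0 ->]]]].
  have [->|a'0] := eqVneq (ev a') 0; first by rewrite mul0r invr0 mulr0.
  exists (d + d')%N, (a * b'), (b * a'); split; [exact: dhomogM|exact: dhomogM| |].
    by rewrite rmorphM mulf_neq0.
  rewrite !rmorphM; move: (ev a) (ev b) (ev a') (ev b') b0 b'0 a'0 => p q r s q0 s0 r0.
  by field; rewrite q0 s0 r0.
Qed.
Definition forms_field : subfld L := Subfld forms_closed.

Lemma forms_field_ratio i j : ev 'X_j != 0 -> forms_field (ev 'X_i / ev 'X_j).
Proof. by move=> j0; exists 1%N, 'X_i, 'X_j; rewrite !dhomogX /= !mdeg1. Qed.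

Lemma forms_field_const c : forms_field (ev c%:MP).
Proof.
exists 0%N, c%:MP, 1; rewrite dhomog1 rmorph1 divr1 oner_neq0.
by split=> //; exact: dhomog_mpolyC.
Qed.

End FormsField.

Lemma sf_mmap (C L : fieldType) (iota : {rmorphism C -> L}) n (h : 'I_n -> L)
    (F : subfld L) (p : {mpoly C[n]}) :
  (forall c, F (iota c)) -> (forall i, F (h i)) -> F (mmap iota h p).
Proof.
move=> FC Fh; apply: sf_sum => m _; apply: sfM => //.
by apply: sf_prod => i _; exact: sfX.
Qed.

Lemma mmap_ratio (C L : fieldType) (iota : {rmorphism C -> L}) n d (h g : 'I_n -> L) z
    (p q : {mpoly C[n]}) : p \is d.-homog -> q \is d.-homog -> z != 0 ->
  (forall i, h i = z * g i) ->
  mmap iota h p / mmap iota h q = mmap iota g p / mmap iota g q.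
Proof.
move=> pd qd z0 hE; rewrite (mmap_eq iota p hE) (mmap_eq iota q hE).
have E r : r \is d.-homog -> mmap iota (fun i => z * g i) r = z ^+ d * mmap iota g r.
  by move=> rd; exact: mmap_homogZ.
by rewrite (E p) // (E q) // -mulf_div divff ?mul1r // expf_neq0.
Qed.

(** * Specialisation of rational functions at closed points *)

Section ConeSpecialization.
Variables (C : closedFieldType) (n : nat) (L : fieldType) (cls : {rmorphism {mpoly C[n]} -> L}).
Variable X : set 'rV[C]_n.
Hypothesis cls_eq0 : forall p, cls p = 0 <-> forall z, X z -> p.@[z 0] = 0.
Definition cls_const : {rmorphism C -> L} := cls \o @mpolyC n C.
Local Notation iota := cls_const.

Lemma cls_mmap p : cls p = mmap iota (fun i => cls 'X_i) p.
Proof.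
have := @rmorph_mpoly_eq n C L cls (mmap iota (fun i => cls 'X_i)).
by apply=> [c|i]; [rewrite /= mmapC|rewrite /= mmapXU].
Qed.

Lemma cls_neq0 p z : X z -> p.@[z 0] != 0 -> cls p != 0.
Proof. by move=> Xz; apply: contraNneq => /cls_eq0/(_ z Xz) ->. Qed.

Lemma cls_eq p q : (forall z, X z -> p.@[z 0] = q.@[z 0]) -> cls p = cls q.
Proof.
move=> pq; apply/eqP; rewrite -subr_eq0 -rmorphB; apply/eqP/cls_eq0 => z Xz.
by rewrite mevalB pq // subrr.
Qed.

Lemma specialization m (z : 'rV[C]_n) (p q : 'I_m -> {mpoly C[n]}) (F : {mpoly C[m]}) :
  X z -> (forall i, (q i).@[z 0] != 0) ->
  mmap iota (fun i => cls (p i) / cls (q i)) F = 0 ->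
  F.@[fun i => (p i).@[z 0] / (q i).@[z 0]] = 0.
Proof.
move=> Xz q0; set h := fun i => cls _ / _; set h' := fun i => _ / _.
(* The relation says that [u] is regular at [z] with value [c]; it is compatible with sums and
   products, so a polynomial in such functions takes the expected value. *)
pose spec u c := exists a b, [/\ b.@[z 0] != 0, u = cls a / cls b & c = a.@[z 0] / b.@[z 0]].
have specD u c v d : spec u c -> spec v d -> spec (u + v) (c + d).
  move=> [a [b [b0 -> ->]]] [a' [b' [b'0 -> ->]]].
  have cb := cls_neq0 Xz b0; have cb' := cls_neq0 Xz b'0.
  exists (a * b' + a' * b), (b * b'); rewrite mevalM mulf_neq0 //.
  by rewrite rmorphD !rmorphM mevalD !mevalM !addf_div.
have specM u c v d : spec u c -> spec v d -> spec (u * v) (c * d).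
  move=> [a [b [b0 -> ->]]] [a' [b' [b'0 -> ->]]].
  by exists (a * a'), (b * b'); rewrite mevalM mulf_neq0 // !rmorphM !mulf_div.
have specF : spec (mmap iota h F) F.@[h'].
  elim/mpoly_ring_ind: F => [c|i|f g|f g].
  - exists c%:MP, 1; rewrite mmapC ?mevalC ?meval1 rmorph1 !divr1 ?mevalC oner_neq0.
    by split.
  - by exists (p i), (q i); rewrite mmapXU mevalXU.
  - by move=> hf hg; rewrite rmorphD mevalD; exact: specD.
  - by move=> hf hg; rewrite rmorphM mevalM; exact: specM.
move=> F0; case: specF => a [b [b0 aE ->]].
have : cls a = 0.
  by apply/eqP; move/eqP: aE; rewrite F0 eq_sym mulf_eq0 invr_eq0 (negPf (cls_neq0 Xz b0)) orbF.
by move=> /cls_eq0/(_ z Xz) ->; rewrite mul0r.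
Qed.

End ConeSpecialization.

Definition seg n m (i : 'I_n.+1) (j : 'I_m.+1) : 'I_(n.+1 * m.+1).-1.+1 := mxvec_index i j.

Lemma segre_coord (K : closedFieldType) n m (x : 'rV[K]_n.+1) (y : 'rV[K]_m.+1) i j :
  segre x y 0 (seg i j) = x 0 i * y 0 j.
Proof. by have := mxvecE (x^T *m y) i j; rewrite mxE big_ord1 !mxE. Qed.

Lemma meval_cubic n (C : comNzRingType) (a : nat -> C) (v : 'I_n -> C) p q r :
  (cubic (@mpolyC n C \o a) p q r).@[v] = cubic a p.@[v] q.@[v] r.@[v].
Proof. by rewrite /meval mmap_cubic. Qed.

(** * The generic point of a Segre product *)

Section ProductGeometry.
Variables (C : closedFieldType) (E F : projVariety C 2).
Hypotheses (E_elliptic : elliptic_curve E) (F_elliptic : elliptic_curve F).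
Variables (L : fieldType) (cls : {rmorphism {mpoly C[(3 * 3).-1.+1]} -> L}).
Hypothesis cls_eq0 : forall p, cls p = 0 <-> forall z, segre_set E F z -> p.@[z 0] = 0.
Local Notation iota := (cls_const cls).

Local Notation Z i j := (cls 'X_(seg i j)).

Lemma seg_meval (i j : 'I_3) (x y : 'rV[C]_3) :
  ('X_(seg i j) : {mpoly C[(3 * 3).-1.+1]}).@[segre x y 0] = x 0 i * y 0 j.
Proof. by rewrite mevalXU; exact: segre_coord. Qed.

Lemma seg_minor i j k l : Z i j * Z k l = Z i l * Z k j.
Proof.
rewrite -!rmorphM; apply: (cls_eq cls_eq0) => _ [x [y [_ _ ->]]].
by rewrite !mevalM !seg_meval; ring.
Qed.

Lemma product_generic_pair : exists (a b : nat -> C) (xi eta : 'rV[L]_3),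
  [/\ smooth_cubic a /\ smooth_cubic b, generic_pair iota a b xi eta,
    (exists2 v : 'rV[C]_3, v != 0 & cubicv a v = 0) /\
    (exists2 v : 'rV[C]_3, v != 0 & cubicv b v = 0) &
    (forms_field cls : set L) = adj iota (coordinates xi eta)].
Proof.
have [a [sa Ea]] := elliptic_cubic E_elliptic.
have [b [sb Fb]] := elliptic_cubic F_elliptic.
have [[x0 Ex0] _] := pv_irreducible E; have [[y0 Fy0] _] := pv_irreducible F.
have [x00 ax0] := (Ea x0).1 Ex0; have [y00 by0] := (Fb y0).1 Fy0.
have [k xk] := vec_neq0 x00; have [l yl] := vec_neq0 y00.
have XS x y : pv_set E x -> pv_set F y -> segre_set E F (segre x y) by move=> *; exists x, y.
have Zneq i j x y : pv_set E x -> pv_set F y -> x 0 i != 0 -> y 0 j != 0 -> Z i j != 0.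
  move=> Ex Fy xi yj; apply: (cls_neq0 cls_eq0 (XS _ _ Ex Fy)).
  by rewrite seg_meval mulf_neq0.
have Zkl : Z k l != 0 by exact: Zneq Ex0 Fy0 xk yl.
(* The indices [k], [l] are coordinates not vanishing at chosen closed points; the vanishing minors
   then give [Z i j] as [Z k l] times the product of coordinates. *)
pose xi : 'rV[L]_3 := \row_i (Z i l / Z k l); pose eta : 'rV[L]_3 := \row_j (Z k j / Z k l).
have xiE i : xi 0 i = Z i l / Z k l by rewrite mxE.
have etaE j : eta 0 j = Z k j / Z k l by rewrite mxE.
have ZE i j : Z i j = Z k l * (xi 0 i * eta 0 j).
  rewrite xiE etaE; have := seg_minor i j k l.
  move: (Z i j) (Z i l) (Z k j) (Z k l) Zkl => p q r s s0 pE.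
  by apply: (mulIf s0); rewrite pE; field.
clearbody xi eta.
have lin1 (M : 'M[C]_3) i j : cls (\sum_r M r i *: 'X_(seg r j)) =
    Z k l * eta 0 j * (xi *m map_mx iota M) 0 i.
  rewrite rmorph_sum mxE mulr_sumr; apply: eq_bigr => r _.
  by rewrite -mul_mpolyC rmorphM ZE [map_mx _ _ _ _]mxE /cls_const /=; ring.
have lin2 (M : 'M[C]_3) i j : cls (\sum_r M r i *: 'X_(seg j r)) =
    Z k l * xi 0 j * (eta *m map_mx iota M) 0 i.
  rewrite rmorph_sum mxE mulr_sumr; apply: eq_bigr => r _.
  by rewrite -mul_mpolyC rmorphM ZE [map_mx _ _ _ _]mxE /cls_const /=; ring.
have lin1E (M : 'M[C]_3) i j (x y : 'rV[C]_3) :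
    (\sum_r M r i *: ('X_(seg r j) : {mpoly C[_]})).@[segre x y 0] = (x *m M) 0 i * y 0 j.
  rewrite raddf_sum mxE mulr_suml; apply: eq_bigr => r _.
  by rewrite /= mevalZ seg_meval; ring.
have lin2E (M : 'M[C]_3) i j (x y : 'rV[C]_3) :
    (\sum_r M r i *: ('X_(seg j r) : {mpoly C[_]})).@[segre x y 0] = x 0 j * (y *m M) 0 i.
  rewrite raddf_sum mxE mulr_sumr; apply: eq_bigr => r _.
  by rewrite /= mevalZ seg_meval; ring.
have xi_neq0 (x : 'rV[C]_3) i : pv_set E x -> x 0 i != 0 -> xi 0 i != 0.
  move=> Ex xi0; have := Zneq i l x y0 Ex Fy0 xi0 yl.
  by apply: contraNneq => h; rewrite ZE h mul0r mulr0.
have eta_neq0 (y : 'rV[C]_3) j : pv_set F y -> y 0 j != 0 -> eta 0 j != 0.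
  move=> Fy yj; have := Zneq k j x0 y Ex0 Fy xk yj.
  by apply: contraNneq => h; rewrite ZE h !mulr0.
have cub1 : cubicv (iota \o a) xi = 0.
  have : cls (cubic (@mpolyC _ C \o a) 'X_(seg i0 l) 'X_(seg i1 l) 'X_(seg i2 l)) = 0.
    apply/cls_eq0 => _ [x [y [Ex Fy ->]]]; rewrite meval_cubic !seg_meval.
    have [_ ax] := (Ea x).1 Ex.
    by rewrite ![x 0 _ * _]mulrC cubicZ -[cubic _ _ _ _]/(cubicv a x) ax mulr0.
  rewrite rmorph_cubic.
  have Zil i : Z i l = Z k l * eta 0 l * xi 0 i by rewrite ZE; ring.
  rewrite (Zil i0) (Zil i1) (Zil i2) cubicZ => /eqP; rewrite mulf_eq0 expf_eq0 mulf_eq0 (negPf Zkl).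
  by rewrite (negPf (eta_neq0 _ _ Fy0 yl)) => /eqP.
have cub2 : cubicv (iota \o b) eta = 0.
  have : cls (cubic (@mpolyC _ C \o b) 'X_(seg k i0) 'X_(seg k i1) 'X_(seg k i2)) = 0.
    apply/cls_eq0 => _ [x [y [Ex Fy ->]]]; rewrite meval_cubic !seg_meval.
    have [_ ay] := (Fb y).1 Fy.
    by rewrite cubicZ -[cubic _ _ _ _]/(cubicv b y) ay mulr0.
  rewrite rmorph_cubic.
  have Zil j : Z k j = Z k l * xi 0 k * eta 0 j by rewrite ZE; ring.
  rewrite (Zil i0) (Zil i1) (Zil i2) cubicZ => /eqP; rewrite mulf_eq0 expf_eq0 mulf_eq0 (negPf Zkl).
  by rewrite (negPf (xi_neq0 _ _ Ex0 xk)) => /eqP.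
exists a, b, xi, eta; split=> //; last 2 first.
- by split; [exists x0|exists y0].
- apply/seteqP; split; last first.
    apply: adj_le => [c|_ [i [->|->]]]; first exact: forms_field_const.
      by rewrite xiE; exact: forms_field_ratio.
    by rewrite etaE; exact: forms_field_ratio.
  move=> _ [d [p [q [pd qd q0 ->]]]]; pose g m := cls 'X_m / Z k l.
  have hE m : cls 'X_m = Z k l * g m by rewrite /g mulrC divfK.
  rewrite (cls_mmap cls p) (cls_mmap cls q) (mmap_ratio iota pd qd Zkl hE).
  have Fg m : adj iota (coordinates xi eta) (g m).
    case/mxvec_indexP: (m : 'I_(3 * 3)) => i j; rewrite /g -/(seg i j) ZE mulrC mulKf //.
    by apply: sfM; apply: adj_sub; [exists i; left|exists j; right].
  by apply: sf_div; apply: sf_mmap => // c; exact: adj_iota.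
split=> //.
- by exists k; rewrite xiE divff.
- by exists l; rewrite etaE divff.
- move=> M i h v av; have [->|v0] := eqVneq v 0; first by rewrite mul0mx mxE.
  have Ev : pv_set E v by apply/Ea.
  have /cls_eq0 hz : cls (\sum_r M r i *: 'X_(seg r l)) = 0 by rewrite lin1 h mulr0.
  have := hz _ (XS _ _ Ev Fy0); rewrite lin1E => /eqP.
  by rewrite mulf_eq0 (negPf yl) orbF => /eqP.
- move=> M i h v bv; have [->|v0] := eqVneq v 0; first by rewrite mul0mx mxE.
  have Fv : pv_set F v by apply/Fb.
  have /cls_eq0 hz : cls (\sum_r M r i *: 'X_(seg k r)) = 0 by rewrite lin2 h mulr0.
  have := hz _ (XS _ _ Ex0 Fv); rewrite lin2E => /eqP.
  by rewrite mulf_eq0 (negPf xk) => /eqP.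
move=> M N G /= x00' y00' G0 v w av bw vM0 wN0.
have v0 : v != 0 by apply: contraNneq vM0 => ->; rewrite mul0mx mxE.
have w0 : w != 0 by apply: contraNneq wN0 => ->; rewrite mul0mx mxE.
have Ev : pv_set E v by apply/Ea.
have Fw : pv_set F w by apply/Fb.
(* The Segre coordinates used in numerators and denominators are adapted to the pair [v], [w], so
   that the denominators do not vanish there. *)
have [k' vk'] := vec_neq0 v0; have [l' wl'] := vec_neq0 w0.
pose P (i : 'I_3) : {mpoly C[(3 * 3).-1.+1]} := \sum_r M r i *: 'X_(seg r l').
pose Q (i : 'I_3) : {mpoly C[(3 * 3).-1.+1]} := \sum_r N r i *: 'X_(seg k' r).
have PQ : (fun i => cls (pair2 (P i1) (Q i1) i) / cls (pair2 (P i0) (Q i0) i))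
  =1 pair2 ((xi *m map_mx iota M) 0 i1 / (xi *m map_mx iota M) 0 i0)
           ((eta *m map_mx iota N) 0 i1 / (eta *m map_mx iota N) 0 i0).
  move=> i; rewrite /pair2; case: ifP => _; rewrite ?lin1 ?lin2 -mulf_div divff ?mul1r //.
    by rewrite mulf_neq0 // (eta_neq0 _ _ Fw wl').
  by rewrite mulf_neq0 // (xi_neq0 _ _ Ev vk').
have PQ0 i : (pair2 (P i0) (Q i0) i).@[segre v w 0] != 0.
  by rewrite /pair2; case: ifP => _; rewrite ?lin1E ?lin2E mulf_neq0.
have := specialization cls_eq0 (XS _ _ Ev Fw) PQ0 (etrans (mmap_eq iota G PQ) G0).
move=> <-; apply: meval_eq => i; rewrite /pair2; case: ifP => _.
  by rewrite !lin1E -mulf_div divff // mulr1.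
by rewrite !lin2E -mulf_div divff // mul1r.
Qed.

End ProductGeometry.

(** * Affine coordinates of a plane field *)

Section AffineChart.
Variables (C : closedFieldType) (L : fieldType) (iota : {rmorphism C -> L}) (l u : L).

Definition chart (T : pzSemiRingType) (x y : T) (i : 'I_3) : T := nth 0 [:: 1; x; y] i.

Lemma chart_algebraically_independent d (q : {mpoly C[3]}) : ~ range iota l ->
  ~ algcl (adj iota [set l]) u -> q \is d.-homog -> mmap iota (chart l u) q = 0 -> q = 0.
Proof.
move=> lC ul qd q0.
pose t : 3.-tuple {mpoly C[2]} := [tuple 1; 'X_ord0; 'X_ord_max].
have g0 : q \mPo t = 0.
  apply: bivariate_eq0; apply: (transcendental_pair lC ul).
  rewrite bivariateE mmap_mPo -[RHS]q0; apply: mmap_eq; apply: ord3P;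
  by rewrite (tnth_nth 0) /chart /= ?rmorph1 ?mmapXU.
(* The dehomogenised polynomial controls [q] only off the line [X_0 = 0]; the extra factor covers
   that line. *)
have : q * 'X_i0 = 0.
  apply: mpoly_eq0 => v; rewrite mevalM mevalXU.
  have [->|v0] := eqVneq (v i0) 0; first by rewrite mulr0.
  have vE : v =1 fun i => v i0 * chart (v i1 / v i0) (v i2 / v i0) i.
    apply: ord3P; rewrite /chart /= ?mulr1 //.
      by rewrite mulrC divfK.
    by rewrite mulrC divfK.
  have qE : q.@[v] = v i0 ^+ d * q.@[chart (v i1 / v i0) (v i2 / v i0)].
    rewrite (meval_eq q vE) /meval; exact: mmap_homogZ.
  rewrite qE; have := congr1 (meval (pair2 (v i1 / v i0) (v i2 / v i0))) g0.
  rewrite meval0 comp_mpoly_meval => h.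
  rewrite (_ : q.@[_] = 0) ?mulr0 ?mul0r // -[RHS]h; apply: meval_eq; apply: ord3P;
  by rewrite (tnth_nth 0) /chart /= ?meval1 ?mevalXU.
move/eqP; rewrite mulf_eq0 => /orP[/eqP //|/eqP h].
have := congr1 (meval (fun=> 1)) h; rewrite meval0 mevalXU => /eqP.
by rewrite oner_eq0.
Qed.

Lemma chart_multiple_eq0 (phi : 'I_3 -> L) z d p : ~ range iota l ->
  ~ algcl (adj iota [set l]) u -> z != 0 -> (forall i, phi i = z * chart l u i) ->
  p \is d.-homog -> mmap iota phi p = 0 -> p = 0.
Proof.
move=> lC ul z0 phiE pd; rewrite (mmap_eq iota p phiE) => h.
apply: (chart_algebraically_independent lC ul pd).
have : z ^+ d * mmap iota (chart l u) p = 0.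
  by rewrite -[RHS]h; apply: esym; exact: mmap_homogZ.
by move/eqP; rewrite mulf_eq0 expf_eq0 (negPf z0) andbF => /eqP.
Qed.

Lemma forms_field_chart (phi : 'I_3 -> L) z : z != 0 ->
  (forall i, phi i = z * chart l u i) ->
  (forms_field (mmap iota phi) : set L) = adj iota [set l; u].
Proof.
move=> z0 phiE; apply/seteqP; split.
  move=> _ [d [p [q [pd qd q0 ->]]]]; rewrite [mmap _ _ p / _](mmap_ratio iota pd qd z0 phiE).
  have Kc c : adj iota [set l; u] (iota c) by exact: adj_iota.
  have Kchart i : adj iota [set l; u] (chart l u i).
    move: i; apply: ord3P; rewrite /chart [nth _ _ _]/=; first exact: sf1.
      by apply: adj_sub; left.
    by apply: adj_sub; right.
  by apply: sf_div; exact: sf_mmap.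
have X0 : mmap iota phi 'X_i0 != 0 by rewrite mmapXU phiE /chart /= mulr1.
apply: adj_le => [c|_ [->|->]].
- by have := forms_field_const (mmap iota phi) c; rewrite /= mmapC.
- have := @forms_field_ratio _ _ _ (mmap iota phi) i1 i0 X0.
  by rewrite /= !mmapXU !phiE /chart /= mulr1 [z * l]mulrC mulfK.
- have := @forms_field_ratio _ _ _ (mmap iota phi) i2 i0 X0.
  by rewrite /= !mmapXU !phiE /chart /= mulr1 [z * u]mulrC mulfK.
Qed.

End AffineChart.

Lemma chart_forms (C L : fieldType) n (cls : {rmorphism {mpoly C[n]} -> L})
    (a1 b1 a2 b2 : {mpoly C[n]}) : cls b1 != 0 -> cls b2 != 0 -> forall i,
  cls (tnth [tuple b1 * b2; a1 * b2; b1 * a2] i)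
  = cls (b1 * b2) * chart (cls a1 / cls b1) (cls a2 / cls b2) i.
Proof.
have E1 (p q s : L) : q != 0 -> p * s = q * s * (p / q) by move=> q0; field.
have E2 (q r s : L) : s != 0 -> q * r = q * s * (r / s) by move=> s0; field.
move=> b10 b20; apply: ord3P; rewrite (tnth_nth 0) /chart /= ?mulr1 // !rmorphM.
  exact: E1.
exact: E2.
Qed.

Lemma forms_field_sub (C L : fieldType) (iota : {rmorphism C -> L}) n
    (phi : 'I_n -> L) (F : subfld L) i : (forall c, F (iota c)) -> phi i != 0 ->
  (forall j, F (phi j / phi i)) -> forall z, forms_field (mmap iota phi) z -> F z.
Proof.
move=> FC phi0 Fphi _ [d [p [q [pd qd q0 ->]]]].
have phiE j : phi j = phi i * (phi j / phi i) by rewrite mulrC divfK.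
have -> := mmap_ratio iota pd qd phi0 phiE.
by apply: sf_div; exact: sf_mmap.
Qed.

(** * Dominance as injectivity on forms *)

Section RationalMaps.
Variables (C : closedFieldType) (n : nat) (X : projVariety C n).
Local Notation L := {fraction hcoord X}.

Definition hcls : {rmorphism {mpoly C[n.+1]} -> L} :=
  @FracField.tofrac (hcoord X) \o hcoord_pi X.

Lemma hcls_eq0 p : hcls p = 0 <-> forall x, pv_set X x -> p.@[x 0] = 0.
Proof. exact: hclass_eq0. Qed.

Lemma function_fieldE : function_field X = forms_field hcls. Proof. by []. Qed.

Lemma cls_comp (R : fieldType) (cls : {rmorphism {mpoly C[n.+1]} -> R}) m
    (t : m.-tuple {mpoly C[n.+1]}) p :
  cls (p \mPo t) = mmap (cls_const cls) (fun i => cls (tnth t i)) p.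
Proof.
rewrite cls_mmap mmap_mPo; apply: mmap_eq => i; exact: esym (cls_mmap _ _).
Qed.

Lemma pullback_fieldE m (f : rationalMap X m) : pullback_field f =
  forms_field (mmap (cls_const hcls) (fun i => hcls (tnth (rm_forms f) i))).
Proof.
have E p : hclass X (p \mPo rm_forms f) =
    mmap (cls_const hcls) (fun i => hcls (tnth (rm_forms f) i)) p.
  exact: (@cls_comp _ hcls m.+1 (rm_forms f) p).
apply/seteqP; split=> z [d [a [b [ad bd b0 zE]]]]; exists d, a, b; move: b0 zE.
  by rewrite !E.
by rewrite /= -!E.
Qed.

(** The zeros of [p] form a closed set containing the image, hence contain every nonzero vector; the
    factor ['X_ord0] in the proof takes care of the zero vector. *)
Lemma dominant_inj m (f : rationalMap X m) d (p : {mpoly C[m.+1]}) :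
  dominant f -> p \is d.-homog ->
  mmap (cls_const hcls) (fun i => hcls (tnth (rm_forms f) i)) p = 0 -> p = 0.
Proof.
move=> fdom pd p0; have closed : proj_closed (proj_zeros [set p]).
  by exists [set p]; split=> // _ ->; apply/homogP; exists d.
have pv (y : 'rV[C]_m.+1) : y != 0 -> p.@[y 0] = 0.
  move=> y0; have [|_] := fdom _ closed _ y y0; last by apply.
  move=> x Xx fx0; split=> // _ ->.
  have /hcls_eq0/(_ x Xx) : hcls (p \mPo rm_forms f) = 0.
    exact: etrans (@cls_comp _ hcls _ _ _) p0.
  by rewrite comp_mpoly_meval => <-; apply: meval_eq => i; rewrite mxE.
have : p * 'X_ord0 = 0.
  apply: mpoly_eq0 => v; rewrite mevalM mevalXU.
  have [->|v0] := eqVneq (v ord0) 0; first by rewrite mulr0.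
  have /pv : \row_i v i != 0 by apply/rV0Pn; exists ord0; rewrite mxE.
  by rewrite (_ : p.@[_] = p.@[v]) => [->|]; [rewrite mul0r|apply: meval_eq => i; rewrite mxE].
move/eqP; rewrite mulf_eq0 => /orP[/eqP //|/eqP h].
have := congr1 (meval (fun=> 1)) h; rewrite meval0 mevalXU => /eqP.
by rewrite oner_eq0.
Qed.

(** A form vanishing on the image pulls back to zero once it is multiplied by a component [i] of [f]
    that is nonzero on [X]: where that component vanishes the product does, elsewhere [f] is
    defined. *)
Lemma inj_dominant m (f : rationalMap X m) :
  (forall d (p : {mpoly C[m.+1]}), p \is d.-homog ->
    mmap (cls_const hcls) (fun i => hcls (tnth (rm_forms f) i)) p = 0 -> p = 0) ->
  dominant f.
Proof.
move=> inj A [S [hS AE]] fA y y0; rewrite AE; split=> // q Sq.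
have /homogP[d qd] := hS q Sq; rewrite (inj d q qd) ?meval0 //.
have [i fi] := rm_neq0 f.
have : hcls (q \mPo rm_forms f) * hcls (tnth (rm_forms f) i) = 0.
  rewrite -rmorphM; apply/hcls_eq0 => x Xx; rewrite mevalM.
  have [x0|x0] := eqVneq (tnth (rm_forms f) i).@[x 0] 0; first by rewrite x0 mulr0.
  have fx0 : rm_eval f x != 0 by apply/rV0Pn; exists i; rewrite mxE.
  have := fA x Xx fx0; rewrite AE => -[_ /(_ q Sq)].
  rewrite comp_mpoly_meval => h; rewrite (_ : q.@[_] = 0) ?mul0r // -[RHS]h.
  by apply: meval_eq => j; rewrite mxE.
move/eqP; rewrite mulf_eq0 => /orP[/eqP h|/eqP h]; last by move/eqP: fi; case.
exact: etrans (esym (@cls_comp _ hcls _ _ _)) h.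
Qed.

End RationalMaps.

(** * Assembly of the two bounds *)

Section Product.
Variables (C : closedFieldType) (E F : projVariety C 2).
Hypotheses (E_elliptic : elliptic_curve E) (F_elliptic : elliptic_curve F).
Hypothesis char0 : forall n, n.+1%:R != 0 :> C.
Let X := prod_variety E F.
Local Notation cls := (hcls X).
Local Notation iota := (cls_const cls).

Lemma irr_product : irr_eq X 3.
Proof.
have [a [b [xi [eta [[sa sb] gp [apt bpt] FE]]]]] :=
  product_generic_pair E_elliptic F_elliptic (hcls_eq0 X).
have funE : function_field X = adj iota (coordinates xi eta) := FE.
have [v v0 av] := apt; have [w w0 bw] := bpt.
have [N _] := exists_normal_form sa v0 av; have [N' _] := exists_normal_form sb w0 bw.
have Fcoord i : function_field X (xi 0 i) /\ function_field X (eta 0 i).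
  by rewrite funE; split; apply: adj_sub; exists i; [left|right].
have FC c : function_field X (iota c) by rewrite funE; exact: adj_iota.
have ge3 (f : rationalMap X 2) e : dominant f -> map_degree f e -> (3 <= e)%N.
  move=> fdom; rewrite /map_degree pullback_fieldE function_fieldE => deg.
  set phi := fun i => _ in deg.
  have [i fi] := rm_neq0 f; have phii : phi i != 0 := fi.
  have phiF j : forms_field cls (phi j / phi i).
    by exists (rm_deg f), (tnth (rm_forms f) j), (tnth (rm_forms f) i); split=> //; exact: rm_homog.
  apply: (plane_degree_ge3 char0 _ (fun d p => dominant_inj fdom) sa sb gp _ _ _ bpt apt deg).
  - by [].
  - exact: Fcoord.
  - by move=> z; rewrite -FE.
  - exact: (forms_field_sub (F := forms_field cls) FC phii phiF).
exists 2%N; split=> //.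
- pose t := nf_t iota N xi; pose t' := nf_t iota N' eta.
  have [Ft _] : function_field X t /\ function_field X (nf_w iota N xi).
    by apply: (@nf_sub _ _ iota _ N xi (forms_field cls)) => // i; case: (Fcoord i).
  have [Ft' _] : function_field X t' /\ function_field X (nf_w iota N' eta).
    by apply: (@nf_sub _ _ iota _ N' eta (forms_field cls)) => // i; case: (Fcoord i).
  exists [tuple t; t']; split.
  + by case=> [[|[|//]] hi]; rewrite (tnth_nth 0).
  + move=> p p0; apply: (gp_independent gp (N := N) (N' := N')).
    apply: etrans p0; apply: mmap_eq => -[[|[|//]] hi]; by rewrite (tnth_nth 0).
  + move=> u Fu indep.
    pose h := tnth [tuple of rcons [tuple t; t'] u].
    have [|p /eqP p0 ph] := @algebraic_dependent C _ iota 2 h; last exact: p0 (indep p ph).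
    have hu : h ord_max = u by rewrite /h (tnth_nth 0).
    rewrite hu; move: Fu; rewrite funE => /(@gp_algebraic _ _ iota char0 _ _ _ _ gp N N' u).
    apply: algOverS; apply: adj_le => [c|_ [->|->]]; first exact: adj_iota.
      by apply: adj_sub; exists ord0; rewrite // /h /= (tnth_nth 0).
    by apply: adj_sub; exists ord_max; rewrite // /h /= (tnth_nth 0).
have [l [u [Fl Fu lC ul [d d3 deg]]]] := generic_pair_cubic char0 gp N N'.
have Xl : function_field X l by rewrite funE.
have Xu : function_field X u by rewrite funE.
have [d1 [a1 [b1 [a1d b1d b10 lE]]]] := Xl.
have [d2 [a2 [b2 [a2d b2d b20 uE]]]] := Xu.
(* With common denominator, these forms define the rational map whose affine coordinates are
   [l = a1 / b1] and [u = a2 / b2]. *)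
pose forms := [tuple b1 * b2; a1 * b2; b1 * a2].
have forms_homog i : tnth forms i \is (d1 + d2).-homog.
  by move: i; apply: ord3P; rewrite (tnth_nth 0) /=; exact: dhomogM.
have b120 : cls (b1 * b2) != 0 by rewrite rmorphM; exact: mulf_neq0 b10 b20.
have forms0 : cls (tnth forms i0) != 0 := b120.
pose f : rationalMap X 2 := RationalMap forms_homog (ex_intro _ i0 forms0).
have phiE : forall i, cls (tnth (rm_forms f) i) = cls (b1 * b2) * chart l u i.
  by rewrite lE uE; exact: (chart_forms (cls := cls) a1 a2 b10 b20).
have fdom : dominant f.
  by apply: inj_dominant => e p; exact: chart_multiple_eq0 lC ul b120 phiE.
exists f; split=> //.
have fdeg : map_degree f d.
  by rewrite /map_degree pullback_fieldE (forms_field_chart iota b120 phiE) funE.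
have d3E : d = 3%N by apply/eqP; rewrite eqn_leq d3 (ge3 f d fdom fdeg).
by move: fdeg; rewrite d3E.
Qed.

End Product.

Theorem theorem1p1 (R : realType) (E F : projVariety R[i] 2) :
  elliptic_curve E -> elliptic_curve F -> irr_eq (prod_variety E F) 3.
Proof.
by move=> Ee Fe; apply: irr_product => // n; rewrite Num.Theory.pnatr_eq0.
Qed.
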